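(* With the notation of the context, assume in addition that $W$ is isotropic, i.e. $W(FR)=W(F)$ for all $F\in\mathbb R^{3\times3}$, $R\in SO(3)$, so that $\mathcal Q_3(F)=2\mu|\mathrm{sym}\,F|^2+\lambda|\mathrm{Tr}\,F|^2$ with Lam\'e constants $\mu,\lambda$. Then the Euler-Lagrange equations of the functional $\mathcal I^{In}_g$ are the following: if $(w,v)\in W^{1,2}(\Omega,\mathbb R^2)\times W^{2,2}(\Omega,\mathbb R)$ is a critical point of $\mathcal I^{In}_g$, then there is an Airy stress potential $\tilde\Phi\in W^{2,2}(\Omega,\mathbb R)$, related to $w$ and $v$ by $$\mathrm{cof}\,\nabla^2\tilde\Phi=2\mu\Big(\mathrm{sym}\,\nabla w+\tfrac12\nabla v\otimes\nabla v-(\mathrm{sym}\,\epsilon_g)_{2\times2}+\big(\mathrm{div}\,w+\mathrm{Tr}\big(\tfrac12\nabla v\otimes\nabla v-(\mathrm{sym}\,\epsilon_g)_{2\times2}\big)\big)\mathrm{Id}_2\Big),$$ such that, in the sense of distributions in $\Omega$, $$\Delta^2\tilde\Phi=-\frac{3\mu}{2}[v,v]-3\mu\,\mathrm{curl}^T\mathrm{curl}\,(\epsilon_g)_{2\times2},$$ $$\frac\mu3\Delta^2v=[v,\tilde\Phi]-\frac\mu3\,\mathrm{div}^T\mathrm{div}\Big((\mathrm{sym}\,\kappa_g)_{2\times2}+\frac12\,\mathrm{cof}\,(\mathrm{sym}\,\kappa_g)_{2\times2}\Big).$$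
   Context: $\Omega\subset\mathbb R^2$ is an open, bounded, simply connected domain; $\epsilon_g,\kappa_g:\bar\Omega\to\mathbb R^{3\times3}$ are given smooth matrix fields; for $F\in\mathbb R^{3\times3}$, $F_{2\times2}$ is its principal (upper left) $2\times2$ minor matrix and $\mathrm{sym}\,F=\frac12(F+F^T)$. The density $W:\mathbb R^{3\times3}\to\mathbb R_+$ satisfies: (1) $W(RF)=W(F)$ for all $R\in SO(3)$, $F\in\mathbb R^{3\times3}$; (2) $W(\mathrm{Id}_3)=0$; (3) $W(F)\ge c\,\mathrm{dist}^2(F,SO(3))$ for some $c>0$; (4) $W$ is $\mathcal C^2$ in a $\delta$-neighborhood of $SO(3)$. Set $\mathcal Q_3(\tilde F)=\nabla^2W(\mathrm{Id}_3)(\tilde F,\tilde F)$ and, for $F\in\mathbb R^{2\times2}$, $\mathcal Q_2^{In}(F)=\min\{\mathcal Q_3(\tilde F)\mid\tilde F\in\mathbb R^{3\times3},\ \tilde F_{2\times2}=F,\ \mathrm{Tr}\,\tilde F=0\}$. The functional is $$\mathcal I^{In}_g(w,v)=\frac12\int_\Omega\mathcal Q_2^{In}\Big(\mathrm{sym}\,\nabla w+\tfrac12\nabla v\otimes\nabla v-(\mathrm{sym}\,\epsilon_g)_{2\times2}\Big)\mathrm dx'+\frac1{24}\int_\Omega\mathcal Q_2^{In}\big(\nabla^2v+(\mathrm{sym}\,\kappa_g)_{2\times2}\big)\mathrm dx'.$$ A critical point is a pair $(w,v)$ with $\mathcal I^{In}_g(w,v)<\infty$ and $\frac{\mathrm d}{\mathrm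 dt}\big|_{t=0}\mathcal I^{In}_g(w+t\eta,v+t\varphi)=0$ for all $\eta\in\mathcal C^\infty(\bar\Omega,\mathbb R^2)$, $\varphi\in\mathcal C^\infty(\bar\Omega,\mathbb R)$ (free boundary conditions), where $\mathcal C^\infty(\bar\Omega)$ denotes restrictions to $\bar\Omega$ of smooth functions on $\mathbb R^2$. For $A\in\mathbb R^{2\times2}$, $\mathrm{cof}\,A$ is its cofactor matrix. The Airy bracket is $[v,\phi]=\nabla^2v:(\mathrm{cof}\,\nabla^2\phi)=\partial_{11}v\,\partial_{22}\phi+\partial_{22}v\,\partial_{11}\phi-2\partial_{12}v\,\partial_{12}\phi$. For a $2\times2$ matrix field $A=(A_{ij})$: $\mathrm{curl}^T\mathrm{curl}\,A=\partial_{22}A_{11}-\partial_{12}(A_{12}+A_{21})+\partial_{11}A_{22}$ and $\mathrm{div}^T\mathrm{div}\,A=\sum_{i,j}\partial_i\partial_jA_{ij}$. *)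

(* Defs.v *)
From HB Require Import structures.
From mathcomp Require Import all_boot all_order all_algebra.
From mathcomp Require Import all_classical all_reals all_analysis.
Set Implicit Arguments.
Unset Strict Implicit.
Unset Printing Implicit Defensive.
Import Order.TTheory GRing.Theory Num.Theory.
Import numFieldNormedType.Exports.
Local Open Scope classical_set_scope.
Local Open Scope ring_scope.

(* The plane is [R * R], with its product topology, its Borel sigma-algebra   *)
(* and the product Lebesgue measure [leb2].  Coordinates are indexed by 'I_2: *)
(* the indices 1, 2 of the usual notation are 0, 1 here.                      *)

Definition sym (R : realType) (n : nat) (F : 'M[R]_n) : 'M[R]_n :=
  2^-1 *: (F + F^T).

Definition minor22 (R : realType) (F : 'M[R]_3) : 'M[R]_2 :=
  @ulsubmx R 2 1 2 1 F.

Definition cof (R : realType) (n : nat) (A : 'M[R]_n) : 'M[R]_n :=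
  \matrix_(i, j) cofactor A i j.

Definition inner (R : realType) (n : nat) (A B : 'M[R]_n) : R :=
  \sum_i \sum_j A i j * B i j.

Definition frob (R : realType) (n : nat) (A : 'M[R]_n) : R :=
  Num.sqrt (inner A A).

Definition SO3 (R : realType) : set 'M[R]_3 :=
  [set Q | Q^T *m Q = 1%:M /\ \det Q = 1].

Definition dist_SO3 (R : realType) (F : 'M[R]_3) : R :=
  inf [set frob (F - Q) | Q in @SO3 R].

(* [f] is of class C^k on the open set [D]: all its iterated directional      *)
(* derivatives of order at most [k] exist and are continuous on [D]; in       *)
(* finite dimension this is the usual notion.                                 *)
Fixpoint Ck_on (R : realType) (V : normedModType R) (k : nat) (D : set V)
    (f : V -> R) : Prop :=
  (forall x, D x -> {for x, continuous f}) /\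
  match k with
  | 0%N => True
  | k'.+1 => forall u : V,
      (forall x, D x -> derivable f x u) /\ Ck_on k' D (fun x => 'D_u f x)
  end.

Definition smooth (R : realType) (f : R * R -> R) : Prop :=
  forall k, Ck_on k [set: R * R] f.

(* restrictions to the closure of Omega of smooth functions on the plane      *)
Definition smooth_closure (R : realType) (Omega : set (R * R))
    (f : R * R -> R) : Prop :=
  exists2 g, smooth g & {in closure Omega, f =1 g}.

(* Nullhomotopy of loops, rel endpoints: [H (s, t)] is the point of parameter *)
(* [t] on the loop at time [s] of the homotopy.                               *)
Definition simply_connected (R : realType) (Omega : set (R * R)) : Prop :=
  connected Omega /\
  forall gamma : R -> R * R,
    {within `[0, 1], continuous gamma} ->
    (forall t, t \in `[0, 1] -> Omega (gamma t)) ->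
    gamma 0 = gamma 1 ->
    exists H : R * R -> R * R,
      [/\ {within `[0, 1] `*` `[0, 1], continuous H},
          (forall s t, s \in `[0, 1] -> t \in `[0, 1] -> Omega (H (s, t))),
          (forall t, t \in `[0, 1] -> H (0, t) = gamma t),
          (forall t, t \in `[0, 1] -> H (1, t) = gamma 0) &
          (forall s, s \in `[0, 1] -> H (s, 0) = gamma 0 /\ H (s, 1) = gamma 0)].

(* The Hessian of W at the identity, as a quadratic form. *)
Definition Q3 (R : realType) (W : 'M[R]_3 -> R) (F : 'M[R]_3) : R :=
  'D_F (fun G => 'D_F W G) 1%:M.

(* The infimum is attained whenever [Q3 W] is a nonnegative quadratic form,   *)
(* as it is for the densities considered; it is then the minimum.             *)
Definition Q2In (R : realType) (W : 'M[R]_3 -> R) (F : 'M[R]_2) : R :=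
  inf [set Q3 W Ft | Ft in [set Ft | minor22 Ft = F /\ \tr Ft = 0]].

Definition leb2 (R : realType) :
    {measure set (measurableTypeR R * measurableTypeR R) -> \bar R} :=
  (@lebesgue_measure R \x @lebesgue_measure R)%E.

Definition L2 (R : realType) (Omega : set (R * R)) (f : R * R -> R) : Prop :=
  measurable_fun (Omega : set (measurableTypeR R * measurableTypeR R)) f /\
  (\int[@leb2 R]_(x in Omega) ((f x) ^+ 2)%:E < +oo)%E.

Definition loc_integrable (R : realType) (Omega : set (R * R))
    (f : R * R -> R) : Prop :=
  forall K, compact K -> K `<=` Omega -> (@leb2 R).-integrable K (EFin \o f).

Definition test_fun (R : realType) (Omega : set (R * R))
    (phi : R * R -> R) : Prop :=
  smooth phi /\
  exists K, [/\ compact K, K `<=` Omega & forall x, ~ K x -> phi x = 0].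

Definition dir (R : realType) (i : 'I_2) : R * R :=
  if i == 0 then (1, 0) else (0, 1).

(* Distributions on [Omega] are represented by functionals that are only      *)
(* ever evaluated at the test functions of [Omega].                           *)
Definition distr (R : realType) := (R * R -> R) -> R.

Definition regular (R : realType) (Omega : set (R * R)) (f : R * R -> R) :
    distr R :=
  fun phi => (\int[@leb2 R]_(x in Omega) (f x * phi x))%R.

Definition dpartial (R : realType) (i : 'I_2) (T : distr R) : distr R :=
  fun phi => - T (fun x => 'D_(dir R i) phi x).

Definition dlaplacian (R : realType) (T : distr R) : distr R :=
  fun phi => \sum_i dpartial i (dpartial i T) phi.

(* curl^T curl and div^T div of a locally integrable matrix field.            *)
Definition curlTcurl (R : realType) (Omega : set (R * R))
    (A : R * R -> 'M[R]_2) : distr R :=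
  fun phi =>
    dpartial 1 (dpartial 1 (regular Omega (fun x => A x 0 0))) phi
    - dpartial 0 (dpartial 1 (regular Omega (fun x => A x 0 1 + A x 1 0))) phi
    + dpartial 0 (dpartial 0 (regular Omega (fun x => A x 1 1))) phi.

Definition divTdiv (R : realType) (Omega : set (R * R))
    (A : R * R -> 'M[R]_2) : distr R :=
  fun phi =>
    \sum_i \sum_j dpartial i (dpartial j (regular Omega (fun x => A x i j))) phi.

Definition is_weak_partial (R : realType) (Omega : set (R * R)) (i : 'I_2)
    (f g : R * R -> R) : Prop :=
  [/\ loc_integrable Omega f, loc_integrable Omega g &
      forall phi, test_fun Omega phi ->
        dpartial i (regular Omega f) phi = regular Omega g phi].

(* Sobolev space W^{k,2}(Omega) *)
Fixpoint sobolev (R : realType) (Omega : set (R * R)) (k : nat)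
    (f : R * R -> R) : Prop :=
  L2 Omega f /\
  match k with
  | 0%N => True
  | k'.+1 => forall i, exists2 g, is_weak_partial Omega i f g &
                                  sobolev Omega k' g
  end.

(* A chosen representative of the weak partial derivative, which is unique    *)
(* up to a.e. equality in [Omega]; junk when there is none.                   *)
Definition wpartial (R : realType) (Omega : set (R * R)) (i : 'I_2)
    (f : R * R -> R) : R * R -> R :=
  xget (fun=> 0) [set g | is_weak_partial Omega i f g].

Definition wgrad (R : realType) (Omega : set (R * R)) (v : R * R -> R)
    (x : R * R) : 'cV[R]_2 :=
  \col_i wpartial Omega i v x.

Definition whess (R : realType) (Omega : set (R * R)) (v : R * R -> R)
    (x : R * R) : 'M[R]_2 :=
  \matrix_(i, j) wpartial Omega j (wpartial Omega i v) x.

Definition wjac (R : realType) (Omega : set (R * R)) (w : R * R -> 'cV[R]_2)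
    (x : R * R) : 'M[R]_2 :=
  \matrix_(i, j) wpartial Omega j (fun y => w y i 0) x.

Definition wdiv (R : realType) (Omega : set (R * R)) (w : R * R -> 'cV[R]_2)
    (x : R * R) : R :=
  \sum_i wpartial Omega i (fun y => w y i 0) x.

Definition tensor (R : realType) (a b : 'cV[R]_2) : 'M[R]_2 := a *m b^T.

Definition airy (R : realType) (Omega : set (R * R)) (v phi : R * R -> R)
    (x : R * R) : R :=
  inner (whess Omega v x) (cof (whess Omega phi x)).

(* The functional takes values in [0, +oo], the integrands being nonnegative. *)
Definition energy (R : realType) (Omega : set (R * R)) (W : 'M[R]_3 -> R)
    (eps_g kappa_g : R * R -> 'M[R]_3)
    (w : R * R -> 'cV[R]_2) (v : R * R -> R) : \bar R :=
  ((2^-1)%:E *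
     \int[@leb2 R]_(x in Omega)
       (Q2In W (sym (wjac Omega w x)
                + 2^-1 *: tensor (wgrad Omega v x) (wgrad Omega v x)
                - minor22 (sym (eps_g x))))%:E
   + (24^-1)%:E *
     \int[@leb2 R]_(x in Omega)
       (Q2In W (whess Omega v x + minor22 (sym (kappa_g x))))%:E)%E.

(* Free boundary conditions: the variations are smooth up to the boundary.    *)
(* Finiteness of the energy at (w, v) entails its finiteness at all           *)
(* (w + t eta, v + t phi), so that [fine] loses nothing.                      *)
Definition critical_point (R : realType) (Omega : set (R * R))
    (W : 'M[R]_3 -> R) (eps_g kappa_g : R * R -> 'M[R]_3)
    (w : R * R -> 'cV[R]_2) (v : R * R -> R) : Prop :=
  (energy Omega W eps_g kappa_g w v < +oo)%E /\
  forall (eta : R * R -> 'cV[R]_2) (phi : R * R -> R),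
    (forall i, smooth_closure Omega (fun x => eta x i 0)) ->
    smooth_closure Omega phi ->
    is_derive (0 : R) (1 : R)
      (fun t : R => fine (energy Omega W eps_g kappa_g
                            (fun x => w x + t *: eta x)
                            (fun x => v x + t * phi x)))
      (0 : R).

(* Main.v *)
Require Import Defs.
From HB Require Import structures.
From mathcomp Require Import all_boot all_order all_algebra.
From mathcomp Require Import all_classical all_reals all_analysis.
From mathcomp Require Import measurable_realfun ring lra.
Set Implicit Arguments.
Unset Strict Implicit.
Unset Printing Implicit Defensive.
Import Order.TTheory GRing.Theory Num.Theory.
Import numFieldNormedType.Exports.
Local Open Scope classical_set_scope.
Local Open Scope ring_scope.

                                                                              
                                                                          
                                                                              
                                                                                
                                                                        
                               

                                                                              
                                                                            
                                                                            
                                                                          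
                                                                              
                                                                              
                                                                               
                                                                              
                                                                          
                                                                        

                                                     

(** Algebra of the density. The Hessian of [W] at the identity is nonnegative, because [W] is
    minimal there, and it is invariant under [F -> Q F Q^T], by frame indifference on the left and
    isotropy on the right. It vanishes on skew matrices: for a skew generator [A], the matrix
    [1 + t A] is a rotation times a matrix at distance of order [t^2] from the identity, so [W] is
    of order [t^4] there. Such a form is [2 mu |sym F|^2 + lambda (tr F)^2] with [mu >= 0]
    ([Q3_isotropic]), and minimising over trace-free extensions leaves [2 mu (|sym F|^2 + (tr F)^2)]
    ([Q2In_isotropic]).

    First variation. The strain depends quadratically on the parameter of a perturbation, so the
    energy along it is a quartic polynomial whose linear coefficient must vanish
    ([weak_euler_lagrange]). In-plane variations are free at the boundary, hence the stress with
    entries [p, q, q, s], extended by zero, has divergence-free rows in the whole plane. Integrating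
    [p] twice in the vertical variable then gives a potential: the divergence equations supply its
    horizontal derivatives, and its Hessian is the cofactor matrix of the stress
    ([stress_potential]). This is the relation between [Phi], [w] and [v].

    The two equations. Through the linear stress-strain law the bilaplacian of [Phi] is [3 mu] times
    [curl^T curl] of the strain. There the symmetric gradient of [w] drops out and half the tensor
    square of the gradient of [v] contributes minus half of [[v, v]] ([det_byparts]), which gives
    [airy_compatibility]. Out-of-plane variations balance bending against the stress acting on the
    gradient of [v]. By the divergence form of the Airy bracket ([airy_byparts]) the latter is minus
    the bracket [[v, Phi]], which gives [airy_equilibrium].

    Regularity. The functions multiplied here are only of class [W^{1,2}]. The product rule
    [product_rule_local] and the identity [jacobian_local] are proved by mollification: in a double
    integral with kernel [rho r (z - y)] a derivative is moved from one factor to the kernel and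
    from the kernel to the other factor, and [cross_cvg] takes the limit [r -> 0]. When [mu = 0] the
    zero potential solves everything. *)

(** * Directional calculus on normed spaces *)

Section affine_substitution.
Variables (R : numFieldType) (V W U : normedModType R).
Variables (f : W -> U) (L : V -> W) (x u : V) (u' : W).
Hypothesis affL : forall h : R, L (h *: u + x) = h *: u' + L x.

Let quotE : (fun h : R => h^-1 *: (((f \o L) \o shift x) (h *: u) - (f \o L) x)) =
  (fun h => h^-1 *: ((f \o shift (L x)) (h *: u') - f (L x))).
Proof. by apply/funext => h /=; rewrite affL. Qed.

Lemma derive_affine : 'D_u (f \o L) x = 'D_u' f (L x).
Proof. by rewrite /derive quotE. Qed.

Lemma derivable_affine : derivable (f \o L) x u = derivable f (L x) u'.
Proof. by rewrite /derivable quotE. Qed.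

Lemma is_derive_affine d : is_derive (L x) u' f d -> is_derive x u (f \o L) d.
Proof.
by move=> [df dfE]; split; [rewrite derivable_affine|rewrite derive_affine].
Qed.

End affine_substitution.

Section line_calculus.
Variables (R : realType) (V : normedModType R).
Implicit Types (f : V -> R) (x u v : V).

Lemma is_derive_line f x u (t d : R) :
  is_derive (x + t *: u) u f d ->
  is_derive t 1 (fun s : R => f (x + s *: u)) d.
Proof.
move=> fd; apply: (@is_derive_affine _ _ _ _ f (fun s : R => x + s *: u)) fd.
by move=> h; rewrite [h *: 1]mulr1 scalerDl addrCA.
Qed.

Lemma MVT_line f x u (h : R) : 0 < h ->
  (forall t, 0 <= t <= h -> derivable f (x + t *: u) u) ->
  exists2 t, 0 < t < h & f (x + h *: u) - f x = h * 'D_u f (x + t *: u).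
Proof.
move=> h0 df.
have D t : 0 <= t <= h ->
    is_derive t 1 (fun s : R => f (x + s *: u)) ('D_u f (x + t *: u)).
  by move=> th; apply/is_derive_line/DeriveDef; [exact: df|].
have [t||t tI] := @MVT _ (fun s : R => f (x + s *: u))
  (fun s => 'D_u f (x + s *: u)) 0 h h0.
- by rewrite in_itv/= => /andP[t0 th]; apply: D; rewrite !ltW.
- apply: derivable_within_continuous => t; rewrite in_itv/= => th.
  by have [] := D _ th.
- rewrite scale0r addr0 subr0 => ->; exists t; last by rewrite mulrC.
  by move: tI; rewrite in_itv.
Qed.

(** Gives short segments in direction [u], uniformly in their base point near [x], so that the mean
    value theorem can be applied on them. *)
Lemma near_line x u (P : set V) : (\forall y \near x, P y) ->
  exists2 r : R, 0 < r & forall y t, `|y - x| <= r -> `|t| <= r -> P (y + t *: u).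
Proof.
move=> /nbhs_ballP[e /= e0 eP].
have u0 : 0 < 1 + `|u| by rewrite ltr_pwDl.
exists (e / 2 / (1 + `|u|)); first by rewrite !divr_gt0.
move=> y t yx tr; apply: eP; rewrite -ball_normE /ball_/=.
rewrite opprD addrA (le_lt_trans (ler_normB _ _))//.
have e2 : e / 2 < e by rewrite ltr_pdivrMr// ltr_pMr// ltr1n.
apply: le_lt_trans e2; rewrite distrC normrZ.
rewrite (@le_trans _ _ (e / 2 / (1 + `|u|) * (1 + `|u|)))//; last first.
  by rewrite divfK// gt_eqF.
by rewrite mulrDr mulr1 lerD// ler_wpM2r.
Qed.

                                                                            
                                                                 
(** Directional derivatives are not additive in the direction in general; continuity of ['D_u f] at
    [x] makes them so. The increment along [h (u + v)] is split at [x + h v], and the piece in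
    direction [u] is, by the mean value theorem, [h] times a value of ['D_u f] near [x]. *)
Lemma derive_add f x u v :
  (\forall y \near x, derivable f y u) ->
  {for x, continuous ('D_u f)} -> derivable f x v ->
  is_derive x (u + v) f ('D_u f x + 'D_v f x).
Proof.
move=> du cu dv.
have quot w d : (h^-1 *: (f (h *: w + x) - f x) @[h --> (0:R)^'] --> d) ->
    is_derive x w f d.
  by move=> H; split; [apply/cvg_ex; exists d|apply/cvg_lim].
apply: quot.
have -> : (fun h : R => h^-1 *: (f (h *: (u + v) + x) - f x)) =
  (fun h => h^-1 *: (f (x + h *: v + h *: u) - f (x + h *: v))) \+
  (fun h => h^-1 *: (f (h *: v + x) - f x)).
  apply/funext => h /=; rewrite -scalerDr; congr (_ *: _).
  rewrite [h *: v + x]addrC addrA subrK; congr (f _ - _).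
  by rewrite scalerDr addrC -addrA; congr (_ + _); rewrite addrC.
apply: cvgD; last exact: dv.
apply/cvgrPdist_le => e e0.
have : \forall y \near x, derivable f y u /\ `|'D_u f x - 'D_u f y| <= e.
  by near=> y; split; near: y => //; move/cvgrPdist_le : cu; exact.
move=> /(near_line u)[r r0 rP].
have v0 : 0 < 1 + `|v| by rewrite ltr_pwDl.
exists (r / (1 + `|v|)) => /=; first by rewrite divr_gt0.
move=> h /=; rewrite sub0r normrN => hr hN0.
have hr' : `|h| <= r.
  rewrite (le_trans (ltW hr))// ler_pdivrMr// ler_peMr ?(ltW r0)//.
  by rewrite lerDl.
have hv : `|x + h *: v - x| <= r.
  rewrite addrAC subrr add0r normrZ.
  rewrite (@le_trans _ _ (r / (1 + `|v|) * (1 + `|v|)))//; last first.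
    by rewrite divfK// gt_eqF.
  by rewrite ler_pM// ?(ltW hr)// lerDr.
have [t tr ->] : exists2 t, `|t| <= r & h^-1 *: (f (x + h *: v + h *: u) - f (x + h *: v))
    = 'D_u f (x + h *: v + t *: u).
  have [h0|h0] : 0 < h \/ 0 < - h.
    by move: hN0; rewrite oppr_gt0 neq_lt => /orP[]; [right|left].
  - have [|t /andP[t0 th] ->] := @MVT_line f (x + h *: v) u h h0.
      move=> t /andP[t0 th]; apply: (rP _ _ hv _).1.
      by rewrite ger0_norm// (le_trans th)// (le_trans (ler_norm _)).
    exists t; first by rewrite gtr0_norm// (le_trans (ltW th))// (le_trans (ler_norm _)).
    by rewrite [_ *: _]mulrA mulVf// mul1r.
  (* For [h < 0] the segment is traversed from its other endpoint. *)
  - have [|t /andP[t0 th]] := @MVT_line f (x + h *: v + h *: u) u (- h) h0.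
      move=> t /andP[t0 th]; rewrite -addrA -scalerDl; apply: (rP _ _ hv _).1.
      rewrite ler_norml; have := hr'; rewrite ler_norml => /andP[h1 h2].
      apply/andP; split; lra.
    rewrite scaleNr addrK => E; exists (h + t).
      have := hr'; rewrite !ler_norml => /andP[h1 h2].
      apply/andP; split; lra.
    rewrite -opprB E scalerDl addrA mulNr opprK [_ *: _]mulrA mulVf ?mul1r//.
exact: (rP _ _ hv tr).2.
Unshelve. all: end_near. Qed.

End line_calculus.

Section smooth_functions.
Variables (R : realType) (V : normedModType R).
Implicit Types (f g : V -> R) (x u v : V).

(** The mean value theorem is used twice: in direction [u] for [f (h v + z) - f z], then in
    direction [v] for [fu]. *)
Lemma second_difference f (fu fuv : V -> R) x u v (h : R) : 0 < h ->
  (forall y, is_derive y u f (fu y)) -> (forall y, is_derive y v fu (fuv y)) ->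
  exists s t, [/\ 0 < s < h, 0 < t < h &
    f (x + h *: v + h *: u) - f (x + h *: v) - (f (x + h *: u) - f x) =
    h * (h * fuv (x + s *: u + t *: v))].
Proof.
move=> h0 du dvu.
have dg y : is_derive y u (fun z => f (h *: v + z) - f z) (fu (h *: v + y) - fu y).
  suff ? : is_derive y u (fun z => f (h *: v + z)) (fu (h *: v + y)).
    exact: is_deriveB.
  apply: (@is_derive_affine _ _ _ _ f (fun z => h *: v + z) y u u) => //.
  by move=> k; rewrite addrCA.
have [|s sh E] := @MVT_line R V (fun z => f (h *: v + z) - f z) x u h h0.
  by move=> t _; have [] := dg (x + t *: u).
have [|t th E'] := @MVT_line R V fu (x + s *: u) v h h0.
  by move=> t _; have [] := dvu (x + s *: u + t *: v).
exists s, t; split => //.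
have [_ <-] := dvu (x + s *: u + t *: v); rewrite -E'.
have [_ dE] := dg (x + s *: u); rewrite dE in E.
by rewrite [X in fu X - _]addrC -E -(addrA x) (addrCA x) (addrC x (h *: v)); ring.
Qed.

Lemma eq_of_near_coincidence (A B : V -> R) x u v :
  {for x, continuous A} -> {for x, continuous B} ->
  (forall h : R, 0 < h -> exists s t s' t', [/\ `|s| <= h, `|t| <= h, `|s'| <= h,
     `|t'| <= h & A (x + s *: u + t *: v) = B (x + s' *: v + t' *: u)]) ->
  A x = B x.
Proof.
move=> cA cB AB.
suff H e : 0 < e -> `|A x - B x| <= e + e.
  apply/eqP; rewrite -subr_eq0 -normr_le0; apply/ler_addgt0Pr => e e0.
  by rewrite add0r (le_trans (H (e / 2) _)) ?divr_gt0// -splitr.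
move=> e0.
have near1 g w1 w2 : {for x, continuous g} ->
    exists2 r, 0 < r & forall s t, `|s| <= r -> `|t| <= r ->
      `|g x - g (x + s *: w1 + t *: w2)| <= e.
  move=> /cvgrPdist_le/(_ _ e0)/(near_line w2)[r r0 rP].
  have w10 : 0 < 1 + `|w1| by rewrite ltr_pwDl.
  exists (r / (1 + `|w1|)) => [|s t sr tr]; first by rewrite divr_gt0.
  have rr : r / (1 + `|w1|) <= r.
    by rewrite ler_pdivrMr// ler_peMr ?(ltW r0)// lerDl.
  apply: rP; last exact: le_trans rr.
  rewrite addrAC subrr add0r normrZ.
  rewrite (@le_trans _ _ (r / (1 + `|w1|) * (1 + `|w1|)))//; last first.
    by rewrite divfK// gt_eqF.
  by rewrite ler_pM// lerDr.
have [r1 r10 r1P] := near1 _ u v cA.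
have [r2 r20 r2P] := near1 _ v u cB.
have [h [h0 hr1 hr2]] : exists h, [/\ 0 < h, h <= r1 & h <= r2].
  by exists (Num.min r1 r2); rewrite lt_min r10 r20 !ge_min !lexx orbT.
have [s [t [s' [t' [sh th s'h t'h E]]]]] := AB _ h0.
have := r1P s t (le_trans sh hr1) (le_trans th hr1).
have := r2P s' t' (le_trans s'h hr2) (le_trans t'h hr2).
rewrite -E distrC => a2 a1.
by rewrite (le_trans (ler_distD (A (x + s *: u + t *: v)) _ _))// lerD.
Qed.

(** Schwarz's theorem: one and the same second difference, divided by [h^2], is a value of [fuv] and
    a value of [fvu], both taken at points tending to [x]. *)
Lemma derive_comm f (fu fv fuv fvu : V -> R) x u v :
  (forall y, is_derive y u f (fu y)) -> (forall y, is_derive y v f (fv y)) ->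
  (forall y, is_derive y v fu (fuv y)) -> (forall y, is_derive y u fv (fvu y)) ->
  {for x, continuous fuv} -> {for x, continuous fvu} -> fuv x = fvu x.
Proof.
move=> du dv dvu duv cvu cuv.
apply: (@eq_of_near_coincidence fuv fvu x u v cvu cuv) => h h0.
have [s [t [/andP[s0 sh] /andP[t0 th] E]]] := second_difference x h0 du dvu.
have [s' [t' [/andP[s'0 s'h] /andP[t'0 t'h] E']]] := second_difference x h0 dv duv.
exists s, t, s', t'; rewrite !gtr0_norm// !ltW//; split=> //.
have hn0 : h != 0 by rewrite gt_eqF.
apply: (mulfI hn0); apply: (mulfI hn0); rewrite -E -E' (addrAC x).
by rewrite !opprB; ring.
Qed.

Local Notation Ck k := (@Ck_on R V k setT).
Local Notation smth f := (forall k, Ck k f).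

Lemma Ck_continuous k f : Ck k f -> continuous f.
Proof. by case: k => [|k] [cf _] x; exact: cf. Qed.

Lemma Ck_derivable k f u x : Ck k.+1 f -> derivable f x u.
Proof. by case=> _ /(_ u)[/(_ x I)]. Qed.

Lemma Ck_derive k f u : Ck k.+1 f -> Ck k ('D_u f).
Proof. by case=> _ /(_ u)[]. Qed.

Lemma Ck_pred k f : Ck k.+1 f -> Ck k f.
Proof.
elim: k f => [|k IH] f; first by case.
move=> Cf; split; first by case: Cf.
by move=> u; split=> [x _|]; [exact: Ck_derivable Cf|exact/IH/(Ck_derive u Cf)].
Qed.

Lemma CkS k f : continuous f -> (forall u, (forall x, derivable f x u)) ->
  (forall u, Ck k ('D_u f)) -> Ck k.+1 f.
Proof. by move=> cf df Df; split=> [x _|u]; [exact: cf|split]. Qed.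

Lemma CkSd k f (df : V -> V -> R) : continuous f ->
  (forall u x, is_derive x u f (df u x)) -> (forall u, Ck k (df u)) -> Ck k.+1 f.
Proof.
move=> cf dfE Cdf; apply: CkS => [//|u x|u]; first by have [] := dfE u x.
by rewrite (_ : 'D_u f = df u)//; apply/funext => x; have [] := dfE u x.
Qed.

Lemma Ck_derivableP k f u x : Ck k.+1 f -> is_derive x u f ('D_u f x).
Proof. by move=> Cf; apply: derivableP; exact: Ck_derivable Cf. Qed.

Lemma Ck_cst k (c : R) : Ck k (fun=> c).
Proof.
elim: k c => [|k IH] c; first by split=> // x _; exact: cst_continuous.
by apply: CkSd (fun u x => is_derive_cst c x u) (fun u => IH 0) => x; exact: cst_continuous.
Qed.

Lemma CkD k f g : Ck k f -> Ck k g -> Ck k (fun x => f x + g x).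
Proof.
elim: k f g => [|k IH] f g Cf Cg.
  by split=> // x _; apply: cvgD; [exact: (Ck_continuous Cf)|exact: (Ck_continuous Cg)].
apply: (@CkSd _ _ (fun u x => 'D_u f x + 'D_u g x)) => [x|u x|u].
- by apply: cvgD; [exact: (Ck_continuous Cf)|exact: (Ck_continuous Cg)].
- by apply: is_deriveD; exact: Ck_derivableP Cf || exact: Ck_derivableP Cg.
- by apply: IH; exact: Ck_derive Cf || exact: Ck_derive Cg.
Qed.

Lemma CkM k f g : Ck k f -> Ck k g -> Ck k (fun x => f x * g x).
Proof.
elim: k f g => [|k IH] f g Cf Cg.
  by split=> // x _; apply: cvgM; [exact: (Ck_continuous Cf)|exact: (Ck_continuous Cg)].
apply: (@CkSd _ _ (fun u x => f x * 'D_u g x + g x * 'D_u f x)) => [x|u x|u].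
- by apply: cvgM; [exact: (Ck_continuous Cf)|exact: (Ck_continuous Cg)].
- by apply: is_deriveM; exact: Ck_derivableP Cf || exact: Ck_derivableP Cg.
- by apply: CkD; apply: IH; (exact: Ck_pred || apply: Ck_derive).
Qed.

Lemma Ck_affine k f (a : V) (b : R) : Ck k f -> Ck k (fun x => f (a + b *: x)).
Proof.
have caff : continuous (fun x : V => a + b *: x).
  by move=> x; apply: cvgD; [exact: cvg_cst|apply: cvgZr; exact: cvg_id].
elim: k f => [|k IH] f Cf.
  split=> // x _; apply: continuous_comp; [exact: caff|exact: (Ck_continuous Cf)].
apply: (@CkSd _ _ (fun u x => 'D_(b *: u) f (a + b *: x))) => [x|u x|u].
- apply: continuous_comp; [exact: caff|exact: (Ck_continuous Cf)].
- apply: (@is_derive_affine _ _ _ _ f (fun x => a + b *: x) x u (b *: u)).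
    by move=> h; rewrite scalerDr !scalerA [b * h]mulrC addrCA.
  exact: Ck_derivableP Cf.
- exact: (IH ('D_(b *: u) f)) (Ck_derive _ Cf).
Qed.

Lemma is_derive_comp_real (h : R -> R) (dh : R) f x u (d : R) :
  is_derive (f x) 1 h dh -> is_derive x u f d ->
  is_derive x u (h \o f) (dh * d).
Proof.
move=> hD fD.
have fD' : is_derive (0:R) 1 (fun s : R => f (x + s *: u)) d.
  by apply: is_derive_line; rewrite scale0r addr0.
have hD' : is_derive (f (x + 0 *: u)) 1 h dh by rewrite scale0r addr0.
have := @is_derive1_comp R h (fun s : R => f (x + s *: u)) 0 _ _ hD' fD'.
have E : (h \o (fun s : R => f (x + s *: u))) = (fun s => (h \o f) (s *: u + x)).
  by apply/funext => s /=; rewrite addrC.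
rewrite E => -[H1 H2]; split; first by apply/derivable1P.
have := @derive_affine R R V R (h \o f) (fun s : R => s *: u + x) 0 1 u.
rewrite scale0r add0r => <-; first by rewrite -[RHS]H2.
by move=> k; rewrite [k *: 1]mulr1 addr0.
Qed.

End smooth_functions.

(** * Smooth functions that are flat at zero *)

Section flat_functions.
Variable R : realType.
Implicit Types (p : {poly R}) (t : R).

                                                                            
                                   
(** The classical [exp (-1/t)], with a polynomial in [1/t] as a factor. The family is closed under
    differentiation, which turns smoothness into an induction on the order. *)
Definition flat p t : R := if 0 < t then p.[t^-1] * expR (- t^-1) else 0.

Lemma poly_expR_bound p : exists2 C : R, 0 <= C &
  forall x : R, 0 <= x -> `|p.[x]| * expR (- x) <= C.
Proof.
have mono (n : nat) (x : R) : 0 <= x -> x ^+ n * expR (- x) <= n%:R ^+ n.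
  move=> x0; case: n => [|n]; first by rewrite !expr0 mul1r -expR0 ler_expR oppr_le0.
  rewrite expRN ler_pdivrMr ?expR_gt0//.
  (* The bound [n^n] comes from [exp x = (exp (x / n))^n >= (x / n)^n]. *)
  have -> : expR x = expR (x / n.+1%:R) ^+ n.+1.
    by rewrite -expRM_natl -mulr_natl mulrCA divff ?mulr1// pnatr_eq0.
  rewrite -exprMn; apply: lerXn2r; rewrite ?nnegrE// ?mulr_ge0 ?expR_ge0//.
  rewrite -ler_pdivrMl// mulrC (le_trans _ (expR_ge1Dx _))// lerDr//.
exists (\sum_(i < size p) `|p`_i| * i%:R ^+ i).
  by apply: sumr_ge0 => i _; rewrite mulr_ge0.
move=> x x0; rewrite horner_coef.
rewrite (@le_trans _ _ ((\sum_(i < size p) `|p`_i * x ^+ i|) * expR (- x)))//.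
  by rewrite ler_wpM2r ?expR_ge0// ler_norm_sum.
rewrite mulr_suml ler_sum// => i _.
by rewrite normrM -mulrA ler_wpM2l// ger0_norm ?exprn_ge0// mono.
Qed.

Lemma flat_le p : exists2 C : R, 0 <= C & forall t, `|flat p t| <= C * `|t|.
Proof.
have [C C0 CP] := poly_expR_bound (p * 'X); exists C => // t.
rewrite /flat; case: ifPn => t0; last by rewrite normr0 mulr_ge0.
have tV : 0 <= t^-1 by rewrite invr_ge0 ltW.
rewrite normrM (ger0_norm (expR_ge0 _)) [in leRHS]gtr0_norm// -ler_pdivrMr//.
by have := CP _ tV; rewrite hornerM hornerX normrM (ger0_norm tV) mulrAC.
Qed.

(** Differentiating [p (1/t) exp (-1/t)] gives [t^-2 (p - p') (1/t) exp (-1/t)]. *)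
Definition dflat p : {poly R} := 'X^2 * (p - p^`()).

Lemma is_derive_flat p t : is_derive t 1 (flat p) (flat (dflat p) t).
Proof.
have [t0|t0|->] := ltgtP t 0.
- rewrite {2}/flat ltNge (ltW t0)/=.
  apply: near_eq_is_derive (is_derive_cst (0 : R) t 1).
  near=> s; rewrite /flat; case: ifPn => // s0.
  have : s < 0 by near: s; exact: lt_nbhsl.
  by rewrite ltNge (ltW s0).
- rewrite {2}/flat t0.
  have flatE : \forall s \near t, p.[s^-1] * expR (- s^-1) = flat p s.
    by near=> s; rewrite /flat ifT//; near: s; exact: lt_nbhsr.
  apply: near_eq_is_derive flatE _.
  have tn0 : t != 0 by rewrite gt_eqF.
  have iV : is_derive t 1 (fun s : R => s^-1) (- t ^- 2).
    split; first exact: derivableV.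
    by rewrite deriveV// derive_id /= [_ *: _]mulr1.
  have h1 : is_derive t 1 (fun s => p.[s^-1]) (p^`().[t^-1] * - t ^- 2).
    exact: (@is_derive1_comp _ (horner p) (fun s : R => s^-1)).
  have h2 : is_derive t 1 (fun s : R => expR (- s^-1)) (expR (- t^-1) * t ^- 2).
    apply: (@is_derive1_comp _ expR (fun s : R => - s^-1)).
    by rewrite -[t ^- 2]opprK; exact: is_deriveN.
  apply: (is_derive_eq (is_deriveM h1 h2)).
  rewrite /dflat !hornerE/= exprVn /GRing.scale/=; ring.
- rewrite {2}/flat ltxx; have [C C0 CP] := flat_le (p * 'X).
  have H : h^-1 *: (flat p (h *: 1 + 0) - flat p 0) @[h --> (0:R)^'] --> (0:R).
    apply/cvgrPdist_le => e e0; near=> h.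
    have hn0 : h != 0 by near: h; exact: nbhs_dnbhs_neq.
    rewrite sub0r normrN addr0 [h *: 1]mulr1 {2}/flat ltxx subr0.
    (* The difference quotient at 0 is again a flat function, hence of order [h] by [flat_le]. *)
    have -> : h^-1 *: flat p h = flat (p * 'X) h.
      rewrite /flat; case: ifPn => h0; last by rewrite scaler0.
      by rewrite hornerM hornerX [LHS]mulrC mulrAC.
    rewrite (le_trans (CP _))//.
    rewrite (@le_trans _ _ ((C + 1) * `|h|))// ?ler_wpM2r ?lerDl//.
    rewrite -ler_pdivlMl ?ltr_wpDl//.
    near: h; exists ((C + 1)^-1 * e) => /=.
      by rewrite mulr_gt0// invr_gt0 ltr_wpDl.
    by move=> h /=; rewrite sub0r normrN => /ltW.
  by split; [apply/cvg_ex; exists 0|apply/cvg_lim].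
Unshelve. all: end_near. Qed.

Lemma continuous_flat p : continuous (flat p).
Proof.
move=> t; apply: differentiable_continuous; apply/derivable1_diffP.
by have [] := is_derive_flat p t.
Qed.

Lemma Ck_flat (V : normedModType R) k p (f : V -> R) :
  Ck_on k setT f -> Ck_on k setT (flat p \o f).
Proof.
have cc (q : {poly R}) (g : V -> R) : continuous g -> continuous (flat q \o g).
  by move=> cg x; apply: continuous_comp; [exact: cg|exact: continuous_flat].
elim: k p => [|k IH] p Cf.
  by split=> // x _; apply: cc; exact: Ck_continuous Cf.
apply: (@CkSd _ _ _ _ (fun u x => flat (dflat p) (f x) * 'D_u f x)) => [|u x|u].
- by apply: cc; exact: Ck_continuous Cf.
- by apply: is_derive_comp_real; [exact: is_derive_flat|exact: Ck_derivableP Cf].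
- by apply: CkM; [exact/IH/Ck_pred|exact: Ck_derive].
Qed.

End flat_functions.

(** * Boxes, open sets and measurability in the plane *)

Section plane.
Variable R : realType.
Local Notation M2 := (measurableTypeR R * measurableTypeR R)%type.
Implicit Types (a b c d : R) (z : R * R) (U : set (R * R)).

Definition obox a b c d : set (R * R) := `]a, b[ `*` `]c, d[.
Definition cbox a b c d : set (R * R) := `[a, b] `*` `[c, d].

Lemma oboxE a b c d z :
  obox a b c d z = (a < z.1 < b /\ c < z.2 < d) :> Prop.
Proof. by rewrite /obox/= !in_itv. Qed.

Lemma cboxE a b c d z :
  cbox a b c d z = (a <= z.1 <= b /\ c <= z.2 <= d) :> Prop.
Proof. by rewrite /cbox/= !in_itv. Qed.

Lemma measurable_obox a b c d : measurable (obox a b c d : set M2).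
Proof. by apply: measurableX. Qed.

Lemma measurable_cbox a b c d : measurable (cbox a b c d : set M2).
Proof. by apply: measurableX. Qed.

Lemma compact_cbox a b c d : compact (cbox a b c d).
Proof. by apply: compact_setX; exact: segment_compact. Qed.

Lemma near_plane z (P : set (R * R)) : (\forall w \near z, P w) ->
  exists2 r : R, 0 < r & forall w, `|w.1 - z.1| < r -> `|w.2 - z.2| < r -> P w.
Proof.
move=> /nbhs_ballP[r /= r0 rP]; exists r => // w w1 w2; apply: rP.
by split; rewrite /ball/= distrC.
Qed.

Lemma rat_box U z : open U -> U z -> exists q : rat * rat * (rat * rat),
  let: (p, q, (r, s)) := q in
  obox (ratr p) (ratr q) (ratr r) (ratr s) z /\
  cbox (ratr p) (ratr q) (ratr r) (ratr s) `<=` U.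
Proof.
move=> oU Uz; have /near_plane[e e0 eU] : \forall w \near z, U w.
  by have := oU z Uz.
have r1 (x : R) : exists p q, x - e < ratr p < x /\ x < ratr q < x + e.
  have [|p] := @rat_in_itvoo R (x - e) x; first by rewrite ltrBlDr ltrDl.
  have [|q] := @rat_in_itvoo R x (x + e); first by rewrite ltrDl.
  by rewrite !in_itv/= => qP pP; exists p, q.
have [p [q [/andP[p1 p2] /andP[q1 q2]]]] := r1 z.1.
have [r [s [/andP[r1' r2] /andP[s1 s2]]]] := r1 z.2.
exists (p, q, (r, s)); rewrite oboxE; split; first by rewrite p2 q1 r2 s1.
move=> w; rewrite cboxE => -[/andP[w1 w2] /andP[w3 w4]].
by apply: eU; rewrite ltr_norml; apply/andP; split; lra.
Qed.

Lemma open_rat_cover U : open U ->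
  exists a b c d : nat -> R,
    (forall n, cbox (a n) (b n) (c n) (d n) `<=` U) /\
    forall z, U z -> exists n, obox (a n) (b n) (c n) (d n) z.
Proof.
move=> oU.
(* Codes of no admissible box are sent to [(1, 0, (1, 0))], whose box is empty. *)
pose B n := if @unpickle (rat * rat * (rat * rat))%type n is Some (p, q, (r, s))
  then if `[< cbox (ratr p : R) (ratr q) (ratr r) (ratr s) `<=` U >]
       then (ratr p : R, ratr q : R, (ratr r : R, ratr s : R)) else (1, 0, (1, 0))
  else (1, 0, (1, 0)).
exists (fun n => (B n).1.1), (fun n => (B n).1.2), (fun n => (B n).2.1),
  (fun n => (B n).2.2); split=> [n|z Uz].
  have c0 : cbox 1 0 1 0 `<=` U.
    by move=> z; rewrite cboxE => -[/andP[z1 z2] _]; exfalso; lra.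
  rewrite /B; case: unpickle => [[[p q] [r s]]|//].
  by case: asboolP.
have [[[p q] [r s]] [zo cU]] := rat_box oU Uz.
exists (pickle (p, q, (r, s))); rewrite /B pickleK.
by case: asboolP.
Qed.

Lemma measurable_open2 U : open U -> measurable (U : set M2).
Proof.
move=> /open_rat_cover[a [b [c [d [BU UB]]]]].
have -> : U = \bigcup_n obox (a n) (b n) (c n) (d n).
  apply/seteqP; split=> [z /UB[n zn]|z [n _]]; first by exists n.
  rewrite oboxE => -[/andP[? ?] /andP[? ?]]; apply: (BU n).
  by rewrite cboxE; split; apply/andP; split; exact: ltW.
by apply: bigcup_measurable => n _; exact: measurable_obox.
Qed.

Lemma measurable_compact2 U : compact U -> measurable (U : set M2).
Proof.
move=> /compact_closed cU; rewrite -(setCK U); apply: measurableC.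
apply: measurable_open2; rewrite openC; apply: cU.
exact: norm_hausdorff.
Qed.

Lemma measurable_continuous2 (f : R * R -> R) :
  continuous f -> measurable_fun [set: M2] f.
Proof.
move=> /continuousP cf; apply: (measurability _ (@measurable_realfun.RGenOpens.measurableE R)).
move=> _ [_ [a [b ->] <-]]; rewrite setTI; apply: measurable_open2.
exact/cf/interval_open.
Qed.

End plane.

                                                         

(** * Real-valued integrals, square integrability and Fubini *)

Section real_integrals.
Context d (T : measurableType d) (R : realType).
Variable m : {measure set T -> \bar R}.
Local Notation itg f := (m.-integrable [set: T] (EFin \o f)).
Local Notation msr f := (measurable_fun [set: T] f).
Local Notation Int f := (\int[m]_x f x).
Implicit Types (f g h : T -> R).

Lemma itg_msr f : itg f -> msr f.
Proof. by move=> /(measurable_int m)/measurable_EFinP. Qed.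

Lemma itgD f g : itg f -> itg g -> itg (fun x => f x + g x).
Proof. by move=> fi gi; have := integrableD measurableT fi gi; apply: eq_integrable. Qed.

Lemma itgN f : itg f -> itg (fun x => - f x).
Proof. by move=> fi; have := integrableN fi; apply: eq_integrable. Qed.

Lemma itgB f g : itg f -> itg g -> itg (fun x => f x - g x).
Proof. by move=> fi gi; apply: itgD => //; exact: itgN. Qed.

Lemma itgZ k f : itg f -> itg (fun x => k * f x).
Proof. by move=> fi; have := integrableZl measurableT k fi; apply: eq_integrable. Qed.

Lemma itg_eq f g : f =1 g -> itg f -> itg g.
Proof. by move=> /funext ->. Qed.

Lemma itg_norm f : itg f -> itg (fun x => `|f x|).
Proof. by move=> fi; have := integrable_norm fi; apply: eq_integrable. Qed.

Lemma itg_le f g : msr f -> (forall x, `|f x| <= g x) -> itg g -> itg f.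
Proof.
move=> mf fg; apply: le_integrable => //; first exact/measurable_EFinP.
by move=> x _ /=; rewrite lee_fin (le_trans (fg x))// ler_norm.
Qed.

Lemma itgMb f g k : msr g -> (forall x, `|g x| <= k) -> itg f ->
  itg (fun x => g x * f x).
Proof.
move=> mg gk fi; apply: (@itg_le _ (fun x => k * `|f x|)).
- by apply: measurable_funM => //; exact: itg_msr.
- by move=> x; rewrite normrM ler_wpM2r.
- by apply: itgZ; exact: itg_norm.
Qed.

Lemma eq_Int f g : f =1 g -> Int f = Int g.
Proof. by move=> /funext ->. Qed.

Lemma IntD f g : itg f -> itg g -> \int[m]_x (f x + g x) = Int f + Int g.
Proof. by move=> fi gi; rewrite RintegralD. Qed.

Lemma IntB f g : itg f -> itg g -> \int[m]_x (f x - g x) = Int f - Int g.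
Proof. by move=> fi gi; rewrite RintegralB. Qed.

Lemma IntZ k f : itg f -> \int[m]_x (k * f x) = k * Int f.
Proof. by move=> fi; rewrite RintegralZl. Qed.

Lemma IntN f : itg f -> \int[m]_x (- f x) = - Int f.
Proof.
move=> fi; rewrite -mulN1r -IntZ//.
by apply: eq_Int => x; rewrite mulN1r.
Qed.

Lemma Int0 : \int[m]_x (0 : R) = 0.
Proof. by rewrite /Rintegral integral0. Qed.

Lemma Int_ge0 f : (forall x, 0 <= f x) -> 0 <= Int f.
Proof. by move=> f0; apply: Rintegral_ge0 => x _. Qed.

Lemma le_Int f g : itg f -> itg g -> (forall x, f x <= g x) -> Int f <= Int g.
Proof. by move=> fi gi fg; apply: le_Rintegral. Qed.

Lemma le_Int_norm f g : itg g -> (forall x, `|f x| <= g x) -> msr f ->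
  `|Int f| <= Int g.
Proof.
move=> gi fg mf; have fi : itg f by exact: itg_le gi.
rewrite (le_trans (le_normr_Rintegral _ fi))// le_Int//.
exact: itg_norm.
Qed.

Lemma Int_ae f g : msr f -> msr g -> (\forall x \ae m, f x = g x) -> Int f = Int g.
Proof.
move=> mf mg fg; rewrite /Rintegral; congr fine; apply: ae_eq_integral => //.
- exact/measurable_EFinP.
- exact/measurable_EFinP.
- by apply: filterS fg => x /= -> _.
Qed.

Lemma itg_ae f g : msr g -> (\forall x \ae m, f x = g x) -> itg f -> itg g.
Proof.
move=> mg fg fi; have mf := itg_msr fi; apply/integrableP; split.
  exact/measurable_EFinP.
have /integrableP[_] := fi; congr (_ < _)%E.
apply: ae_eq_integral => //.
- by apply/measurable_EFinP; apply: measurableT_comp.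
- by apply/measurable_EFinP; apply: measurableT_comp.
- by apply: filterS fg => x /= -> _.
Qed.

Lemma Int_eq0 f : itg f -> (forall x, 0 <= f x) -> Int f = 0 ->
  \forall x \ae m, f x = 0.
Proof.
move=> fi f0 If0; have mf := itg_msr fi.
have mf' : measurable_fun setT (EFin \o f) by exact/measurable_EFinP.
have [H _] := ae_eq_integral_abs m measurableT mf'.
have /H : (\int[m]_(x in setT) `|(EFin \o f) x| = 0)%E.
  under eq_integral => x _ do rewrite gee0_abs ?lee_fin ?f0//.
  rewrite -[LHS]fineK; first by congr EFin.
  exact: (integrable_fin_num _ fi).
by apply: filterS => x /= /(_ I)[].
Qed.

(** Partial integrals in Fubini's theorem may be infinite on a null set; [fine] replaces them by
    real functions with the same integral. *)
Lemma itg_fine (F : T -> \bar R) : m.-integrable setT F ->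
  itg (fine \o F) /\ fine (\int[m]_x F x) = \int[m]_x fine (F x).
Proof.
move=> iF; have mF := measurable_int m iF.
have FE : \forall x \ae m, F x = ((fine \o F) x)%:E.
  by apply: filterS (integrable_ae measurableT iF) => x /(_ I) /= /fineK ->.
have mfF : measurable_fun setT (EFin \o (fine \o F)).
  by apply: measurableT_comp => //; exact: measurableT_comp.
split; last first.
  by congr fine; apply: ae_eq_integral => //; apply: filterS FE => x /= {1}->.
apply/integrableP; split => //; have /integrableP[_] := iF; congr (_ < _)%E.
apply: ae_eq_integral => //; first exact: measurableT_comp.
  exact: measurableT_comp.
by apply: filterS FE => x /= {1}->.
Qed.

Lemma dominated_Int (f_ : nat -> T -> R) f g : (forall n, msr (f_ n)) -> msr f ->
  (forall x, f_ ^~ x @ \oo --> f x) -> itg g ->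
  (forall n x, `|f_ n x| <= g x) -> Int (f_ n) @[n --> \oo] --> Int f.
Proof.
move=> mf_ mf ff gi fg.
have mF_ n : measurable_fun setT (EFin \o f_ n) by exact/measurable_EFinP.
have mF : measurable_fun setT (EFin \o f) by exact/measurable_EFinP.
have FF : {ae m, forall x, setT x -> (fun n => (EFin \o f_ n) x) @ \oo --> (EFin \o f) x}.
  by apply: aeW => x _; apply: cvg_EFin; [exact: nearW|exact: ff].
have FG : {ae m, forall x n, setT x -> (`|(EFin \o f_ n) x| <= (EFin \o g) x)%E}.
  by apply: aeW => x n _; rewrite lee_fin.
have [fi _ H] := dominated_convergence measurableT mF_ mF FF gi FG.
apply: fine_cvg; rewrite fineK//; exact: integrable_fin_num.
Qed.

(** Membership in [L^2]; measurability of [f] is recorded separately because integrability of the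
    square does not yield it. *)
Definition sqi f := msr f /\ itg (fun x => f x ^+ 2).

Lemma sqi_msr f : sqi f -> msr f. Proof. by case. Qed.

Lemma sqiM f g : sqi f -> sqi g -> itg (fun x => f x * g x).
Proof.
move=> [mf fi] [mg gi]; apply: (@itg_le _ (fun x => f x ^+ 2 + g x ^+ 2)).
- exact: measurable_funM.
- move=> x; rewrite ler_norml; apply/andP; split; nra.
- exact: itgD.
Qed.

Lemma sqi_le f g : msr f -> sqi g -> (forall x, `|f x| <= `|g x|) -> sqi f.
Proof.
move=> mf [mg gi] fg; split => //; apply: itg_le gi; first exact: measurable_funX.
by move=> x; rewrite normrX -(real_normK (num_real (g x))) lerXn2r ?nnegrE.
Qed.

Lemma sqiZ k f : sqi f -> sqi (fun x => k * f x).
Proof.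
move=> [mf fi]; split; first exact: measurable_funM.
by apply: (itg_eq _ (itgZ (k ^+ 2) fi)) => x; rewrite exprMn.
Qed.

Lemma sqiMb f g k : msr g -> (forall x, `|g x| <= k) -> sqi f ->
  sqi (fun x => g x * f x).
Proof.
move=> mg gk fi; apply: (@sqi_le _ (fun x => k * f x)).
- by apply: measurable_funM => //; exact: sqi_msr.
- exact: sqiZ.
- by move=> x; rewrite !normrM ler_wpM2r// (le_trans (gk x))// ler_norm.
Qed.

Lemma sqiD f g : sqi f -> sqi g -> sqi (fun x => f x + g x).
Proof.
move=> fi gi; split; first by apply: measurable_funD; exact: sqi_msr.
apply: (@itg_le _ (fun x => 2 * (f x ^+ 2 + g x ^+ 2))).
- by apply: measurable_funX; apply: measurable_funD; exact: sqi_msr.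
- by move=> x; rewrite ger0_norm ?sqr_ge0//; have := sqr_ge0 (f x - g x); nra.
- by apply: itgZ; apply: itgD; [case: fi|case: gi].
Qed.

Lemma sqiN f : sqi f -> sqi (fun x => - f x).
Proof. by move=> fi; have := sqiZ (-1) fi; under eq_fun do rewrite mulN1r. Qed.

Lemma sqiB f g : sqi f -> sqi g -> sqi (fun x => f x - g x).
Proof. by move=> fi gi; apply: sqiD => //; exact: sqiN. Qed.

Lemma sqi_ae f g : msr g -> (\forall x \ae m, f x = g x) -> sqi f -> sqi g.
Proof.
move=> mg fg [mf fi]; split => //; apply: itg_ae fi; first exact: measurable_funX.
by apply: filterS fg => x ->.
Qed.

Lemma itg_indic (A : set T) : measurable A -> (m A < +oo)%E -> itg (\1_A : T -> R).
Proof.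
move=> mA Afin; apply/integrableP; split; first exact/measurable_EFinP.
rewrite (eq_integral (fun x => (\1_A x)%:E)); last first.
  by move=> t _; rewrite gee0_abs// lee_fin.
by rewrite integral_indic// setIT.
Qed.

Lemma sqi_itg f (A : set T) : measurable A -> (m A < +oo)%E ->
  (forall x, ~ A x -> f x = 0) -> sqi f -> itg f.
Proof.
move=> mA Afin fA fi.
have Ai : sqi (\1_A : T -> R).
  split; first exact: measurable_indic.
  apply: (@itg_eq (\1_A : T -> R)).
    by move=> x; rewrite indicE; case: (_ \in _); rewrite ?expr1n ?expr0n.
  exact: itg_indic.
apply: (itg_eq _ (sqiM Ai fi)) => x; rewrite indicE.
by have [/[!inE] Ax|/negP/[!inE] /fA ->] := boolP (x \in A); rewrite ?mul1r ?mulr0.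
Qed.

End real_integrals.

Section real_fubini.
Context d1 (T1 : measurableType d1) d2 (T2 : measurableType d2) (R : realType).
Variables (m1 : {sigma_finite_measure set T1 -> \bar R}).
Variables (m2 : {sigma_finite_measure set T2 -> \bar R}).
Implicit Type f : T1 * T2 -> R.

Lemma Int_prod1 f : (m1 \x m2)%E.-integrable setT (EFin \o f) ->
  m1.-integrable setT (EFin \o (fun x => \int[m2]_y f (x, y))) /\
  \int[(m1 \x m2)%E]_z f z = \int[m1]_x \int[m2]_y f (x, y).
Proof.
move=> fi; have [H <-] := itg_fine (integrable_fubini_F fi); split; first exact: H.
by rewrite (integral12_prod_meas1 fi).
Qed.

Lemma Int_prod2 f : (m1 \x m2)%E.-integrable setT (EFin \o f) ->
  m2.-integrable setT (EFin \o (fun y => \int[m1]_x f (x, y))) /\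
  \int[(m1 \x m2)%E]_z f z = \int[m2]_y \int[m1]_x f (x, y).
Proof.
move=> fi; have iG : m2.-integrable setT (fubini_G m1 (EFin \o f)).
  have mf := measurable_int _ fi.
  have mG := measurable_fubini_G fi.
  apply/integrableP; split => //.
  apply: le_lt_trans ((integrable21ltyP m1 m2 mf).1 fi).
  apply: ge0_le_integral => //; first exact: measurableT_comp.
    apply: (measurable_fun_fubini_tonelli_G (abse \o (EFin \o f))) => //.
      exact: measurableT_comp.
    by move=> ?; exact: abse_ge0.
  move=> y _; apply: le_abse_integral => //.
  exact: measurableT_comp mf _.
have [H <-] := itg_fine iG; split; first exact: H.
by rewrite (integral21_prod_meas1 fi).
Qed.

Lemma itg_prodP f (g : T1 -> T2 -> R) : measurable_fun setT f ->
  (forall x y, `|f (x, y)| <= g x y) ->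
  (forall x, m2.-integrable setT (EFin \o g x)) ->
  m1.-integrable setT (EFin \o (fun x => \int[m2]_y g x y)) ->
  (m1 \x m2)%E.-integrable setT (EFin \o f).
Proof.
move=> mf fg gi gii; apply/integrable12ltyP; first exact/measurable_EFinP.
have /integrableP[mG] := gii; apply: le_lt_trans; apply: ge0_le_integral => //.
- by move=> x _; apply: integral_ge0.
- apply: (measurable_fun_fubini_tonelli_F (EFin \o (fun z => `|f z|))) => //.
    by apply/measurable_EFinP; apply: measurableT_comp.
  by move=> z; rewrite lee_fin.
- by apply: measurableT_comp.
- move=> x _; rewrite [leRHS]/= ger0_norm; last first.
    by apply: Int_ge0 => y; exact: le_trans (fg x y).
  rewrite /Rintegral fineK; last exact: (integrable_fin_num _ (gi x)).
  apply: ge0_le_integral => //.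
  + by apply/measurable_EFinP; apply: measurableT_comp => //; apply: measurableT_comp.
  + exact: measurable_int (gi x).
  + by move=> y _; rewrite lee_fin.
Qed.

End real_fubini.

(** * Planar Lebesgue measure and induction on boxes *)

Section plane_measure.
Variable R : realType.
Local Notation M2 := (measurableTypeR R * measurableTypeR R)%type.
Local Notation mu := (@leb2 R).
Local Notation itg f := (mu.-integrable [set: M2] (EFin \o f)).
Local Notation msr f := (measurable_fun [set: M2] f).
Local Notation Int f := (\int[mu]_x f x).
Implicit Types (a b c d : R) (z : R * R) (U : set (R * R)).

Definition oboxes : set (set (R * R)) :=
  [set B | exists a b c d, B = obox a b c d].

Lemma oboxI a b c d a' b' c' d' : obox a b c d `&` obox a' b' c' d' =
  obox (Num.max a a') (Num.min b b') (Num.max c c') (Num.min d d').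
Proof.
apply/seteqP; split=> z; rewrite oboxE.
  move=> [] /[!oboxE] -[/andP[? ?] /andP[? ?]] [/andP[? ?] /andP[? ?]].
  by rewrite !gt_max !lt_min; split; apply/andP; split; apply/andP; split.
rewrite !gt_max !lt_min => -[/andP[/andP[? ?] /andP[? ?]] /andP[/andP[? ?] /andP[? ?]]].
by split; rewrite oboxE; split; apply/andP; split.
Qed.

Lemma oboxes_setI : setI_closed oboxes.
Proof.
move=> _ _ [a [b [c [d ->]]]] [a' [b' [c' [d' ->]]]]; rewrite oboxI.
by exists (Num.max a a'), (Num.min b b'), (Num.max c c'), (Num.min d d').
Qed.

Lemma open_g_oboxes U : open U -> <<s oboxes >> U.
Proof.
move=> /open_rat_cover[a [b [c [d [BU UB]]]]].
have -> : U = \bigcup_n obox (a n) (b n) (c n) (d n).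
  apply/seteqP; split=> [z /UB[n zn]|z [n _]]; first by exists n.
  rewrite oboxE => -[/andP[? ?] /andP[? ?]]; apply: (BU n).
  by rewrite cboxE; split; apply/andP; split; exact: ltW.
apply: (@sigma_algebra_bigcup _ setT) => n; apply: sub_sigma_algebra.
by exists (a n), (b n), (c n), (d n).
Qed.

Lemma measurable_g_oboxes : @measurable _ M2 = <<s oboxes >>.
Proof.
apply/seteqP; split; last first.
  apply: smallest_sub; first exact: sigma_algebra_measurable.
  by move=> _ [a [b [c [d ->]]]]; exact: measurable_obox.
rewrite measurable_prod_measurableType.
apply: smallest_sub; first exact: smallest_sigma_algebra.
pose T' := g_sigma_algebraType oboxes.
have mfst : measurable_fun [set: T'] (fst : T' -> measurableTypeR R).
  apply: (measurability _ (@measurable_realfun.RGenOpens.measurableE R)).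
  move=> _ [_ [a [b ->] <-]]; rewrite setTI; apply: open_g_oboxes.
  apply: (@open_comp _ _ (@fst R R)); last exact: interval_open.
  by move=> z _; exact: cvg_fst.
have msnd : measurable_fun [set: T'] (snd : T' -> measurableTypeR R).
  apply: (measurability _ (@measurable_realfun.RGenOpens.measurableE R)).
  move=> _ [_ [a [b ->] <-]]; rewrite setTI; apply: open_g_oboxes.
  apply: (@open_comp _ _ (@snd R R)); last exact: interval_open.
  by move=> z _; exact: cvg_snd.
move=> _ [A mA] [B mB] <-.
have := measurableI _ _ (mfst measurableT A mA) (msnd measurableT B mB).
by rewrite !setTI.
Qed.

(** Dynkin's pi-lambda theorem: open boxes are stable under intersection and generate the product
    sigma-algebra. *)
Lemma box_induction (P : set_system (R * R)) : P setT ->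
  (forall a b c d, P (obox a b c d)) ->
  (forall S, measurable (S : set M2) -> P S -> P (~` S)) ->
  (forall F : (set M2)^nat, (forall n, measurable (F n)) -> trivIset [set: nat] F ->
    (forall n, P (F n)) -> P (\bigcup_k F k)) ->
  forall S, measurable (S : set M2) -> P S.
Proof.
move=> PT Pbox PC PU S; rewrite measurable_g_oboxes.
apply: (@dynkin_induction _ M2 oboxes P) => //.
- exact: measurable_g_oboxes.
- exact: oboxes_setI.
- by move=> _ [a [b [c [d ->]]]].
Qed.

Lemma leb2_cbox a b c d : (mu (cbox a b c d) < +oo)%E.
Proof.
have -> : mu (cbox a b c d) =
    (@lebesgue_measure R `[a, b]%classic * @lebesgue_measure R `[c, d]%classic)%E.
  exact: product_measure1E.
by rewrite !lebesgue_measure_itv/=; case: ifP => _; case: ifP => _;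
  rewrite -?EFinD -?EFinM ?mule0 ?mul0e ?ltry.
Qed.

Lemma sigma_finite_leb2 : sigma_finite setT (leb2 R).
Proof.
exists (fun n => cbox (- (n%:R)) n%:R (- (n%:R)) n%:R) => [|n]; last first.
  by split; [exact: measurable_cbox|exact: leb2_cbox].
apply/seteqP; split=> // z _; exists (Num.truncn (Num.max `|z.1| `|z.2|)).+1 => //.
have := truncnS_gt (Num.max `|z.1| `|z.2|); rewrite gt_max => /andP[].
set n := _.+1; rewrite !ltr_norml => /andP[? ?] /andP[? ?].
by rewrite cboxE !ltW.
Qed.

(** A name of the planar measure that carries a sigma-finite structure, so that it can itself be a
    factor of the product measure on pairs of points used for mollification. *)
Definition leb2f : set M2 -> \bar R := leb2 R.

HB.instance Definition _ := Measure.copy leb2f (leb2 R).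
HB.instance Definition _ := Measure_isSigmaFinite.Build _ _ _ leb2f sigma_finite_leb2.

Definition leb2s : {sigma_finite_measure set M2 -> \bar R} := leb2f.

End plane_measure.

(** * Smooth bumps supported in boxes *)

Section bumps.
Variable R : realType.
Local Notation M2 := (measurableTypeR R * measurableTypeR R)%type.
Implicit Types (a b c d x : R) (z : R * R) (U : set (R * R)) (f g : R * R -> R).

Lemma smoothD f g : smooth f -> smooth g -> smooth (fun z => f z + g z).
Proof. by move=> sf sg k; exact: CkD. Qed.

Lemma smoothM f g : smooth f -> smooth g -> smooth (fun z => f z * g z).
Proof. by move=> sf sg k; exact: CkM. Qed.

Lemma smooth_cst (k : R) : smooth (fun=> k : R).
Proof. by move=> n; exact: Ck_cst. Qed.

Lemma smoothZ k f : smooth f -> smooth (fun z => k * f z).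
Proof. by move=> sf; apply: smoothM => //; exact: smooth_cst. Qed.

Lemma smoothN f : smooth f -> smooth (fun z => - f z).
Proof. by move=> sf; under eq_fun do rewrite -mulN1r; exact: smoothZ. Qed.

Lemma smoothB f g : smooth f -> smooth g -> smooth (fun z => f z - g z).
Proof. by move=> sf sg; apply: smoothD => //; exact: smoothN. Qed.

Lemma smooth_continuous f : smooth f -> continuous f.
Proof. by move=> /(_ 0%N); exact: Ck_continuous. Qed.

Lemma smooth_is_derive f u z : smooth f -> is_derive z u f ('D_u f z).
Proof. by move=> /(_ 1%N); exact: Ck_derivableP. Qed.

Lemma smooth_derive f u : smooth f -> smooth ('D_u f).
Proof. by move=> sf k; exact: Ck_derive. Qed.

Lemma smoothI f (df : R * R -> R * R -> R) : continuous f ->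
  (forall u z, is_derive z u f (df u z)) -> (forall u, smooth (df u)) -> smooth f.
Proof.
by move=> cf dfE sdf [|k]; [split=> // z _; exact: cf|apply: CkSd dfE _ => // u; exact: sdf].
Qed.

Lemma smooth_fst : smooth (fst : R * R -> R).
Proof.
apply: (@smoothI _ (fun u _ => u.1)) => [z|u z|u]; [exact: cvg_fst| |exact: smooth_cst].
have H : h^-1 *: ((h *: u + z).1 - z.1) @[h --> (0:R)^'] --> u.1.
  apply: cvg_near_cst; near=> h.
  rewrite /= addrK [_ *: _]mulrA mulVf ?mul1r//.
  by near: h; exact: nbhs_dnbhs_neq.
by split; [apply/cvg_ex; exists u.1|apply/cvg_lim].
Unshelve. all: end_near. Qed.

Lemma smooth_snd : smooth (snd : R * R -> R).
Proof.
apply: (@smoothI _ (fun u _ => u.2)) => [z|u z|u]; [exact: cvg_snd| |exact: smooth_cst].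
have H : h^-1 *: ((h *: u + z).2 - z.2) @[h --> (0:R)^'] --> u.2.
  apply: cvg_near_cst; near=> h.
  rewrite /= addrK [_ *: _]mulrA mulVf ?mul1r//.
  by near: h; exact: nbhs_dnbhs_neq.
by split; [apply/cvg_ex; exists u.2|apply/cvg_lim].
Unshelve. all: end_near. Qed.

Lemma smooth_derive_comm f u v z : smooth f -> 'D_v ('D_u f) z = 'D_u ('D_v f) z.
Proof.
move=> sf; apply: (@derive_comm _ _ f ('D_u f) ('D_v f) ('D_v ('D_u f)) ('D_u ('D_v f)) z u v).
- by move=> y; exact: smooth_is_derive.
- by move=> y; exact: smooth_is_derive.
- by move=> y; apply: smooth_is_derive; exact: smooth_derive.
- by move=> y; apply: smooth_is_derive; exact: smooth_derive.
- by apply: smooth_continuous; do 2 apply: smooth_derive.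
- by apply: smooth_continuous; do 2 apply: smooth_derive.
Qed.

Lemma smooth_msr f : smooth f -> measurable_fun [set: M2] f.
Proof. by move=> /smooth_continuous; exact: measurable_continuous2. Qed.

(** For [k > 0] and [a <= b] the quadratic is positive exactly on []a, b[]. As [k] grows the bump
    tends to the indicator of that interval, since [flat 1] tends to 1 at infinity. *)
Definition bump1 (k a b x : R) : R := flat 1 (k * ((x - a) * (b - x))).

Lemma flat1_ge0 x : 0 <= flat 1 x :> R.
Proof. by rewrite /flat; case: ifP => // _; rewrite hornerE mul1r expR_ge0. Qed.

Lemma flat1_le1 x : flat 1 x <= 1 :> R.
Proof.
rewrite /flat; case: ifP => // x0; rewrite hornerE mul1r -expR0 ler_expR oppr_le0.
by rewrite invr_ge0 ltW.
Qed.

Lemma flat1_gt0 x : (0 < flat 1 x :> R) = (0 < x).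
Proof.
by rewrite /flat; case: ifP => [_|]; rewrite ?ltxx// hornerE mul1r expR_gt0.
Qed.

Lemma bump1_ge0 k a b x : 0 <= bump1 k a b x.
Proof. exact: flat1_ge0. Qed.

Lemma bump1_le1 k a b x : bump1 k a b x <= 1.
Proof. exact: flat1_le1. Qed.

Lemma bump1_gt0 k a b x : 0 < k -> a < x < b -> 0 < bump1 k a b x.
Proof. by move=> k0 /andP[ax xb]; rewrite flat1_gt0 !mulr_gt0 ?subr_gt0. Qed.

Lemma bump1_eq0 k a b x : 0 < k -> a <= b -> ~~ (a < x < b) -> bump1 k a b x = 0.
Proof.
move=> k0 ab H; rewrite /bump1 /flat ifF//; apply/negbTE; rewrite -leNgt pmulr_rle0//.
move: H; rewrite negb_and -!leNgt => /orP[xa|bx].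
  by rewrite mulr_le0_ge0 ?subr_le0// subr_ge0 (le_trans xa).
by rewrite mulr_ge0_le0 ?subr_le0// subr_ge0 (le_trans ab).
Qed.

Lemma bump1_cvg a b x : a < x < b -> bump1 n.+1%:R a b x @[n --> \oo] --> (1 : R).
Proof.
move=> /andP[ax xb]; set t := (x - a) * (b - x).
have t0 : 0 < t by rewrite mulr_gt0 ?subr_gt0.
rewrite (_ : (fun n => _) = (fun n : nat => expR (- (t^-1 * n.+1%:R^-1)))); last first.
  apply/funext => n; rewrite /bump1 /flat -/t mulr_gt0// hornerE mul1r.
  by rewrite invfM mulrC.
have H : - (t^-1 * n.+1%:R^-1) @[n --> \oo] --> - (t^-1 * 0 : R).
  by apply: cvgN; apply: cvgM; [exact: cvg_cst|exact: cvg_harmonic].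
rewrite [X in _ --> X](_ : _ = expR (- (t^-1 * 0))); last first.
  by rewrite mulr0 oppr0 expR0.
by apply: continuous_cvg H; exact: continuous_expR.
Qed.

Definition bump k a b c d z : R := bump1 k a b z.1 * bump1 k c d z.2.

Lemma smooth_bump k a b c d : smooth (bump k a b c d).
Proof.
have H (p : R * R -> R) a' b' : smooth p -> smooth (fun z => bump1 k a' b' (p z)).
  move=> sp n; apply: (@Ck_flat _ _ n 1 (fun z => k * ((p z - a') * (b' - p z)))).
  move: n; apply: smoothZ; apply: smoothM; apply: smoothB => //; exact: smooth_cst.
by apply: smoothM; apply: H; [exact: smooth_fst|exact: smooth_snd].
Qed.

Lemma bump_itv k a b c d z : 0 <= bump k a b c d z <= 1.
Proof.
by rewrite mulr_ge0 ?bump1_ge0//= mulr_ile1 ?bump1_ge0 ?bump1_le1.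
Qed.

Lemma bump_gt0 k a b c d z : 0 < k -> obox a b c d z -> 0 < bump k a b c d z.
Proof. by move=> k0; rewrite oboxE => -[? ?]; rewrite mulr_gt0// bump1_gt0. Qed.

Lemma bump_eq0 k a b c d z : 0 < k -> a <= b -> c <= d ->
  ~ obox a b c d z -> bump k a b c d z = 0.
Proof.
move=> k0 ab cd; rewrite oboxE => H; rewrite /bump.
have [h1|h1] := boolP (a < z.1 < b); last by rewrite bump1_eq0 ?mul0r.
have [h2|h2] := boolP (c < z.2 < d); last by rewrite (@bump1_eq0 _ c) ?mulr0.
by case: H.
Qed.

Lemma bump_cvg a b c d z : a <= b -> c <= d ->
  bump n.+1%:R a b c d z @[n --> \oo] --> (\1_(obox a b c d) z : R).
Proof.
move=> ab cd; rewrite indicE; have [/[!inE]|/negP/[!inE] zn] := boolP (z \in _).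
  rewrite oboxE => -[z1 z2]; rewrite -[X in _ --> X](mulr1 1).
  by apply: cvgM; exact: bump1_cvg.
by apply: cvg_near_cst; apply: nearW => n; rewrite bump_eq0.
Qed.

Lemma test_fun_bump U k a b c d : 0 < k -> a <= b -> c <= d ->
  cbox a b c d `<=` U -> test_fun U (bump k a b c d).
Proof.
move=> k0 ab cd cU; split; first exact: smooth_bump.
exists (cbox a b c d); split=> //; first exact: compact_cbox.
move=> z zn; apply: bump_eq0 => //; rewrite oboxE => -[/andP[? ?] /andP[? ?]].
by apply: zn; rewrite cboxE !ltW.
Qed.

End bumps.

(** * The fundamental lemma of the calculus of variations *)

Section fundamental_lemma.
Variable R : realType.
Local Notation M2 := (measurableTypeR R * measurableTypeR R)%type.
Local Notation mu := (@leb2 R).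
Local Notation itg f := (mu.-integrable [set: M2] (EFin \o f)).
Local Notation msr f := (measurable_fun [set: M2] f).
Implicit Types (a b c d : R) (z : R * R) (U : set (R * R)) (f g : R * R -> R).

Global Instance leb2_ae_filter : @Filter (R * R)%type (nbhs (almost_everywhere mu)).
Proof. exact: (ae_filter_ringOfSetsType mu). Qed.

Lemma indic_bigcup_cvg (T : Type) (F : (set T)^nat) : trivIset [set: nat] F ->
  (forall n x, 0 <= \sum_(k < n) (\1_(F k) x : R) <= 1) /\
  forall x, \sum_(k < n) (\1_(F k) x : R) @[n --> \oo] --> (\1_(\bigcup_k F k) x : R).
Proof.
move=> tF.
have one n x k : F k x -> \sum_(j < n) (\1_(F j) x : R) = (k < n)%N%:R.
  move=> Fkx; have F0 j : j != k -> \1_(F j) x = 0 :> R.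
    move=> jk; rewrite indicE; case: (boolP (x \in _)) => // /[!inE] Fjx.
    case/negP: jk; apply/eqP; apply: (tF j k) => //.
    by exists x.
  have [kn|nk] := ltnP k n.
    rewrite (bigD1 (Ordinal kn))//= big1 ?addr0 => [|j /eqP jk].
      by rewrite indicE mem_set.
    by apply: F0; apply/eqP => jk'; apply: jk; exact: val_inj.
  by rewrite big1// => j _; apply: F0; rewrite ltn_eqF// (leq_trans (ltn_ord j)).
have zero n x : (forall k, ~ F k x) -> \sum_(j < n) (\1_(F j) x : R) = 0.
  by move=> H; rewrite big1// => j _; rewrite indicE memNset.
split=> [n x|x].
  have [[k Fkx]|/forallNP H] := pselect (exists k, F k x).
    by rewrite (one _ _ _ Fkx); case: (k < n)%N; rewrite ?lexx ?ler01.
  by rewrite zero// lexx ler01.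
have [[k Fkx]|/forallNP H] := pselect (exists k, F k x).
  apply: cvg_near_cst; exists k.+1 => // n /= kn.
  by rewrite (one _ _ _ Fkx) kn indicE mem_set//; exists k.
apply: cvg_near_cst; apply: nearW => n; rewrite zero// indicE memNset//.
by move=> [k _ /(H k)].
Qed.

Lemma sqbox_cvg z : (\1_(obox (- n%:R) n%:R (- n%:R) n%:R) z : R) @[n --> \oo] --> (1 : R).
Proof.
apply: cvg_near_cst; exists (Num.truncn (Num.max `|z.1| `|z.2|)).+1 => // n /= Nn.
have := truncnS_gt (Num.max `|z.1| `|z.2|); rewrite gt_max => /andP[].
have : (Num.truncn (Num.max `|z.1| `|z.2|)).+1%:R <= n%:R :> R by rewrite ler_nat.
move: (_.+1%:R) => N Nn' h1 h2.
have := lt_le_trans h1 Nn'; have := lt_le_trans h2 Nn'.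
rewrite !ltr_norml => /andP[? ?] /andP[? ?].
by rewrite indicE mem_set// oboxE; split; apply/andP; split.
Qed.

(** By [box_induction] the integral vanishes on every measurable set. The whole plane is reached
    through growing squares and disjoint unions through partial sums of indicators, both by
    dominated convergence. *)
Lemma Int_box_eq0 f : itg f ->
  (forall a b c d, \int[mu]_x (\1_(obox a b c d) x * f x) = 0) ->
  \forall x \ae mu, f x = 0.
Proof.
move=> fi fb.
have mi (S : set M2) : measurable S -> msr (fun x => \1_S x * f x).
  by move=> mS; apply: measurable_funM; [exact: measurable_indic|exact: itg_msr fi].
have ii (S : set M2) : measurable S -> itg (fun x => \1_S x * f x).
  move=> mS; apply: (itgMb (k := 1) _ _ fi); first exact: measurable_indic.
  by move=> x; rewrite indicE; case: (_ \in _); rewrite ?normr1 ?normr0.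
have fT : \int[mu]_x (f x) = 0.
  have : \int[mu]_x (\1_(obox (- n%:R) n%:R (- n%:R) n%:R) x * f x) @[n --> \oo] --> \int[mu]_x (f x).
    apply: (@dominated_Int _ _ _ mu (fun n x => \1_(obox (- n%:R) n%:R (- n%:R) n%:R) x * f x)
      f (fun x => `|f x|)).
    - by move=> n; apply: mi; exact: measurable_obox.
    - exact: itg_msr fi.
    - move=> x; rewrite -[X in _ --> X]mul1r; apply: cvgM; last exact: cvg_cst.
      exact: sqbox_cvg.
    - exact: itg_norm fi.
    - by move=> n x; rewrite indicE; case: (_ \in _); rewrite ?mul1r ?mul0r ?normr0.
  under eq_fun do rewrite fb.
  by move=> /cvg_lim <- //; rewrite lim_cst.
have fS (S : set M2) : measurable S -> \int[mu]_x (\1_S x * f x) = 0.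
  apply: (@box_induction R (fun S => \int[mu]_x (\1_S x * f x) = 0)) => {S}.
  - by under eq_Int do rewrite indicT mul1r.
  - exact: fb.
  - move=> S mS S0.
    have E x : \1_(~` S) x * f x = f x - \1_S x * f x.
      by rewrite !indicE in_setC; case: (_ \in _); rewrite ?mul0r ?mul1r ?subrr ?subr0.
    under eq_Int => x do rewrite E.
    by rewrite IntB ?S0 ?fT ?subr0//; exact: ii.
  - move=> F mF tF F0; have [Fb Fc] := indic_bigcup_cvg tF.
    have E n : \int[mu]_x ((\sum_(k < n) \1_(F k) x) * f x) = 0.
      elim: n => [|n IH]; first by under eq_Int do rewrite big_ord0 mul0r; rewrite Int0.
      under eq_Int do rewrite big_ord_recr/= mulrDl.
      rewrite IntD ?IH ?F0 ?addr0//; last exact: ii.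
      apply: (itgMb (k := 1) _ _ fi).
        by apply: measurable_sum => k; exact: measurable_indic.
      by move=> x; have /andP[h1 h2] := Fb n x; rewrite ger0_norm.
    have : \int[mu]_x ((\sum_(k < n) \1_(F k) x) * f x) @[n --> \oo] --> \int[mu]_x (\1_(\bigcup_k F k) x * f x).
      apply: (@dominated_Int _ _ _ mu (fun n x => (\sum_(k < n) \1_(F k) x) * f x)
        (fun x => \1_(\bigcup_k F k) x * f x) (fun x => `|f x|)).
      + move=> n; apply: measurable_funM; last exact: itg_msr fi.
        by apply: measurable_sum => k; exact: measurable_indic.
      + by apply: mi; exact: bigcupT_measurable.
      + by move=> x; apply: cvgM; [exact: Fc|exact: cvg_cst].
      + exact: itg_norm fi.
      + move=> n x; have /andP[h1 h2] := Fb n x.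
        by rewrite normrM (ger0_norm h1) ler_piMl.
    under eq_fun do rewrite E.
    by move=> /cvg_lim <- //; rewrite lim_cst.
have H : ae_eq mu setT (EFin \o f) (cst 0%E).
  apply: integral_ae_eq => //.
  move=> E _ mE; rewrite integral_cst// mul0e.
  have := fS E mE; rewrite /Rintegral => E0.
  rewrite integral_mkcond (_ : (\int[mu]_x _ = \int[mu]_x (\1_E x * f x)%:E)%E).
    by rewrite -[LHS]fineK ?E0//; exact: (integrable_fin_num _ (ii E mE)).
  apply: eq_integral => x _.
  by rewrite restrict_EFin/= indicE patchE; case: (_ \in _); rewrite ?mul1r ?mul0r.
by apply: filterS H => x /(_ I) [].
Qed.

(** On a box with closure in [U] the function is integrable, and its integrals over smaller boxes
    are limits of integrals against bumps, which are test functions of [U]. Countably many such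
    boxes cover [U]. *)
Lemma fundamental_lemma U f : open U -> loc_integrable U f ->
  (forall phi, test_fun U phi -> \int[mu]_(x in U) (f x * phi x) = 0) ->
  \forall x \ae mu, U x -> f x = 0.
Proof.
move=> oU fi f0; have [a [b [c [d [BU UB]]]]] := open_rat_cover oU.
have boxP a' b' c' d' : cbox a' b' c' d' `<=` U ->
    \forall x \ae mu, obox a' b' c' d' x -> f x = 0.
  move=> cU; pose B := obox a' b' c' d'.
  have oc a1 b1 c1 d1 : obox a1 b1 c1 d1 `<=` cbox a1 b1 c1 d1.
    by move=> z; rewrite oboxE cboxE => -[/andP[? ?] /andP[? ?]]; rewrite !ltW.
  have gi : itg (fun x => \1_B x * f x).
    have := integrableS (measurable_cbox a' b' c' d') (measurable_obox a' b' c' d')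
      (oc _ _ _ _) (fi _ (@compact_cbox _ a' b' c' d') cU).
    rewrite integrable_mkcond; last exact: measurable_obox.
    apply: eq_integrable => // x _; rewrite restrict_EFin/= indicE patchE.
    by case: (_ \in _); rewrite ?mul1r ?mul0r.
  suff /(Int_box_eq0 gi) : forall a1 b1 c1 d1,
      \int[mu]_z (\1_(obox a1 b1 c1 d1) z * (\1_B z * f z)) = 0.
    by move=> H; apply: filterS H => x + xB; rewrite indicE mem_set// mul1r.
  move=> a1 b1 c1 d1.
  pose a2 := Num.max a1 a'; pose b2 := Num.min b1 b'.
  pose c2 := Num.max c1 c'; pose d2 := Num.min d1 d'.
  (* An arbitrary box meets [B] in a box again, and the bumps of the latter are supported in [U]. *)
  have o2E : obox a2 b2 c2 d2 = obox a1 b1 c1 d1 `&` B by rewrite oboxI.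
  have E z : \1_(obox a1 b1 c1 d1) z * (\1_B z * f z) = \1_(obox a2 b2 c2 d2) z * (\1_B z * f z).
    rewrite o2E !indicE in_setI; case: (z \in B); rewrite ?andbT//.
    by rewrite !mul0r !mulr0.
  under eq_Int => z do rewrite E.
  have sub2 z : cbox a2 b2 c2 d2 z -> cbox a' b' c' d' z.
    rewrite !cboxE !ge_max !le_min.
    move=> [/andP[/andP[? ?] /andP[? ?]] /andP[/andP[? ?] /andP[? ?]]].
    by do ![split]; do ![apply/andP; split].
  have sub2o z : obox a2 b2 c2 d2 z -> B z by rewrite o2E => -[].
  have [[ab cd]|deg] := pselect (a2 <= b2 /\ c2 <= d2); last first.
    rewrite -[RHS](Int0 mu); apply: eq_Int => z; rewrite indicE memNset ?mul0r//.
    rewrite oboxE => -[/andP[h1 h2] /andP[h3 h4]]; apply: deg.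
    by split; [exact: ltW (lt_trans h1 h2)|exact: ltW (lt_trans h3 h4)].
  have : \int[mu]_z (bump n.+1%:R a2 b2 c2 d2 z * (\1_B z * f z)) @[n --> \oo] -->
      \int[mu]_z (\1_(obox a2 b2 c2 d2) z * (\1_B z * f z)).
    apply: (@dominated_Int _ _ _ mu (fun n z => bump n.+1%:R a2 b2 c2 d2 z * (\1_B z * f z))
      (fun z => \1_(obox a2 b2 c2 d2) z * (\1_B z * f z)) (fun z => `|\1_B z * f z|)).
    - move=> n; apply: measurable_funM; last exact: itg_msr gi.
      by apply: smooth_msr; exact: smooth_bump.
    - apply: measurable_funM; last exact: itg_msr gi.
      by apply: measurable_indic; exact: measurable_obox.
    - by move=> x; apply: cvgM; [exact: bump_cvg|exact: cvg_cst].
    - exact: itg_norm gi.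
    - move=> n x; have /andP[h1 h2] := bump_itv n.+1%:R a2 b2 c2 d2 x.
      by rewrite normrM (ger0_norm h1) ler_piMl.
  rewrite (_ : (fun _ => _) = (fun=> 0)) => [/cvg_lim <- //|]; first by rewrite lim_cst.
  apply/funext => n; rewrite -(f0 (bump n.+1%:R a2 b2 c2 d2)).
    rewrite [RHS]Rintegral_mkcond; apply: eq_Int => z; rewrite patchE.
    have [zo|zo] := pselect (obox a2 b2 c2 d2 z); last first.
      by rewrite bump_eq0// mul0r mulr0 if_same.
    rewrite mem_set; last by apply: cU; apply: oc; exact: sub2o.
    by rewrite indicE mem_set ?mul1r 1?mulrC//; exact: sub2o.
  by apply: test_fun_bump => // z /sub2; exact: cU.
have : \forall x \ae mu, forall n, obox (a n) (b n) (c n) (d n) x -> f x = 0.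
  by apply/ae_foralln => n; exact: boxP.
by move=> H; apply: filterS H => x H /UB[n]; exact: H.
Qed.

End fundamental_lemma.

(** * Test functions and integration by parts *)

Section test_functions.
Variable R : realType.
Local Notation M2 := (measurableTypeR R * measurableTypeR R)%type.
Local Notation mu := (@leb2 R).
Local Notation leb := (@lebesgue_measure R).
Local Notation itg f := (mu.-integrable [set: M2] (EFin \o f)).
Local Notation msr f := (measurable_fun [set: M2] f).
Local Notation sqi f := (sqi mu f).
Implicit Types (a b c d M : R) (z : R * R) (U : set (R * R)) (f g phi : R * R -> R).

Lemma compact_sqbox (K : set (R * R)) : compact K ->
  exists2 M, 0 < M & K `<=` cbox (- M) M (- M) M.
Proof.
move=> /compact_bounded[M [_ /(_ (`|M| + 1))]] MP.
exists (`|M| + 1); first by rewrite ltr_wpDl.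
move=> z /MP; rewrite (le_lt_trans (ler_norm M)) ?ltrDl// => /(_ isT) /=.
by rewrite prod_normE ge_max/= !ler_norml cboxE => /andP[].
Qed.

Lemma test_supp U phi : test_fun U phi ->
  exists2 M, 0 < M & forall z, ~ obox (- M) M (- M) M z -> phi z = 0.
Proof.
move=> [_ [K [cK _ phi0]]]; have [M M0 KM] := compact_sqbox cK.
exists (M + 1) => [|z zM]; first by rewrite addr_gt0.
apply: phi0 => /KM; rewrite cboxE => -[/andP[? ?] /andP[? ?]]; apply: zM.
by rewrite oboxE; split; apply/andP; split; lra.
Qed.

Lemma bounded_on_box f a b c d : continuous f ->
  exists2 k : R, 0 <= k & forall z, cbox a b c d z -> `|f z| <= k.
Proof.
move=> cf.
have /compact_bounded[M [_ /(_ (`|M| + 1))]] : compact (f @` cbox a b c d).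
  apply: continuous_compact; last exact: compact_cbox.
  exact: continuous_subspaceT.
rewrite (le_lt_trans (ler_norm M)) ?ltrDl// => /(_ isT) MP.
by exists (`|M| + 1) => [|z zB]; [rewrite addr_ge0|apply: MP; exists z].
Qed.

Lemma test_bounded U phi : test_fun U phi ->
  exists2 k : R, 0 <= k & forall z, `|phi z| <= k.
Proof.
move=> tphi; have [M M0 MP] := test_supp tphi.
have [k k0 kP] := bounded_on_box (- M) M (- M) M (smooth_continuous tphi.1).
exists k => // z; have [zB|/MP ->] := pselect (obox (- M) M (- M) M z); last by rewrite normr0.
by apply: kP; move: zB; rewrite oboxE cboxE => -[/andP[? ?] /andP[? ?]]; rewrite !ltW.
Qed.

Lemma test_funS U V phi : U `<=` V -> test_fun U phi -> test_fun V phi.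
Proof. by move=> UV [sphi [K [cK KU Kphi]]]; split => //; exists K; split=> // z /KU /UV. Qed.

Lemma test_fun_derive U phi u : test_fun U phi -> test_fun U ('D_u phi).
Proof.
move=> [sphi [K [cK KU Kphi]]]; split; first exact: smooth_derive.
exists K; split=> // z zK; rewrite -(derive_cst (0 : R) z u).
apply: near_eq_derive; have oK : open (~` K).
  by rewrite openC; apply: compact_closed => //; exact: norm_hausdorff.
have := oK z zK; rewrite /interior/=; apply: filterS => w; exact: Kphi.
Qed.

Lemma test_funM U phi f : smooth f -> test_fun U phi -> test_fun U (fun z => f z * phi z).
Proof.
move=> sf [sphi [K [cK KU Kphi]]]; split; first exact: smoothM.
by exists K; split=> // z /Kphi ->; rewrite mulr0.
Qed.

Lemma test_funZ U phi (k : R) : test_fun U phi -> test_fun U (fun z => k * phi z).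
Proof. by apply: test_funM; exact: smooth_cst. Qed.

Lemma test_funD U phi psi : test_fun U phi -> test_fun U psi ->
  test_fun U (fun z => phi z + psi z).
Proof.
move=> [sphi [K [cK KU Kphi]]] [spsi [L [cL LU Lpsi]]]; split; first exact: smoothD.
exists (K `|` L); split; first exact: compactU.
  by move=> z [/KU|/LU].
by move=> z /not_orP[/Kphi -> /Lpsi ->]; rewrite addr0.
Qed.

Lemma test_fun0 U : test_fun U (fun=> 0 : R).
Proof. by split; [exact: smooth_cst|exists set0; split=> //; exact: compact0]. Qed.

Lemma sqi_bounded f (k : R) a b c d : msr f -> (forall z, `|f z| <= k) ->
  (forall z, ~ cbox a b c d z -> f z = 0) -> sqi f.
Proof.
move=> mf fk f0; split => //.
apply: (@itg_le _ _ _ mu _ (fun z => k ^+ 2 * \1_(cbox a b c d) z)).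
- exact: measurable_funX.
- move=> z; rewrite indicE; have [zB|/f0 ->] := pselect (cbox a b c d z).
    by rewrite mem_set// mulr1 normrX lerXn2r ?nnegrE// (le_trans _ (fk z)).
  by rewrite expr0n normr0 mulr_ge0 ?sqr_ge0.
- by apply: itgZ; apply: itg_indic; [exact: measurable_cbox|exact: leb2_cbox].
Qed.

Lemma sqi_boxed_itg f a b c d : (forall z, ~ cbox a b c d z -> f z = 0) -> sqi f -> itg f.
Proof. by move=> f0 fi; apply: (sqi_itg (measurable_cbox a b c d) (leb2_cbox a b c d)). Qed.

Lemma test_msr U phi : test_fun U phi -> msr phi.
Proof. by case=> /smooth_msr. Qed.

Lemma test_supp_cbox U phi : test_fun U phi ->
  exists2 M, 0 < M & forall z, ~ cbox (- M) M (- M) M z -> phi z = 0.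
Proof.
move=> /test_supp[M M0 MP]; exists M => // z zM; apply: MP; apply: contra_not zM.
by rewrite oboxE cboxE => -[/andP[? ?] /andP[? ?]]; rewrite !ltW.
Qed.

Lemma test_sqi U phi : test_fun U phi -> sqi phi.
Proof.
move=> tphi; have [k k0 kP] := test_bounded tphi.
have [M M0 MP] := test_supp_cbox tphi.
by apply: sqi_bounded MP => //; exact: test_msr tphi.
Qed.

Lemma test_itg U phi : test_fun U phi -> itg phi.
Proof.
move=> tphi; have [M M0 MP] := test_supp_cbox tphi.
by apply: sqi_boxed_itg MP _; exact: test_sqi tphi.
Qed.

Lemma itgM_test U phi f : test_fun U phi -> itg f -> itg (fun z => f z * phi z).
Proof.
move=> tphi fi; have [k k0 kP] := test_bounded tphi.
by apply: (itg_eq _ (itgMb (test_msr tphi) kP fi)) => z; rewrite mulrC.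
Qed.

Lemma Int_itv (F f : R -> R) (a b : R) : a < b -> (forall x : R, is_derive x (1 : R) F (f x)) ->
  continuous f -> (forall x : R, ~ (a <= x <= b) -> f x = 0) ->
  \int[leb]_x f x = F b - F a.
Proof.
move=> ab Ff cf f0.
have cF x : {for x, continuous F}.
  by apply/differentiable_continuous/derivable1_diffP; have [] := Ff x.
have E : (\int[leb]_(x in `[a, b]) (f x)%:E = (F b)%:E - (F a)%:E)%E.
  apply: continuous_FTC2 => //.
  - exact: continuous_subspaceT.
  - split=> [x _| |]; first by have [] := Ff x.
      by apply: cvg_at_right_filter; exact: cF.
    by apply: cvg_at_left_filter; exact: cF.
  - by move=> x _; rewrite derive1E; have [] := Ff x.
have -> : F b - F a = fine ((F b)%:E - (F a)%:E)%E by [].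
rewrite -E /Rintegral [in RHS]integral_mkcond; congr fine; apply: eq_integral => x _.
rewrite patchE; case: ifPn => // /negP xn; rewrite f0// => H.
by apply: xn; rewrite inE/= in_itv.
Qed.

Lemma test_supp_derive U phi u : test_fun U phi -> exists2 M, 0 < M &
  (forall z, ~ obox (- M) M (- M) M z -> phi z = 0) /\
  (forall z, ~ obox (- M) M (- M) M z -> 'D_u phi z = 0).
Proof.
move=> tphi; have [M M0 MP] := test_supp tphi.
have [N N0 NP] := test_supp (test_fun_derive u tphi).
have sub P Q z : 0 < P -> 0 < Q -> ~ obox (- (P + Q)) (P + Q) (- (P + Q)) (P + Q) z ->
    ~ obox (- P) P (- P) P z.
  move=> P0 Q0; apply: contra_not; rewrite !oboxE => -[/andP[? ?] /andP[? ?]].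
  by split; apply/andP; split; lra.
exists (M + N); first exact: addr_gt0.
by split=> z zn; [apply: MP; exact: (sub M N)|apply: NP; apply: (sub N M) => //; rewrite addrC].
Qed.

Lemma is_derive_slice1 phi x y : smooth phi ->
  is_derive (x : R) (1 : R) (fun s : R => phi (s, y)) ('D_(1, 0) phi (x, y)).
Proof.
move=> sphi; apply: (@is_derive_affine _ _ _ _ phi (fun s : R => (s, y)) x 1 (1, 0)).
  by move=> h; rewrite -[RHS]/(h *: 1 + x, h *: 0 + y) scaler0 add0r.
exact: smooth_is_derive.
Qed.

Lemma is_derive_slice2 phi x y : smooth phi ->
  is_derive (y : R) (1 : R) (fun s : R => phi (x, s)) ('D_(0, 1) phi (x, y)).
Proof.
move=> sphi; apply: (@is_derive_affine _ _ _ _ phi (fun s : R => (x, s)) y 1 (0, 1)).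
  by move=> h; rewrite -[RHS]/(h *: 0 + x, h *: 1 + y) scaler0 add0r.
exact: smooth_is_derive.
Qed.

Lemma continuous_slice1 phi y : continuous phi -> continuous (fun s : R => phi (s, y)).
Proof.
move=> cphi x; apply: (continuous_comp (f := fun s : R => (s, y))); last exact: cphi.
exact: (cvg_pair cvg_id (cvg_cst y)).
Qed.

Lemma continuous_slice2 phi x : continuous phi -> continuous (fun s : R => phi (x, s)).
Proof.
move=> cphi y; apply: (continuous_comp (f := fun s : R => (x, s))); last exact: cphi.
exact: (cvg_pair (cvg_cst x) cvg_id).
Qed.

Lemma Int_derive1_test U phi : test_fun U phi -> \int[mu]_z ('D_(1, 0) phi z) = 0.
Proof.
move=> tphi; have [M M0 [MP DP]] := test_supp_derive (1, 0) tphi.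
have [_ ->] := Int_prod2 (test_itg (test_fun_derive (1, 0) tphi)).
rewrite -[RHS](Int0 leb); apply: eq_Int => y.
transitivity (phi (M, y) - phi (- M, y)); last first.
  by rewrite !MP ?subrr//; rewrite oboxE/= => -[/andP[? ?] _]; lra.
apply: (@Int_itv (fun s => phi (s, y)) (fun s => 'D_(1, 0) phi (s, y))).
- by lra.
- by move=> x; apply: is_derive_slice1 tphi.1.
- exact: (continuous_slice1 (y := y) (smooth_continuous (smooth_derive (1, 0) tphi.1))).
- by move=> x xM; apply: DP; rewrite oboxE => -[/andP[? ?] _]; apply: xM; rewrite !ltW.
Qed.

Lemma Int_derive2_test U phi : test_fun U phi -> \int[mu]_z ('D_(0, 1) phi z) = 0.
Proof.
move=> tphi; have [M M0 [MP DP]] := test_supp_derive (0, 1) tphi.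
have [_ ->] := Int_prod1 (test_itg (test_fun_derive (0, 1) tphi)).
rewrite -[RHS](Int0 leb); apply: eq_Int => x.
transitivity (phi (x, M) - phi (x, - M)); last first.
  by rewrite !MP ?subrr//; rewrite oboxE/= => -[_ /andP[? ?]]; lra.
apply: (@Int_itv (fun s => phi (x, s)) (fun s => 'D_(0, 1) phi (x, s))).
- by lra.
- by move=> y; apply: is_derive_slice2 tphi.1.
- exact: (continuous_slice2 (x := x) (smooth_continuous (smooth_derive (0, 1) tphi.1))).
- by move=> y yM; apply: DP; rewrite oboxE => -[_ /andP[? ?]]; apply: yM; rewrite !ltW.
Qed.

Lemma Int_derive_test U phi (i : 'I_2) : test_fun U phi ->
  \int[mu]_z ('D_(dir R i) phi z) = 0.
Proof.
by rewrite /dir; case: ifP => _; [exact: Int_derive1_test|exact: Int_derive2_test].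
Qed.

Lemma Int_byparts U phi f (i : 'I_2) : smooth f -> test_fun U phi ->
  \int[mu]_z (f z * 'D_(dir R i) phi z) = - \int[mu]_z ('D_(dir R i) f z * phi z).
Proof.
move=> sf tphi; set u := dir R i.
have E z : 'D_u (fun w => f w * phi w) z = f z * 'D_u phi z + 'D_u f z * phi z.
  have h1 := smooth_is_derive u z sf; have h2 := smooth_is_derive u z tphi.1.
  by have [_ ->] := is_deriveM h1 h2; rewrite [X in _ + X]mulrC.
have := Int_derive_test i (test_funM sf tphi).
under eq_Int do rewrite E.
rewrite IntD; first by move=> /eqP; rewrite addr_eq0 => /eqP.
  exact: test_itg (test_funM sf (test_fun_derive u tphi)).
exact: test_itg (test_funM (smooth_derive u sf) tphi).
Qed.

End test_functions.

                                                     

(** * Density of test functions in [L^2] *)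

Section density.
Variable R : realType.
Local Notation M2 := (measurableTypeR R * measurableTypeR R)%type.
Local Notation mu := (@leb2 R).
Local Notation itg f := (mu.-integrable [set: M2] (EFin \o f)).
Local Notation msr f := (measurable_fun [set: M2] f).
Local Notation sqi f := (sqi mu f).
Implicit Types (a b c d M e : R) (z : R * R) (f g h : R * R -> R).

Definition approximable f := forall e, 0 < e ->
  exists2 h, test_fun setT h & \int[mu]_z ((f z - h z) ^+ 2) <= e.

Lemma Int_sq_triangle f g h : sqi f -> sqi g -> sqi h ->
  \int[mu]_z ((f z - h z) ^+ 2) <=
  2 * \int[mu]_z ((f z - g z) ^+ 2) + 2 * \int[mu]_z ((g z - h z) ^+ 2).
Proof.
move=> sf sg sh; have fg := (sqiB sf sg).2; have gh := (sqiB sg sh).2.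
rewrite -!IntZ// -IntD; [|exact: itgZ..].
apply: le_Int; [exact: (sqiB sf sh).2|by apply: itgD; exact: itgZ|].
by move=> z; have := sqr_ge0 (f z - g z - (g z - h z)); nra.
Qed.

Lemma approximable_close f : sqi f ->
  (forall e, 0 < e -> exists g, [/\ sqi g, approximable g &
    \int[mu]_z ((f z - g z) ^+ 2) <= e]) -> approximable f.
Proof.
move=> sf H e e0; have e4 : 0 < e / 4 by rewrite divr_gt0.
have [g [sg ag fg]] := H _ e4; have [h th gh] := ag _ e4.
exists h => //; apply: (le_trans (Int_sq_triangle sf sg (test_sqi th))).
by move: fg gh; lra.
Qed.

(** Dominated convergence for the squared distance, whose majorant is [4 g^2]; this is how every
    limit passage below is made. *)
Lemma approximable_seq (f_ : nat -> R * R -> R) f g :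
  (forall n, sqi (f_ n)) -> (forall n, approximable (f_ n)) -> msr f ->
  (forall z, f_ ^~ z @ \oo --> f z) -> sqi g ->
  (forall n z, `|f_ n z| <= `|g z|) -> (forall z, `|f z| <= `|g z|) ->
  approximable f.
Proof.
move=> sf_ af_ mf ff sg f_g fg.
have sf := sqi_le mf sg fg; apply: approximable_close => // e e0.
have : \int[mu]_z ((f z - f_ n z) ^+ 2) @[n --> \oo] --> \int[mu]_z (0 : R).
  apply: (@dominated_Int _ _ _ mu (fun n z => (f z - f_ n z) ^+ 2) (fun=> 0)
    (fun z => 4 * g z ^+ 2)).
  - by move=> n; apply: measurable_funX; apply: measurable_funB => //; exact: (sf_ n).1.
  - exact: measurable_cst.
  - move=> z; rewrite -[X in _ --> X](expr0n R 2) -(subrr (f z)).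
    rewrite expr2; apply: cvgM; apply: cvgB => //; exact: cvg_cst.
  - exact: itgZ sg.2.
  - move=> n z; rewrite ger0_norm ?sqr_ge0//.
    have := f_g n z; have := fg z; rewrite -(real_normK (num_real (g z))).
    move: (`|g z|) => G; rewrite !ler_norml => /andP[? ?] /andP[? ?]; nra.
rewrite Int0 => /cvgrPdist_le/(_ _ e0)[N _ /(_ N (leqnn N))].
rewrite sub0r normrN => H; exists (f_ N); split=> //.
exact: le_trans (ler_norm _) H.
Qed.

Lemma approximableD f g : sqi f -> sqi g -> approximable f -> approximable g ->
  approximable (fun z => f z + g z).
Proof.
move=> sf sg af ag e e0; have e4 : 0 < e / 4 by rewrite divr_gt0.
have [h th fh] := af _ e4; have [k tk gk] := ag _ e4.
exists (fun z => h z + k z); first exact: test_funD.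
have sh := (sqiB sf (test_sqi th)).2; have sk := (sqiB sg (test_sqi tk)).2.
apply: (@le_trans _ _ (2 * \int[mu]_z ((f z - h z) ^+ 2) + 2 * \int[mu]_z ((g z - k z) ^+ 2))).
  rewrite -!IntZ// -IntD; [|exact: itgZ..].
  apply: le_Int.
  - exact: (sqiB (sqiD sf sg) (sqiD (test_sqi th) (test_sqi tk))).2.
  - by apply: itgD; exact: itgZ.
  - by move=> z; have := sqr_ge0 (f z - h z - (g z - k z)); nra.
by move: fh gk; lra.
Qed.

Lemma approximableZ (k : R) f : sqi f -> approximable f ->
  approximable (fun z => k * f z).
Proof.
move=> sf af e e0; have k0 : 0 < k ^+ 2 + 1 by rewrite ltr_wpDl ?sqr_ge0.
have ek : 0 < e / (k ^+ 2 + 1) by rewrite divr_gt0.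
have [h th fh] := af _ ek; exists (fun z => k * h z); first exact: test_funZ.
have E z : (k * f z - k * h z) ^+ 2 = k ^+ 2 * (f z - h z) ^+ 2 by ring.
under eq_Int do rewrite E.
rewrite IntZ; last exact: (sqiB sf (test_sqi th)).2.
rewrite ler_pdivlMr// in fh; apply: le_trans fh; rewrite mulrC ler_wpM2l// ?lerDl//.
by apply: Int_ge0 => z; exact: sqr_ge0.
Qed.

Lemma approximable0 : approximable (fun=> 0).
Proof.
move=> e e0; exists (fun=> 0); first exact: test_fun0.
by under eq_Int do rewrite subrr expr0n; rewrite Int0 ltW.
Qed.

Lemma sqi_indic_obox a b c d : sqi (\1_(obox a b c d) : R * R -> R).
Proof.
apply: (@sqi_bounded R _ 1 a b c d).
- by apply: measurable_indic; exact: measurable_obox.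
- by move=> z; rewrite indicE; case: (_ \in _); rewrite ?normr1 ?normr0.
- move=> z zn; rewrite indicE memNset//; apply: contra_not zn.
  by rewrite oboxE cboxE => -[/andP[? ?] /andP[? ?]]; rewrite !ltW.
Qed.

Lemma approximable_obox a b c d : approximable (\1_(obox a b c d) : R * R -> R).
Proof.
have [[ab cd]|deg] := pselect (a <= b /\ c <= d); last first.
  rewrite (_ : \1_ _ = (fun=> 0)); first exact: approximable0.
  apply/funext => z; rewrite indicE memNset//.
  rewrite oboxE => -[/andP[h1 h2] /andP[h3 h4]]; apply: deg.
  by split; [exact: ltW (lt_trans h1 h2)|exact: ltW (lt_trans h3 h4)].
have tb n : test_fun setT (bump n.+1%:R a b c d) by exact: test_fun_bump.
apply: (@approximable_seq (fun n => bump n.+1%:R a b c d) _ (\1_(obox a b c d) : R * R -> R)).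
- by move=> n; exact: test_sqi (tb n).
- move=> n e e0; exists (bump n.+1%:R a b c d) => //.
  by under eq_Int do rewrite subrr expr0n; rewrite Int0 ltW.
- by apply: measurable_indic; exact: measurable_obox.
- by move=> z; exact: bump_cvg.
- exact: sqi_indic_obox.
- move=> n z; have [zo|zn] := pselect (obox a b c d z); last by rewrite bump_eq0// normr0.
  rewrite indicE mem_set// normr1; have /andP[h1 h2] := bump_itv n.+1%:R a b c d z.
  by rewrite ger0_norm.
- by [].
Qed.

(** By [box_induction]; the factor cutting off to a fixed square keeps even the indicators of
    complements square integrable. *)
Lemma approximable_indic M (S : set M2) : measurable S ->
  approximable (fun z => \1_S z * \1_(obox (- M) M (- M) M) z : R).
Proof.
pose B := obox (- M) M (- M) M.
have mB : measurable (B : set M2) by exact: measurable_obox.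
have mi (S' : set M2) : measurable S' -> msr (fun z => \1_S' z * \1_B z : R).
  by move=> mS; apply: measurable_funM; exact: measurable_indic.
have le1 (S' : set M2) z : `|\1_S' z * \1_B z : R| <= `|\1_B z : R|.
  by rewrite indicE; case: (z \in S'); rewrite ?mul1r ?mul0r ?normr0.
have si (S' : set M2) : measurable S' -> sqi (fun z => \1_S' z * \1_B z : R).
  by move=> mS; apply: sqi_le (mi _ mS) (sqi_indic_obox (- M) M (- M) M) (le1 S').
apply: (@box_induction R (fun S => approximable (fun z => \1_S z * \1_B z : R))) => {S}.
- by rewrite indicT; under eq_fun do rewrite mul1r; exact: approximable_obox.
- move=> a b c d.
  rewrite (_ : (fun z => _) = \1_(obox a b c d `&` B)); last first.
    by apply/funext => z; rewrite !indicE in_setI; case: (_ \in _); case: (_ \in _); rewrite ?mul1r ?mul0r.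
  by rewrite oboxI; exact: approximable_obox.
- move=> S mS aS.
  rewrite (_ : (fun z => _) = (fun z => \1_B z + (-1) * (\1_S z * \1_B z))); last first.
    by apply/funext => z; rewrite !indicE in_setC; case: (z \in S); rewrite /= ?mul0r ?mul1r ?mulr0 ?addr0 ?mulN1r ?subrr.
  apply: approximableD; [exact: sqi_indic_obox| |exact: approximable_obox|].
    by apply: sqiZ; exact: si.
  by apply: approximableZ => //; exact: si.
- move=> F mF tF aF; have [Fb Fc] := indic_bigcup_cvg R tF.
  have mS n : msr (fun z => (\sum_(k < n) \1_(F k) z) * \1_B z : R).
    apply: measurable_funM; last exact: measurable_indic.
    by apply: measurable_sum => k; exact: measurable_indic.
  have Sle n z : `|(\sum_(k < n) \1_(F k) z) * \1_B z : R| <= `|\1_B z : R|.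
    by have /andP[h1 h2] := Fb n z; rewrite normrM (ger0_norm h1) ler_piMl.
  have sS n : sqi (fun z => (\sum_(k < n) \1_(F k) z) * \1_B z : R).
    exact: sqi_le (mS n) (sqi_indic_obox (- M) M (- M) M) (Sle n).
  apply: (@approximable_seq (fun n z => (\sum_(k < n) \1_(F k) z) * \1_B z) _ (\1_B)) => //.
  + elim=> [|n IH]; first by under eq_fun do rewrite big_ord0 mul0r; exact: approximable0.
    under eq_fun do rewrite big_ord_recr/= mulrDl.
    exact: (approximableD (sS n) (si _ (mF n)) IH (aF n)).
  + by apply: mi; exact: bigcupT_measurable.
  + by move=> z; apply: cvgM; [exact: Fc|exact: cvg_cst].
  + exact: sqi_indic_obox.
Qed.

Import HBNNSimple.

(** [f] is the limit of simple functions below it, each a finite combination of indicators covered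
    by [approximable_indic] once cut off to the square. *)
Lemma approximable_nneg M f : sqi f -> (forall z, 0 <= f z) ->
  (forall z, ~ obox (- M) M (- M) M z -> f z = 0) -> approximable f.
Proof.
move=> sf f0 fB; pose B := obox (- M) M (- M) M.
have mf := sf.1; have mF : measurable_fun [set: M2] (EFin \o f) by exact/measurable_EFinP.
pose s := nnsfun_approx measurableT mF.
have sle n z : s n z <= f z.
  rewrite -lee_fin nnsfun_approxE; apply: (le_approx (f := EFin \o f)) => //.
  by move=> w _; rewrite lee_fin.
have sc z : s n z @[n --> \oo] --> f z.
  under eq_fun do rewrite nnsfun_approxE.
  by apply: (cvg_approx (f := EFin \o f)) => //; rewrite ?ltry// => w _; rewrite lee_fin.
have s0 n z : 0 <= s n z by exact: fun_ge0.
have ms n : msr (s n) by [].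
have ab n : approximable (fun z => s n z * \1_B z).
  have [k [t E]] : exists k (t : seq R), forall z,
      s n z = \sum_(i < k) (t`_i * \1_(s n @^-1` [set t`_i]) z).
    by eexists; eexists; move=> z; exact: fimfunEord.
  rewrite (_ : (fun z => _) =
      (fun z => \sum_(i < k) (t`_i * (\1_(s n @^-1` [set t`_i]) z * \1_B z)))); last first.
    by apply/funext => z; rewrite {1}E mulr_suml; apply: eq_bigr => i _; rewrite mulrA.
  move: k {E} => k.
  have sP i : sqi (fun z => t`_i * (\1_(s n @^-1` [set t`_i]) z * \1_B z)).
    apply: sqiZ; apply: (sqiMb (k := 1)) (sqi_indic_obox (- M) M (- M) M).
      by apply: measurable_indic; rewrite -[X in measurable X]setTI; exact: ms.
    by move=> z; rewrite indicE; case: (_ \in _); rewrite ?normr1 ?normr0.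
  elim: k => [|k IH]; first by under eq_fun do rewrite big_ord0; exact: approximable0.
  under eq_fun do rewrite big_ord_recr/=.
  apply: approximableD => //.
    elim: k {IH} => [|k IH]; under eq_fun do rewrite ?big_ord0 ?big_ord_recr/=.
      exact: test_sqi (test_fun0 setT).
    exact: sqiD.
  apply: approximableZ.
    apply: (sqiMb (k := 1)) (sqi_indic_obox (- M) M (- M) M).
      by apply: measurable_indic; rewrite -[X in measurable X]setTI; exact: ms.
    by move=> z; rewrite indicE; case: (_ \in _); rewrite ?normr1 ?normr0.
  by apply: approximable_indic; rewrite -[X in measurable X]setTI; exact: ms.
have mB : measurable (B : set M2) by exact: measurable_obox.
have sB n z : `|s n z * \1_B z| <= `|f z|.
  rewrite indicE ger0_norm ?mulr_ge0// (ger0_norm (f0 z)).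
  by apply: le_trans (sle n z); rewrite ler_piMr//; case: (_ \in _).
apply: (approximable_seq (f_ := fun n z => s n z * \1_B z) (g := f)) => //.
- move=> n; have mS : msr (fun z => s n z * \1_B z).
    by apply: measurable_funM => //; exact: measurable_indic.
  exact: (sqi_le mS sf (sB n)).
- move=> z; rewrite indicE; have [zB|zB] := pselect (B z).
    by rewrite mem_set//; under eq_fun do rewrite mulr1; exact: sc.
  by rewrite memNset//; under eq_fun do rewrite mulr0; rewrite fB//; exact: cvg_cst.
Qed.

Lemma approximable_boxed M f : sqi f ->
  (forall z, ~ obox (- M) M (- M) M z -> f z = 0) -> approximable f.
Proof.
move=> sf fB.
pose fp z := (`|f z| + f z) / 2; pose fm z := (`|f z| - f z) / 2.
have -> : f = (fun z => fp z + (-1) * fm z) by apply/funext => z; rewrite /fp /fm; field.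
have mn : msr (fun z => `|f z|) by apply: measurableT_comp => //; exact: sf.1.
have bnd x : 0 <= (`|x| + x) / 2 <= `|x :> R|.
  by have := ler_norm x; have := ler_norm (- x); rewrite normrN => h1 h2; apply/andP; split; lra.
have bnd' x : 0 <= (`|x| - x) / 2 <= `|x :> R|.
  by have := bnd (- x); rewrite normrN.
have sp : sqi fp.
  have mp : msr fp.
    by apply: measurable_funM => //; apply: measurable_funD => //; exact: sf.1.
  apply: (sqi_le mp sf).
  by move=> z; have /andP[h1 h2] := bnd (f z); rewrite ger0_norm.
have sm : sqi fm.
  have mm : msr fm.
    by apply: measurable_funM => //; apply: measurable_funB => //; exact: sf.1.
  apply: (sqi_le mm sf).
  by move=> z; have /andP[h1 h2] := bnd' (f z); rewrite ger0_norm.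
apply: approximableD => //.
- exact: sqiZ.
- apply: (@approximable_nneg M) => // z; first by have /andP[] := bnd (f z).
  by move=> /fB; rewrite /fp => ->; rewrite normr0 addr0 mul0r.
- apply: approximableZ => //; apply: (@approximable_nneg M) => // z.
    by have /andP[] := bnd' (f z).
  by move=> /fB; rewrite /fm => ->; rewrite normr0 subr0 mul0r.
Qed.

End density.

(** * Mollification as a bilinear form *)

Section kernel.
Variable R : realType.
Local Notation M2 := (measurableTypeR R * measurableTypeR R)%type.
Local Notation mu := (@leb2 R).
Local Notation mu2 := (@leb2s R \x @leb2s R)%E.
Local Notation leb := (@lebesgue_measure R).
Local Notation itg f := (mu.-integrable [set: M2] (EFin \o f)).
Local Notation msr f := (measurable_fun [set: M2] f).
Local Notation sqi f := (sqi mu f).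
Implicit Types (a b c d M e r : R) (z y : R * R) (f g h phi : R * R -> R).

Lemma Int_translation (G : R -> R) (c : R) : continuous G -> (forall x, 0 <= G x) ->
  \int[leb]_x G (x - c) = \int[leb]_x G x.
Proof.
move=> cG G0.
have D (x : R) : is_derive x (1 : R) (fun s : R => s - c) 1.
  by rewrite -[X in is_derive _ _ _ X]subr0; exact: is_deriveB.
have DE : (fun s : R => s - c)^`()%classic = cst 1.
  by apply/funext => x; rewrite derive1E; have [] := D x.
rewrite /Rintegral (@increasing_ge0_integration_by_substitutionT R (fun x => x - c) G) => //.
- by congr fine; apply: eq_integral => x _; rewrite DE/= fctE/= mulr1.
- by move=> x y xy; rewrite ltrD2r.
- by rewrite DE; move=> x; exact: cvg_cst.
- by rewrite DE; exact: is_cvg_cst.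
- by rewrite DE; exact: is_cvg_cst.
- by apply/cvgrNyPle => A; near=> x; rewrite lerBlDr; near: x; apply: nbhs_ninfty_le; exact: num_real.
- by apply/cvgryPge => A; near=> x; rewrite lerBrDr; near: x; apply: nbhs_pinfty_ge; exact: num_real.
Unshelve. all: end_near. Qed.

Lemma derive_opp f u z : smooth f -> 'D_(- u) f z = - 'D_u f z.
Proof.
move=> sf.
have [|||_] := @derive_add _ _ f z u (- u).
- by near=> w; have [] := smooth_is_derive u w sf.
- exact: smooth_continuous (smooth_derive u sf) _.
- by have [] := smooth_is_derive (- u) z sf.
by rewrite subrr derive0 => /esym/eqP; rewrite addrC addr_eq0 => /eqP.
Unshelve. all: end_near. Qed.

Lemma is_derive_translate f y u z : smooth f ->
  is_derive z u (fun w => f (w - y)) ('D_u f (z - y)).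
Proof.
move=> sf; apply: (@is_derive_affine _ _ _ _ f (fun w => w - y) z u u).
  by move=> h; rewrite addrA.
exact: smooth_is_derive.
Qed.

Lemma is_derive_reflect f y u z : smooth f ->
  is_derive z u (fun w => f (y - w)) (- 'D_u f (y - z)).
Proof.
move=> sf; apply: (@is_derive_affine _ _ _ _ f (fun w => y - w) z u (- u)).
  by move=> h; rewrite scalerN opprD addrCA.
by rewrite -derive_opp//; exact: smooth_is_derive.
Qed.

Lemma smooth_translate f y : smooth f -> smooth (fun w => f (w - y)).
Proof.
move=> sf k; have := @Ck_affine _ _ k f (- y) 1 (sf k).
by under eq_fun do rewrite scale1r addrC.
Qed.

Lemma smooth_reflect f y : smooth f -> smooth (fun w => f (y - w)).
Proof.
move=> sf k; have := @Ck_affine _ _ k f y (-1) (sf k).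
by under eq_fun do rewrite scaleN1r.
Qed.

(** A mollifier that is not normalised: the estimates below carry its integral [mass r] as a
    factor. *)
Definition rho r : R * R -> R := bump 1 (- r) r (- r) r.

Lemma rhoN r z : rho r (- z) = rho r z.
Proof.
have H x : bump1 1 (- r) r (- x) = bump1 1 (- r) r x :> R.
  by rewrite /bump1; congr flat; ring.
by rewrite /rho /bump/= !H.
Qed.

Lemma rho_ge0 r z : 0 <= rho r z.
Proof. by have /andP[] := bump_itv 1 (- r) r (- r) r z. Qed.

Lemma rho_le1 r z : rho r z <= 1.
Proof. by have /andP[] := bump_itv 1 (- r) r (- r) r z. Qed.

Lemma rho_eq0 r z : 0 < r -> ~ (`|z.1| < r /\ `|z.2| < r) -> rho r z = 0.
Proof.
move=> r0 zr; rewrite /rho bump_eq0//; [lra|lra|].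
by rewrite oboxE -!ltr_norml.
Qed.

Lemma smooth_rho r : smooth (rho r). Proof. exact: smooth_bump. Qed.

Lemma test_rho_translate r y : 0 < r -> test_fun setT (fun z => rho r (z - y)).
Proof.
move=> r0; split; first exact: smooth_translate (smooth_rho r).
exists (cbox (y.1 - r) (y.1 + r) (y.2 - r) (y.2 + r)); split=> //; first exact: compact_cbox.
move=> z zn; apply: rho_eq0 => // -[/=]; rewrite !ltr_norml => /andP[? ?] /andP[? ?].
by apply: zn; rewrite cboxE; split; apply/andP; split; lra.
Qed.

Definition mass r : R := \int[mu]_z rho r z.

Lemma itg_real (G : R -> R) (a b : R) : continuous G ->
  (forall x, ~ (a <= x <= b) -> G x = 0) -> leb.-integrable setT (EFin \o G).
Proof.
move=> cG G0.
have : leb.-integrable `[a, b] (EFin \o G).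
  by apply: continuous_compact_integrable; [exact: segment_compact|exact: continuous_subspaceT].
rewrite integrable_mkcond//; apply: eq_integrable => // x _.
rewrite restrict_EFin/= patchE; case: ifPn => // /negP xn; rewrite G0// => xab.
by apply: xn; rewrite inE/= in_itv.
Qed.

Lemma Int_rho r y : 0 < r -> \int[mu]_z rho r (z - y) = mass r.
Proof.
move=> r0.
have cb c : continuous (fun x => bump1 1 (- r) r (x - c) : R).
  move=> x; apply: (@continuous_comp _ _ _
    (fun x : R => 1 * (((x - c) - - r) * (r - (x - c)))) (flat 1)).
    apply: cvgM; first exact: cvg_cst.
    by apply: cvgM; do ![apply: cvgB; (try exact: cvg_cst)]; exact: cvg_id.
  exact: continuous_flat.
have cb0 : continuous (bump1 1 (- r) r).
  by have := cb 0; under eq_fun do rewrite subr0.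
have ib c : leb.-integrable setT (EFin \o (fun x => bump1 1 (- r) r (x - c) : R)).
  apply: (@itg_real _ (c - r) (c + r)); first exact: cb.
  move=> x xn; apply: bump1_eq0 => //; first lra.
  by apply/negP => /andP[? ?]; apply: xn; apply/andP; split; lra.
have H (y' : R * R) : \int[mu]_z rho r (z - y') =
    (\int[leb]_x bump1 1 (- r) r x) * (\int[leb]_x bump1 1 (- r) r x).
  have [_ ->] := Int_prod1 (test_itg (test_rho_translate y' r0)).
  have E x : \int[leb]_y0 rho r ((x, y0) - y') =
      (\int[leb]_x bump1 1 (- r) r x) * bump1 1 (- r) r (x - y'.1).
    rewrite mulrC -(Int_translation y'.2 cb0 (@bump1_ge0 R _ _ _)).
    by rewrite -IntZ//; exact: ib.
  under eq_Int do rewrite E.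
  rewrite IntZ; last exact: ib.
  by rewrite (Int_translation y'.1 cb0 (@bump1_ge0 R _ _ _)).
by rewrite H -(H 0) /mass; apply: eq_Int => z; rewrite subr0.
Qed.

Lemma Int_rho_swap r z : 0 < r -> \int[mu]_y rho r (z - y) = mass r.
Proof.
move=> r0; rewrite -(Int_rho z r0); apply: eq_Int => y.
by rewrite -rhoN opprB.
Qed.

Lemma mass_gt0 r : 0 < r -> 0 < mass r.
Proof.
move=> r0; rewrite lt_neqAle Int_ge0 ?andbT => [|z]; last exact: rho_ge0.
apply/eqP => m0.
have ti : itg (rho r).
  by have := test_itg (test_rho_translate 0 r0); under eq_fun do rewrite subr0.
have [N [mN N0 HN]] := Int_eq0 ti (rho_ge0 r) (esym m0).
have mB := measurable_obox (- r) r (- r) r.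
have : (mu (obox (- r) r (- r) r) <= mu N)%E.
  apply: le_measure; rewrite ?inE// => z zo; apply: HN => /= z0.
  by have := @bump_gt0 R 1 _ _ _ _ z ltr01 zo; rewrite -[bump _ _ _ _ _ _]/(rho r z) z0 ltxx.
rewrite N0 leNgt => /negP; apply.
have -> : mu (obox (- r) r (- r) r) = (leb `](- r)%R, r%R[%classic * leb `](- r)%R, r%R[%classic)%E.
  exact: product_measure1E.
have rr : - r < r by lra.
by rewrite lebesgue_measure_itv/= lte_fin rr -EFinD -EFinM lte_fin mulr_gt0//; lra.
Qed.

(** The pairing of [f] with the convolution of [g] by [k]. As a double integral it can be evaluated
    by integrating the kernel against either factor first ([crossE1], [crossE2]). *)
Definition cross (k : R * R -> R) f g : R := \int[mu2]_w (f w.1 * k (w.1 - w.2) * g w.2).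

Lemma itg_cross (k : M2 * M2 -> R) f g (C : R) : measurable_fun setT k ->
  (forall w, `|k w| <= C) -> itg f -> itg g ->
  mu2.-integrable setT (EFin \o (fun w => f w.1 * k w * g w.2)).
Proof.
move=> mk kC fi gi; have mf := itg_msr fi; have mg := itg_msr gi.
apply: (@itg_prodP _ _ _ _ R (leb2s R) (leb2s R) (fun w : M2 * M2 => f w.1 * k w * g w.2)
  (fun z y : M2 => (`|f z| * C) * `|g y|)).
- apply: measurable_funM; last exact: measurableT_comp mg measurable_snd.
  by apply: measurable_funM => //; exact: measurableT_comp mf measurable_fst.
- by move=> z y /=; rewrite !normrM ler_wpM2r// ler_wpM2l.
- by move=> z; apply: itgZ; exact: itg_norm gi.
- apply: (itg_eq _ (itgZ (C * \int[mu]_y `|g y|) (itg_norm fi))) => z.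
  by rewrite -/(leb2 R) (IntZ _ (itg_norm gi)); ring.
Qed.

Lemma measurable_kernel phi : smooth phi ->
  measurable_fun [set: M2 * M2] (fun w => phi (w.1 - w.2)).
Proof.
move=> sphi; apply: (measurableT_comp (smooth_msr sphi)).
apply: (@measurable_fun_pair _ _ _ _ _ _ (fun w : M2 * M2 => w.1.1 - w.2.1) (fun w : M2 * M2 => w.1.2 - w.2.2)).
  apply: measurable_funB; apply: measurableT_comp => //; exact: measurable_fst || exact: measurable_snd.
apply: measurable_funB; apply: measurableT_comp => //; exact: measurable_fst || exact: measurable_snd.
Qed.

Lemma norm_rho_le1 r z : `|rho r z| <= 1.
Proof. by rewrite ger0_norm ?rho_ge0 ?rho_le1. Qed.

Section cross_smooth_kernel.
Variables (k : R * R -> R) (C : R).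
Hypotheses (sk : smooth k) (kC : forall z, `|k z| <= C).

Lemma itg_cross_smooth f g : itg f -> itg g ->
  mu2.-integrable setT (EFin \o (fun w => f w.1 * k (w.1 - w.2) * g w.2)).
Proof.
by apply: (itg_cross (k := fun w => k (w.1 - w.2)) (C := C)) => [|w];
  [exact: measurable_kernel|exact: kC].
Qed.

Lemma crossE1 f g : itg f -> itg g ->
  itg (fun z => f z * \int[mu]_y (k (z - y) * g y)) /\
  cross k f g = \int[mu]_z (f z * \int[mu]_y (k (z - y) * g y)).
Proof.
move=> fi gi; have [H E] := Int_prod1 (itg_cross_smooth fi gi).
have FE z : \int[mu]_y (f z * k (z - y) * g y) = f z * \int[mu]_y (k (z - y) * g y).
  rewrite -IntZ; first by apply: eq_Int => y; rewrite mulrA.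
  apply: (itgMb (k := C)) => //.
  exact: smooth_msr (smooth_reflect z sk).
split; first by apply: itg_eq H => z; exact: FE.
by rewrite /cross E; apply: eq_Int => z; exact: FE.
Qed.

Lemma crossE2 f g : itg f -> itg g ->
  itg (fun y => g y * \int[mu]_z (k (z - y) * f z)) /\
  cross k f g = \int[mu]_y (g y * \int[mu]_z (k (z - y) * f z)).
Proof.
move=> fi gi; have [H E] := Int_prod2 (itg_cross_smooth fi gi).
have FE y : \int[mu]_z (f z * k (z - y) * g y) = g y * \int[mu]_z (k (z - y) * f z).
  rewrite -IntZ; first by apply: eq_Int => z; ring.
  apply: (itgMb (k := C)) => //.
  exact: smooth_msr (smooth_translate y sk).
split; first by apply: itg_eq H => y; exact: FE.
by rewrite /cross E; apply: eq_Int => y; exact: FE.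
Qed.

End cross_smooth_kernel.

Definition itg_cross_rho r := itg_cross_smooth (smooth_rho r) (norm_rho_le1 r).

Lemma itg_rho_reflect r z : 0 < r -> itg (fun y => rho r (z - y)).
Proof.
move=> r0; apply: (itg_eq _ (test_itg (test_rho_translate z r0))) => y.
by rewrite -rhoN opprB.
Qed.

Lemma Int_rho_indic_le r z (B : set M2) : 0 < r -> measurable B ->
  `|\int[mu]_y (rho r (z - y) * \1_B y)| <= mass r.
Proof.
move=> r0 mB; rewrite -(Int_rho_swap z r0); apply: le_Int_norm.
- exact: itg_rho_reflect.
- move=> y; rewrite normrM (ger0_norm (rho_ge0 _ _)) ler_piMr ?rho_ge0//.
  by rewrite indicE; case: (_ \in _); rewrite ?normr1 ?normr0.
- apply: measurable_funM; last exact: measurable_indic.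
  exact: smooth_msr (smooth_reflect z (smooth_rho r)).
Qed.

(** Young's inequality [|f g| <= e f^2 + g^2 / e] under the kernel; integrating out the other
    variable costs at most [mass r]. The indicator of the square replaces the constant 1, which is
    not integrable. *)
Lemma cross_bound r M e f g : 0 < r -> 0 < e ->
  sqi f -> (forall z, ~ obox (- M) M (- M) M z -> f z = 0) ->
  sqi g -> (forall z, ~ obox (- M) M (- M) M z -> g z = 0) ->
  `|cross (rho r) f g| <= mass r * (e * \int[mu]_z (f z ^+ 2) + e^-1 * \int[mu]_z (g z ^+ 2)).
Proof.
move=> r0 e0 sf fB sg gB; pose B := obox (- M) M (- M) M.
have mB : measurable (B : set M2) by exact: measurable_obox.
have boxed (h : R * R -> R) : (forall z, ~ B z -> h z = 0) ->
    forall z, ~ cbox (- M) M (- M) M z -> h z = 0.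
  move=> hB z zn; apply: hB; apply: contra_not zn.
  by rewrite /B oboxE cboxE => -[/andP[? ?] /andP[? ?]]; rewrite !ltW.
have fi := sqi_boxed_itg (boxed _ fB) sf; have gi := sqi_boxed_itg (boxed _ gB) sg.
have Bi : itg (\1_B : R * R -> R).
  apply: (sqi_boxed_itg (boxed _ _) (sqi_indic_obox _ _ _ _)).
  by move=> z zB; rewrite indicE memNset.
have f2 : itg (fun z => f z ^+ 2) := sf.2; have g2 : itg (fun z => g z ^+ 2) := sg.2.
have i1 := itg_cross_rho r f2 Bi; have i2 := itg_cross_rho r Bi g2.
have ei : 0 < e^-1 by rewrite invr_gt0.
apply: (@le_trans _ _ (e * cross (rho r) (fun z => f z ^+ 2) \1_B + e^-1 * cross (rho r) \1_B (fun z => g z ^+ 2))).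
  rewrite /cross -!IntZ// -IntD; [|exact: itgZ..].
  apply: le_Int_norm.
  - by apply: itgD; exact: itgZ.
  - move=> w; rewrite 2!normrM (ger0_norm (rho_ge0 _ _)).
    have R0 := rho_ge0 r (w.1 - w.2); move: (rho r _) R0 => q q0.
    rewrite !indicE; have [w1|w1] := pselect (B w.1); last first.
      by rewrite (fB _ w1) normr0 expr0n !mul0r mulr0 add0r memNset// !(mul0r, mulr0).
    have [w2|w2] := pselect (B w.2); last first.
      by rewrite (gB _ w2) normr0 expr0n !(mul0r, mulr0) [in X in _ * _ * X]memNset// !(mul0r, mulr0) addr0.
    rewrite !mem_set// mulr1 mul1r -(real_normK (num_real (f w.1))) -(real_normK (num_real (g w.2))).
    move: (`|f w.1|) (`|g w.2|) (normr_ge0 (f w.1)) (normr_ge0 (g w.2)) => F G F0 G0.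
    have H : F * G <= e * F ^+ 2 + e^-1 * G ^+ 2.
      have := sqr_ge0 (e * F - G); rewrite -(@ler_pM2l _ e)// => H'.
      rewrite -(@ler_pM2l _ e)// mulrDr [e * (e^-1 * _)]mulrA divff ?gt_eqF// mul1r.
      have FG : 0 <= F * G by rewrite mulr_ge0.
      have := sqr_ge0 (e * F - G); nra.
    rewrite (_ : F * q * G = q * (F * G)); last ring.
    by apply: (le_trans (ler_wpM2l q0 H)); rewrite le_eqVlt; apply/orP; left; apply/eqP; ring.
  - have := itg_msr (itg_cross_rho r fi gi); exact.
rewrite mulrDr; apply: lerD.
  rewrite mulrCA ler_pM2l//; have [H ->] := crossE1 (smooth_rho r) (norm_rho_le1 r) f2 Bi.
  rewrite -IntZ//; apply: le_Int => //; first exact: itgZ.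
  move=> z; rewrite mulrC ler_wpM2r ?sqr_ge0//.
  exact: le_trans (ler_norm _) (Int_rho_indic_le z r0 mB).
rewrite mulrCA ler_pM2l//; have [H ->] := crossE2 (smooth_rho r) (norm_rho_le1 r) Bi g2.
rewrite -IntZ//; apply: le_Int => //; first exact: itgZ.
move=> z; rewrite mulrC ler_wpM2r ?sqr_ge0//.
apply: le_trans (ler_norm _) _; apply: le_trans (Int_rho_indic_le z r0 mB).
by under [X in `|X| <= _]eq_Int do rewrite -rhoN opprB.
Qed.

Lemma lipschitz_real (F dF : R -> R) (L : R) :
  (forall x : R, is_derive x (1 : R) F (dF x)) -> (forall x, `|dF x| <= L) ->
  forall a b, `|F a - F b| <= L * `|a - b|.
Proof.
move=> DF dL.
have H a b : a < b -> `|F b - F a| <= L * `|b - a|.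
  move=> ab; have [|c _ ->] := @MVT R F dF a b ab (fun x _ => DF x).
    by apply: derivable_within_continuous => x _; have [] := DF x.
  by rewrite normrM ler_wpM2r.
move=> a b; have [ab|ab|->] := ltgtP a b; last by rewrite !subrr normr0 mulr0.
  by rewrite distrC (distrC a); exact: H.
exact: H.
Qed.

Lemma test_lipschitz U phi : test_fun U phi -> exists2 L : R, 0 <= L &
  forall z y, `|phi z - phi y| <= L * (`|z.1 - y.1| + `|z.2 - y.2|).
Proof.
move=> tphi.
have [k1 k10 k1P] := test_bounded (test_fun_derive (1, 0) tphi).
have [k2 k20 k2P] := test_bounded (test_fun_derive (0, 1) tphi).
exists (k1 + k2) => [|z y]; first exact: addr_ge0.
rewrite (le_trans (ler_distD (phi (y.1, z.2)) _ _))// mulrDr lerD//.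
  have := @lipschitz_real (fun s => phi (s, z.2)) (fun s => 'D_(1, 0) phi (s, z.2)) k1 _ _ z.1 y.1.
  rewrite -surjective_pairing => H; rewrite (le_trans (H _ _))//.
  - by move=> x; exact: is_derive_slice1 tphi.1.
  - by rewrite ler_wpM2r// lerDl.
have := @lipschitz_real (fun s => phi (y.1, s)) (fun s => 'D_(0, 1) phi (y.1, s)) k2 _ _ z.2 y.2.
rewrite -surjective_pairing => H; rewrite (le_trans (H _ _))//.
- by move=> x; exact: is_derive_slice2 tphi.1.
- by rewrite ler_wpM2r// lerDr.
Qed.

(** [h] is Lipschitz, so [h y - h z] is of order [r] wherever the kernel does not vanish. *)
Lemma cross_test f U h : test_fun U h -> itg f -> exists2 C : R, 0 <= C & forall r, 0 < r ->
  `|cross (rho r) f h - mass r * \int[mu]_z (f z * h z)| <= C * r * mass r.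
Proof.
move=> th fi; have [L L0 LP] := test_lipschitz th.
have hi := test_itg th.
exists (2 * L * \int[mu]_z `|f z|); first by rewrite !mulr_ge0// Int_ge0.
move=> r r0; have [H ->] := crossE1 (smooth_rho r) (norm_rho_le1 r) fi hi.
have fhi := itgM_test th fi.
rewrite -IntZ// -IntB//; last exact: itgZ.
rewrite [leRHS](_ : _ = (2 * L * r * mass r) * \int[mu]_z `|f z|); last by ring.
rewrite -IntZ; last exact: itg_norm.
apply: le_Int_norm.
- by apply: itgZ; exact: itg_norm.
- move=> z.
  rewrite (_ : _ - _ = f z * (\int[mu]_y (rho r (z - y) * h y) - h z * mass r)); last by ring.
  rewrite normrM mulrC ler_wpM2r// -(Int_rho_swap z r0).
  have rr := itg_rho_reflect z r0.
  have rhi : itg (fun y => rho r (z - y) * h y).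
    apply: (itgMb (k := 1)) => //; last by move=> y; exact: norm_rho_le1.
    exact: smooth_msr (smooth_reflect z (smooth_rho r)).
  rewrite -!IntZ// -IntB//; last exact: itgZ.
  apply: le_Int_norm.
  + exact: itgZ.
  + move=> y; rewrite (_ : _ - _ = rho r (z - y) * (h y - h z)); last by ring.
    rewrite normrM (ger0_norm (rho_ge0 _ _)) mulrC.
    have [[z1 z2]|zn] := pselect (`|(z - y).1| < r /\ `|(z - y).2| < r); last first.
      by rewrite rho_eq0// !mulr0.
    rewrite ler_wpM2r ?rho_ge0// distrC (le_trans (LP _ _))//.
    rewrite (_ : 2 * L * r = L * (r + r)); last by ring.
    by rewrite ler_wpM2l// lerD// ltW.
  + apply: measurable_funB; first exact: itg_msr rhi.
    by apply: measurable_funM => //; exact: itg_msr rr.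
- by apply: measurable_funB; [exact: itg_msr H|apply: measurable_funM => //; exact: itg_msr fhi].
Qed.

                                                                      
(** The quotient [cross (rho r) f g / mass r] tends to the [L^2] product of [f] and [g]: replace [g]
    by a test function, at a cost controlled by [cross_bound], and apply [cross_test] to that test
    function. *)
Lemma cross_cvg M f g e : 0 < M -> 0 < e ->
  sqi f -> (forall z, ~ obox (- M) M (- M) M z -> f z = 0) ->
  sqi g -> (forall z, ~ obox (- M) M (- M) M z -> g z = 0) ->
  exists2 r0 : R, 0 < r0 & forall r, 0 < r <= r0 ->
    `|cross (rho r) f g - mass r * \int[mu]_z (f z * g z)| <= e * mass r.
Proof.
move=> M0 e0 sf fB sg gB.
have boxed (h : R * R -> R) : (forall z, ~ obox (- M) M (- M) M z -> h z = 0) ->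
    forall z, ~ cbox (- M) M (- M) M z -> h z = 0.
  move=> hB z zn; apply: hB; apply: contra_not zn.
  by rewrite oboxE cboxE => -[/andP[? ?] /andP[? ?]]; rewrite !ltW.
have fi := sqi_boxed_itg (boxed _ fB) sf; have gi := sqi_boxed_itg (boxed _ gB) sg.
set A := \int[mu]_z (f z ^+ 2).
have A0 : 0 <= A by apply: Int_ge0 => z; exact: sqr_ge0.
(* [q] is the weight in Young's inequality: [q A <= e / 6], and [h] is taken so close to [g] that
   the other term is at most [e / 6] too. The part [g - h] then costs [e / 3] in each of its two
   occurrences. *)
pose q := e / (6 * (A + 1)); have q0 : 0 < q by rewrite divr_gt0// mulr_gt0// ltr_wpDl.
have qA : q * A <= e / 6.
  by rewrite /q invfM mulrA -mulrA ler_piMr ?divr_ge0 ?(ltW e0)// ler_pdivrMl ?mulr1 ?lerDl// ltr_wpDl.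
have qe : 0 < q * (e / 6) by rewrite mulr_gt0// divr_gt0.
have [h th gh] := approximable_boxed sg gB qe.
have sh := test_sqi th; have hi := test_itg th; have sk := sqiB sg sh.
have D0 : 0 <= \int[mu]_z ((g z - h z) ^+ 2) by apply: Int_ge0 => z; exact: sqr_ge0.
have qD : q^-1 * \int[mu]_z ((g z - h z) ^+ 2) <= e / 6 by rewrite ler_pdivrMl.
have [C C0 CP] := cross_test th fi.
have [N N0 NP] := test_supp th.
have sub P Q z : 0 < P -> 0 < Q -> ~ obox (- (P + Q)) (P + Q) (- (P + Q)) (P + Q) z ->
    ~ obox (- P) P (- P) P z.
  move=> P0 Q0; apply: contra_not; rewrite !oboxE => -[/andP[? ?] /andP[? ?]].
  by split; apply/andP; split; lra.
have fB' z : ~ obox (- (M + N)) (M + N) (- (M + N)) (M + N) z -> f z = 0.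
  by move=> zn; apply: fB; exact: (sub M N).
have kB' z : ~ obox (- (M + N)) (M + N) (- (M + N)) (M + N) z -> g z - h z = 0.
  move=> zn; rewrite gB; last exact: (sub M N).
  by rewrite NP ?subrr//; apply: (sub N M) => //; rewrite addrC.
exists (e / (3 * (C + 1))); first by rewrite divr_gt0// mulr_gt0// ltr_wpDl.
move=> r /andP[r0 re]; have m0 := mass_gt0 r0.
have Cr : C * r <= e / 3.
  apply: (@le_trans _ _ ((C + 1) * (e / (3 * (C + 1))))).
    by apply: ler_pM => //; [exact: ltW|rewrite lerDl].
  have Cn : C + 1 != 0 by rewrite gt_eqF// ltr_wpDl.
  by rewrite le_eqVlt; apply/orP; left; apply/eqP; field; rewrite Cn.
have ki : itg (fun z => g z - h z) by exact: itgB.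
have fki := sqiM sf sk; have fhi := sqiM sf sh.
have E1 : cross (rho r) f g = cross (rho r) f (fun z => g z - h z) + cross (rho r) f h.
  rewrite /cross -(IntD (itg_cross_rho r fi ki) (itg_cross_rho r fi hi)).
  by apply: eq_Int => w; ring.
have E2 : \int[mu]_z (f z * g z) = \int[mu]_z (f z * (g z - h z)) + \int[mu]_z (f z * h z).
  by rewrite -IntD//; apply: eq_Int => z; ring.
have B1 := cross_bound r0 q0 sf fB' sk kB'.
have B2 := CP r r0.
have B3 : `|\int[mu]_z (f z * (g z - h z))| <= q * A + q^-1 * \int[mu]_z ((g z - h z) ^+ 2).
  rewrite -!IntZ; [|exact: sk.2|exact: sf.2].
  rewrite -IntD; [|exact: itgZ sf.2|exact: itgZ sk.2].
  apply: le_Int_norm; [by apply: itgD; [exact: itgZ sf.2|exact: itgZ sk.2]| |exact: itg_msr fki].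
  move=> z; move: (f z) (g z - h z) => F G.
  rewrite -(@ler_pM2l _ q)// mulrDr [q * (q^-1 * _)]mulrA divff ?gt_eqF// mul1r.
  rewrite -[X in X * `|_|]ger0_norm ?(ltW q0)// -normrM ler_norml.
  have h1 := sqr_ge0 (q * F - G); have h2 := sqr_ge0 (q * F + G); have h3 := sqr_ge0 G.
  by apply/andP; split; nra.
rewrite E1 E2 mulrDr.
have -> : cross (rho r) f (fun z => g z - h z) + cross (rho r) f h -
  (mass r * \int[mu]_z (f z * (g z - h z)) + mass r * \int[mu]_z (f z * h z)) =
  cross (rho r) f (fun z => g z - h z) - mass r * \int[mu]_z (f z * (g z - h z)) +
  (cross (rho r) f h - mass r * \int[mu]_z (f z * h z)) by ring.
rewrite (le_trans (ler_normD _ _))//.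
have T1 := ler_normB (cross (rho r) f (fun z => g z - h z)) (mass r * \int[mu]_z (f z * (g z - h z))).
rewrite normrM (gtr0_norm m0) in T1.
move: B1 B2 B3 T1 qA qD Cr m0; rewrite -/A.
move: (\int[mu]_z ((g z - h z) ^+ 2)) (`|cross (rho r) f _|) (`|_ - _|) (`|\int[mu]_z _|) (`|_ - _|).
move=> {}D b1 b2 b3 t1 B1 B2 B3 T1 qA qD Cr m0.
have S1 : mass r * (q * A + q^-1 * D) <= mass r * (e / 3).
  by rewrite ler_pM2l//; lra.
have S2 : mass r * b3 <= mass r * (e / 3) by rewrite ler_pM2l//; lra.
have S3 : C * r * mass r <= e / 3 * mass r by rewrite ler_pM2r.
lra.
Qed.

End kernel.

                                                           

(** * Weak derivatives and Sobolev functions *)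

Section weak_derivatives.
Variable R : realType.
Variable Omega : set (R * R).
Hypothesis oO : open Omega.
Local Notation M2 := (measurableTypeR R * measurableTypeR R)%type.
Local Notation mu := (@leb2 R).
Local Notation itg f := (mu.-integrable [set: M2] (EFin \o f)).
Local Notation msr f := (measurable_fun [set: M2] f).
Local Notation sqi f := (sqi mu f).
Local Notation tst := (test_fun Omega).
Implicit Types (a b c d M e r : R) (z y : R * R) (f g h phi psi : R * R -> R) (i j : 'I_2).

Definition ext f z : R := \1_Omega z * f z.

Lemma extE f z : Omega z -> ext f z = f z.
Proof. by move=> zO; rewrite /ext indicE mem_set// mul1r. Qed.

Lemma ext0 f z : ~ Omega z -> ext f z = 0.
Proof. by move=> zO; rewrite /ext indicE memNset// mul0r. Qed.

Lemma mO : measurable (Omega : set M2). Proof. exact: measurable_open2. Qed.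

Lemma extD f g z : ext (fun w => f w + g w) z = ext f z + ext g z.
Proof. by rewrite /ext mulrDr. Qed.

Lemma extZ k f z : ext (fun w => k * f w) z = k * ext f z.
Proof. by rewrite /ext mulrCA. Qed.

Lemma extM f g z : ext (fun w => f w * g w) z = ext f z * ext g z.
Proof.
have [zO|zO] := pselect (Omega z); first by rewrite !extE.
by rewrite !ext0// mul0r.
Qed.

Lemma extMl f g z : ext (fun w => f w * g w) z = ext f z * g z.
Proof. by rewrite /ext mulrA. Qed.

Lemma patch_ext f : f \_ Omega = ext f.
Proof.
apply/funext => z; rewrite /ext indicE patchE.
by case: (_ \in _); rewrite ?mul1r ?mul0r.
Qed.

Lemma Int_ext f : \int[mu]_(z in Omega) f z = \int[mu]_z ext f z.
Proof. by rewrite Rintegral_mkcond patch_ext. Qed.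

Lemma regularE f phi : regular Omega f phi = \int[mu]_z (ext f z * phi z).
Proof. by rewrite /regular Int_ext; apply: eq_Int => z; rewrite extMl. Qed.

Lemma measurable_ext f : measurable_fun (Omega : set M2) f <-> msr (ext f).
Proof.
by rewrite -patch_ext; exact: (measurable_restrictT (f : M2 -> R) mO).
Qed.

Lemma sqi_L2 f : L2 Omega f <-> sqi (ext f).
Proof.
have E : (\int[mu]_(x in Omega) (f x ^+ 2)%:E =
    \int[mu]_x `|(EFin \o (fun z => ext f z ^+ 2)%R) x|)%E.
  rewrite [LHS]integral_mkcond; apply: eq_integral => z _.
  rewrite patchE /ext /= indicE; case: (_ \in _) => /=; last by rewrite mul0r expr0n normr0.
  by rewrite mul1r ger0_norm ?sqr_ge0.
rewrite /L2 E; split=> [[/measurable_ext mf fi]|[mf /integrableP[_ fi]]].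
  split=> //; apply/integrableP; split=> //.
  by apply/measurable_EFinP; exact: measurable_funX.
by split=> //; exact/measurable_ext.
Qed.

Lemma loc_itg f K : loc_integrable Omega f -> compact K -> K `<=` Omega ->
  itg (fun z => \1_K z * ext f z).
Proof.
move=> fi cK KO; have := fi K cK KO.
rewrite integrable_mkcond; last exact: measurable_compact2.
apply: eq_integrable => // z _; rewrite restrict_EFin/= indicE patchE.
have [zK|zK] := boolP (z \in K); last by rewrite mul0r.
by rewrite mul1r extE//; apply: KO; rewrite inE in zK.
Qed.

Lemma loc_msr f : loc_integrable Omega f -> msr (ext f).
Proof.
move=> fi; apply/measurable_ext.
have [a [b [c [d [BU UB]]]]] := open_rat_cover oO.
have -> : Omega = \bigcup_n (cbox (a n) (b n) (c n) (d n)).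
  apply/seteqP; split=> [z /UB[n zn]|z [n _]]; last exact: BU.
  exists n => //; move: zn; rewrite oboxE cboxE => -[/andP[? ?] /andP[? ?]].
  by rewrite !ltW.
apply/measurable_fun_bigcup => n; first exact: measurable_cbox.
by have /measurable_int/measurable_EFinP := fi _ (@compact_cbox _ (a n) (b n) (c n) (d n)) (BU n).
Qed.

Lemma loc_itg_test f phi : loc_integrable Omega f -> tst phi ->
  itg (fun z => ext f z * phi z).
Proof.
move=> fi tphi; have [_ [K [cK KO phi0]]] := tphi.
apply: (itg_eq _ (itgM_test tphi (loc_itg fi cK KO))) => z.
rewrite indicE; have [zK|zK] := pselect (K z); first by rewrite mem_set// mul1r.
by rewrite phi0// !mulr0.
Qed.

Lemma sqi_loc f : sqi (ext f) -> loc_integrable Omega f.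
Proof.
move=> sf K cK KO; have mK := measurable_compact2 cK.
have [M M0 KM] := compact_sqbox cK.
rewrite integrable_mkcond//.
have : itg (fun z => \1_K z * ext f z).
  apply: (@sqi_boxed_itg _ _ (- M) M (- M) M).
    by move=> z zM; rewrite indicE memNset ?mul0r//; apply: contra_not zM => /KM.
  apply: (sqiMb (k := 1)) => // z.
  by rewrite indicE; case: (_ \in _); rewrite ?normr1 ?normr0.
apply: eq_integrable => // z _; rewrite restrict_EFin/= indicE patchE.
have [zK|zK] := boolP (z \in K); last by rewrite mul0r.
by rewrite mul1r extE//; apply: KO; rewrite inE in zK.
Qed.

Lemma loc_integrableD f g : loc_integrable Omega f -> loc_integrable Omega g ->
  loc_integrable Omega (fun z => f z + g z).
Proof.
move=> fi gi K cK KO; have mK := measurable_compact2 cK.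
by have := integrableD mK (fi K cK KO) (gi K cK KO); apply: eq_integrable.
Qed.

Lemma loc_integrableZ k f : loc_integrable Omega f ->
  loc_integrable Omega (fun z => k * f z).
Proof.
move=> fi K cK KO; have mK := measurable_compact2 cK.
by have := integrableZl mK k (fi K cK KO); apply: eq_integrable.
Qed.

Lemma is_weak_partialE i f g : is_weak_partial Omega i f g <->
  [/\ loc_integrable Omega f, loc_integrable Omega g & forall phi, tst phi ->
    \int[mu]_z (ext f z * 'D_(dir R i) phi z) = - \int[mu]_z (ext g z * phi z)].
Proof.
split=> -[fi gi H]; split=> // phi tphi; have := H phi tphi.
  by rewrite /dpartial !regularE => <-; rewrite opprK.
by rewrite /dpartial !regularE => ->; rewrite opprK.
Qed.

(** The difference of two weak derivatives annihilates all test functions, so [fundamental_lemma]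
    applies. *)
Lemma weak_partial_unique i f g g' : is_weak_partial Omega i f g ->
  is_weak_partial Omega i f g' -> \forall z \ae mu, Omega z -> g z = g' z.
Proof.
move=> /is_weak_partialE[_ gi H] /is_weak_partialE[_ gi' H'].
have : \forall z \ae mu, Omega z -> g z + (-1) * g' z = 0.
  apply: fundamental_lemma => //.
    by apply: loc_integrableD => //; exact: loc_integrableZ.
  move=> phi tphi; rewrite Int_ext.
  have E z : ext (fun w => (g w + (-1) * g' w) * phi w) z = ext g z * phi z - ext g' z * phi z.
    by rewrite /ext; ring.
  under eq_Int do rewrite E.
  rewrite IntB; [|exact: loc_itg_test..].
  by apply/eqP; rewrite subr_eq0 -eqr_opp -H// -H'.
move=> H0; apply: filterS H0 => z /[apply]; rewrite mulN1r => /eqP.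
by rewrite subr_eq0 => /eqP.
Qed.

Lemma Int_ext_ae f g phi : loc_integrable Omega f -> loc_integrable Omega g ->
  (\forall z \ae mu, Omega z -> f z = g z) -> tst phi ->
  \int[mu]_z (ext f z * phi z) = \int[mu]_z (ext g z * phi z).
Proof.
move=> fi gi fg tphi; apply: Int_ae.
- exact: itg_msr (loc_itg_test fi tphi).
- exact: itg_msr (loc_itg_test gi tphi).
- apply: filterS fg => z fg; have [zO|zO] := pselect (Omega z); last by rewrite !ext0.
  by rewrite !extE// fg.
Qed.

Lemma weak_partial_ae i f f' g g' : is_weak_partial Omega i f g ->
  loc_integrable Omega f' -> loc_integrable Omega g' ->
  (\forall z \ae mu, Omega z -> f z = f' z) ->
  (\forall z \ae mu, Omega z -> g z = g' z) -> is_weak_partial Omega i f' g'.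
Proof.
move=> /is_weak_partialE[fi gi H] f'i g'i ff gg.
apply/is_weak_partialE; split=> // phi tphi.
by rewrite -(Int_ext_ae gi g'i gg)// -H// -(Int_ext_ae fi f'i ff)//; exact: test_fun_derive.
Qed.

Lemma weak_partialD i f g f' g' : is_weak_partial Omega i f g ->
  is_weak_partial Omega i f' g' ->
  is_weak_partial Omega i (fun z => f z + f' z) (fun z => g z + g' z).
Proof.
move=> /is_weak_partialE[fi gi H] /is_weak_partialE[f'i g'i H'].
apply/is_weak_partialE; split=> [||phi tphi]; [exact: loc_integrableD..|].
under eq_Int do rewrite extD mulrDl.
under [in RHS]eq_Int do rewrite extD mulrDl.
have tD := test_fun_derive (dir R i) tphi.
by rewrite !IntD ?H ?H' ?opprD//; exact: loc_itg_test.
Qed.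

Lemma weak_partialZ i k f g : is_weak_partial Omega i f g ->
  is_weak_partial Omega i (fun z => k * f z) (fun z => k * g z).
Proof.
move=> /is_weak_partialE[fi gi H].
apply/is_weak_partialE; split=> [||phi tphi]; [exact: loc_integrableZ..|].
under eq_Int do rewrite extZ -mulrA.
under [in RHS]eq_Int do rewrite extZ -mulrA.
have tD := test_fun_derive (dir R i) tphi.
by rewrite !IntZ ?H ?mulrN//; exact: loc_itg_test.
Qed.

Lemma weak_partial_wpartial i f g : is_weak_partial Omega i f g ->
  is_weak_partial Omega i f (wpartial Omega i f).
Proof. by move=> fg; apply: (@xgetPex _ (fun=> 0) [set h | is_weak_partial Omega i f h]); exists g. Qed.

Lemma wpartial_ae i f g : is_weak_partial Omega i f g ->
  \forall z \ae mu, Omega z -> wpartial Omega i f z = g z.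
Proof. by move=> fg; exact: weak_partial_unique (weak_partial_wpartial fg) fg. Qed.

Lemma L2_ae f g : msr (ext g) -> (\forall z \ae mu, Omega z -> f z = g z) ->
  sqi (ext f) -> sqi (ext g).
Proof.
move=> mg fg; apply: sqi_ae => //; apply: filterS fg => z fg.
have [zO|zO] := pselect (Omega z); last by rewrite !ext0.
by rewrite !extE// fg.
Qed.

(** Trades the existential derivatives in [sobolev] for the chosen representatives [wpartial], equal
    to them almost everywhere. *)
Lemma sobolev1_wpartial f : sobolev Omega 1 f -> [/\ sqi (ext f),
  forall i, is_weak_partial Omega i f (wpartial Omega i f) &
  forall i, sqi (ext (wpartial Omega i f))].
Proof.
move=> [/sqi_L2 sf Hf]; split=> // i; have [g fg [/sqi_L2 sg _]] := Hf i.
  exact: weak_partial_wpartial fg.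
have [_ wi _] := (is_weak_partialE _ _ _).1 (weak_partial_wpartial fg).
apply: L2_ae sg; first exact: loc_msr.
have H := wpartial_ae fg; apply: filterS H => z H zO.
by rewrite H.
Qed.

Lemma sobolev_ae f g : loc_integrable Omega g ->
  (\forall z \ae mu, Omega z -> f z = g z) -> sobolev Omega 1 f -> sobolev Omega 1 g.
Proof.
move=> gi fg [/sqi_L2 sf Hf]; split; first by apply/sqi_L2; apply: L2_ae fg sf; exact: loc_msr.
move=> i; have [h fh sh] := Hf i; exists h => //.
have [_ hi _] := (is_weak_partialE _ _ _).1 fh.
by apply: weak_partial_ae fh _ _ fg _ => //; exact: nearW.
Qed.

Lemma sobolev2_wpartial f : sobolev Omega 2 f -> [/\ sqi (ext f),
  forall i, is_weak_partial Omega i f (wpartial Omega i f) &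
  forall i, sobolev Omega 1 (wpartial Omega i f)].
Proof.
move=> [/sqi_L2 sf Hf]; split=> // i; have [g fg sg] := Hf i.
  exact: weak_partial_wpartial fg.
have [_ wi _] := (is_weak_partialE _ _ _).1 (weak_partial_wpartial fg).
apply: sobolev_ae sg => //.
have H := wpartial_ae fg; apply: filterS H => z H zO.
by rewrite H.
Qed.

Lemma sobolevS f : sobolev Omega 2 f -> sobolev Omega 1 f.
Proof.
move=> [/sqi_L2 sf Hf]; split; first exact/sqi_L2.
by move=> i; have [g fg [sg _]] := Hf i; exists g => //; split.
Qed.

End weak_derivatives.

(** * Product rule and Jacobian identity for [W^{1,2}] functions *)

Section product_rules.
Variable R : realType.
Variable Omega : set (R * R).
Hypothesis oO : open Omega.
Variable M : R.
Hypothesis M0 : 0 < M.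
Hypothesis OM : Omega `<=` obox (- M) M (- M) M.
Local Notation M2 := (measurableTypeR R * measurableTypeR R)%type.
Local Notation mu := (@leb2 R).
Local Notation itg f := (mu.-integrable [set: M2] (EFin \o f)).
Local Notation msr f := (measurable_fun [set: M2] f).
Local Notation sqi f := (sqi mu f).
Local Notation tst := (test_fun Omega).
Local Notation ext := (ext Omega).
Local Notation D i f := ('D_(dir R i) f).
Implicit Types (z y : R * R) (f g h phi psi : R * R -> R) (i j : 'I_2).

Definition boxed f := forall z, ~ obox (- M) M (- M) M z -> f z = 0.

Lemma boxed_ext f : boxed (ext f).
Proof. by move=> z zM; rewrite ext0//; apply: contra_not zM; exact: OM. Qed.

Lemma sqi_boxed f : boxed f -> sqi f -> itg f.
Proof.
move=> fB; apply: (@sqi_boxed_itg _ _ (- M) M (- M) M) => z zn; apply: fB.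
by apply: contra_not zn; rewrite oboxE cboxE => -[/andP[? ?] /andP[? ?]]; rewrite !ltW.
Qed.

(** An identity between mollified pairings that is exact for all small [r] survives in the limit,
    because both sides of [cross_cvg] carry the same factor [mass r]. *)
Lemma cross_limit (s : R) f g f' g' : sqi f -> sqi g -> sqi f' -> sqi g' ->
  boxed f -> boxed g -> boxed f' -> boxed g' -> `|s| <= 1 ->
  (exists2 r0 : R, 0 < r0 & forall r, 0 < r < r0 ->
    cross (rho r) f g = s * cross (rho r) f' g') ->
  \int[mu]_z (f z * g z) = s * \int[mu]_z (f' z * g' z).
Proof.
move=> sf sg sf' sg' fB gB f'B g'B s1 [r0 r00 E].
apply/eqP; rewrite -subr_eq0 -normr_le0; apply/ler_addgt0Pr => e e0; rewrite add0r.
have e2 : 0 < e / 2 by rewrite divr_gt0.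
have [r1 r10 H1] := cross_cvg M0 e2 sf fB sg gB.
have [r2 r20 H2] := cross_cvg M0 e2 sf' f'B sg' g'B.
pose r := Num.min (r0 / 2) (Num.min r1 r2).
have rP : 0 < r by rewrite !lt_min r10 r20 divr_gt0.
have rr0 : r < r0.
  by rewrite (@le_lt_trans _ _ (r0 / 2))// ?ge_min ?lexx// ltr_pdivrMr// ltr_pMr// ltr1n.
have m0 := mass_gt0 rP.
have := H1 r; have := H2 r; rewrite rP /=.
have -> : r <= r1 by rewrite !ge_min lexx !orbT.
have -> : r <= r2 by rewrite !ge_min lexx !orbT.
move=> /(_ isT) h2 /(_ isT); rewrite E ?rP//.
move: h2; set X := cross _ _ _; set A := \int[mu]_z _; set B := \int[mu]_z _.
move=> h2 h1; rewrite -(ler_pM2l m0).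
have T : mass r * `|B - s * A| <= `|s * X - mass r * B| + `|s| * `|X - mass r * A|.
  rewrite -normrM -[X in X * _ <= _](gtr0_norm m0) -normrM.
  rewrite (le_trans _ (ler_normB _ _))//; rewrite -normrN le_eqVlt; apply/orP; left; apply/eqP.
  by congr (`|_|); ring.
have s0 := normr_ge0 s; have n0 := normr_ge0 (X - mass r * A).
apply: (le_trans T); rewrite (_ : mass r * e = e / 2 * mass r + e / 2 * mass r); last by field.
by apply: lerD => //; rewrite (le_trans _ h2)// ler_piMl.
Qed.

(** The room in which a small kernel centred on the support of a test function stays inside
    [Omega]. *)
Lemma compact_margin (K : set (R * R)) : compact K -> K `<=` Omega ->
  exists2 r0 : R, 0 < r0 & forall y z, K y -> `|z.1 - y.1| < r0 -> `|z.2 - y.2| < r0 -> Omega z.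
Proof.
move=> /compact_near_coveringP cK KO.
have := cK R (nbhs (0 : R)) (fun r y => forall z, `|z.1 - y.1| < r -> `|z.2 - y.2| < r -> Omega z) _.
case.
  move=> y Ky; have /near_plane[e e0 eP] : \forall w \near y, Omega w by have := oO (KO _ Ky).
  have e2 : 0 < e / 2 by rewrite divr_gt0.
  exists (ball y (e / 2), ball (0 : R) (e / 2)).
    by split; exact: nbhsx_ballx.
  move=> [y' r]/= [[y1 y2] r2] z z1 z2; apply: eP.
    rewrite (le_lt_trans (ler_distD y'.1 _ _))// [e]splitr ltrD//.
      apply: (lt_trans z1); move: r2; rewrite /ball/= sub0r normrN => /(le_lt_trans _); apply.
      exact: ler_norm.
    by move: y1; rewrite /ball/= distrC.
  rewrite (le_lt_trans (ler_distD y'.2 _ _))// [e]splitr ltrD//.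
    apply: (lt_trans z2); move: r2; rewrite /ball/= sub0r normrN => /(le_lt_trans _); apply.
    exact: ler_norm.
  by move: y2; rewrite /ball/= distrC.
move=> e /= e0 H; exists (e / 2); first by rewrite divr_gt0.
move=> y z Ky; apply: (H (e / 2)) => //=.
by rewrite sub0r normrN gtr0_norm ?divr_gt0// ltr_pdivrMr// ltr_pMr// ltr1n.
Qed.

Lemma test_rho (r : R) : 0 < r -> test_fun setT (rho r).
Proof.
by move=> r0; have := test_rho_translate 0 r0; under eq_fun do rewrite subr0.
Qed.

Definition W12 f (f_ : 'I_2 -> R * R -> R) := [/\ sqi (ext f), forall i, sqi (ext (f_ i)) &
  forall i, is_weak_partial Omega i f (f_ i)].

Lemma W12_byparts f (f_ : 'I_2 -> R * R -> R) i phi : W12 f f_ -> tst phi ->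
  \int[mu]_z (ext f z * D i phi z) = - \int[mu]_z (ext (f_ i) z * phi z).
Proof. by move=> [_ _ /(_ i)/is_weak_partialE[_ _]]; exact. Qed.

Section localized.
Variables (a b : R * R -> R) (a_ b_ : 'I_2 -> R * R -> R) (phi : R * R -> R).
Hypotheses (Wa : W12 a a_) (Wb : W12 b b_) (tphi : tst phi).

(** [b] localised by a test function; [B_ i] is its derivative according to Leibniz. Compact support
    in [Omega] allows pairing with arbitrary smooth functions. *)
Let B z := ext b z * phi z.
Let B_ i z := ext b z * D i phi z + ext (b_ i) z * phi z.

Lemma sqiM_test f psi : sqi f -> tst psi -> sqi (fun z => f z * psi z).
Proof.
move=> sf tpsi; have [k k0 kP] := test_bounded tpsi.
have H := sqiMb (test_msr tpsi) kP sf.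
by rewrite (_ : (fun z => _) = (fun z => psi z * f z))//; apply/funext => z; rewrite mulrC.
Qed.

Let sB : sqi B. Proof. by apply: sqiM_test => //; case: Wb. Qed.
Let sB_ i : sqi (B_ i).
Proof.
apply: sqiD; apply: sqiM_test => //; [by case: Wb|exact: test_fun_derive|].
by case: Wb.
Qed.
Let bB : boxed B.
Proof. by move=> z zM; rewrite /B boxed_ext// mul0r. Qed.
Let bB_ i : boxed (B_ i).
Proof. by move=> z zM; rewrite /B_ !boxed_ext// !mul0r addr0. Qed.

Let byparts_B i psi : smooth psi ->
  \int[mu]_y (B y * D i psi y) = - \int[mu]_y (B_ i y * psi y).
Proof.
move=> spsi; set u := dir R i.
have E z : 'D_u (fun w => psi w * phi w) z = psi z * 'D_u phi z + 'D_u psi z * phi z.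
  have h1 := smooth_is_derive u z spsi; have h2 := smooth_is_derive u z tphi.1.
  by have [_ ->] := is_deriveM h1 h2; rewrite [X in _ + X]mulrC.
have t1 := test_funM spsi tphi.
have sb : sqi (ext b) by case: Wb.
have bi : sqi (ext (b_ i)) by case: Wb.
have t2 := test_funM spsi (test_fun_derive u tphi).
have t3 := test_funM (smooth_derive u spsi) tphi.
have i1 := sqiM sb (test_sqi t2); have i2 := sqiM sb (test_sqi t3).
have i3 := sqiM bi (test_sqi t1).
have E1 : \int[mu]_z (ext b z * 'D_u (fun w => psi w * phi w) z) =
    \int[mu]_z (ext b z * (psi z * 'D_u phi z)) + \int[mu]_z (ext b z * ('D_u psi z * phi z)).
  by rewrite -(IntD i1 i2); apply: eq_Int => z; rewrite E mulrDr.
have E2 : \int[mu]_y (B y * 'D_u psi y) = \int[mu]_z (ext b z * ('D_u psi z * phi z)).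
  by apply: eq_Int => z; rewrite /B -mulrA [phi z * _]mulrC.
have E3 : \int[mu]_y (B_ i y * psi y) =
    \int[mu]_z (ext b z * (psi z * 'D_u phi z)) + \int[mu]_z (ext (b_ i) z * (psi z * phi z)).
  by rewrite -(IntD i1 i3); apply: eq_Int => z; rewrite /B_; ring.
have E4 := W12_byparts i Wb t1.
rewrite E2 E3; move: E4; rewrite E1 => E4.
by rewrite opprD -E4 addrA addNr add0r.
Qed.

Let kernel_itg k f z : test_fun setT k -> itg f -> itg (fun y => k (z - y) * f y).
Proof.
move=> tk fi; have [C C0 CP] := test_bounded tk.
by apply: (itgMb _ _ fi (k := C)) => //; exact: smooth_msr (smooth_reflect z tk.1).
Qed.

(** No sign appears: the minus of the integration by parts cancels the one from differentiating
    [k (z - y)] in [y]. *)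
Let kernel_B i k z : test_fun setT k ->
  \int[mu]_y (k (z - y) * B_ i y) = \int[mu]_y (D i k (z - y) * B y).
Proof.
move=> tk; have sk := tk.1; have := byparts_B i (smooth_reflect z sk).
have -> : \int[mu]_y (B y * D i (fun w => k (z - w)) y) = - \int[mu]_y (D i k (z - y) * B y).
  rewrite -IntN; last first.
    exact: (kernel_itg z (test_fun_derive (dir R i) tk) (sqi_boxed bB sB)).
  apply: eq_Int => y; have [_ ->] := is_derive_reflect z (dir R i) y sk.
  by rewrite mulrN mulrC.
by move=> /oppr_inj H; rewrite H; apply: eq_Int => y; rewrite mulrC.
Qed.

Let cross_B i k f : test_fun setT k -> itg f -> cross k f (B_ i) = cross (D i k) f B.
Proof.
move=> tk fi; have tDk := test_fun_derive (dir R i) tk.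
have [C _ CP] := test_bounded tk; have [C' _ CP'] := test_bounded tDk.
have Bi := sqi_boxed bB sB; have B_i := sqi_boxed (bB_ i) (sB_ i).
have [_ ->] := crossE1 tk.1 CP fi B_i; have [_ ->] := crossE1 tDk.1 CP' fi Bi.
by apply: eq_Int => z; rewrite kernel_B.
Qed.

(** Translated kernels centred where [phi] is nonzero are test functions of [Omega], hence
    admissible in the definition of the weak derivatives of [a]. *)
Let margin : exists2 r0 : R, 0 < r0 & forall r y, 0 < r < r0 -> phi y != 0 ->
  tst (fun z => rho r (z - y)).
Proof.
have [_ [K [cK KO phi0]]] := tphi; have [r0 r00 r0P] := compact_margin cK KO.
exists r0 => // r y /andP[rP rr0] phiy; split; first exact: smooth_translate (smooth_rho r).
have Ky : K y by apply: contrapT => /phi0 E; rewrite E eqxx in phiy.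
exists (cbox (y.1 - r) (y.1 + r) (y.2 - r) (y.2 + r)); split; first exact: compact_cbox.
  move=> z; rewrite cboxE => -[/andP[? ?] /andP[? ?]].
  by apply: (r0P y) => //; rewrite ltr_norml; apply/andP; split; lra.
move=> z zn; apply: rho_eq0 => // -[/=]; rewrite !ltr_norml => /andP[? ?] /andP[? ?].
by apply: zn; rewrite cboxE; split; apply/andP; split; lra.
Qed.

Let sa : sqi (ext a). Proof. by case: Wa. Qed.
Let sa_ i : sqi (ext (a_ i)). Proof. by case: Wa. Qed.
Let ia : itg (ext a). Proof. exact: sqi_boxed (boxed_ext _) sa. Qed.
Let ia_ i : itg (ext (a_ i)). Proof. exact: sqi_boxed (boxed_ext _) (sa_ i). Qed.
Let iB : itg B. Proof. exact: sqi_boxed bB sB. Qed.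

Let kernel_a i k y : smooth k -> tst (fun z => k (z - y)) ->
  \int[mu]_z (D i k (z - y) * ext a z) = - \int[mu]_z (k (z - y) * ext (a_ i) z).
Proof.
move=> sk tk; rewrite (_ : \int[mu]_z (k (z - y) * ext (a_ i) z) =
    \int[mu]_z (ext (a_ i) z * k (z - y))); last by apply: eq_Int => z; rewrite mulrC.
rewrite -(W12_byparts i Wa tk); apply: eq_Int => z.
by have [_ ->] := is_derive_translate y (dir R i) z sk; rewrite mulrC.
Qed.

(** For each small [r] the derivative travels from [B] to the kernel ([cross_B]) and from the kernel
    to [a] ([kernel_a]) without error; [cross_limit] concludes. *)
Lemma product_rule_local i :
  \int[mu]_z (ext a z * B_ i z) = - \int[mu]_z (ext (a_ i) z * B z).
Proof.
rewrite -mulN1r; apply: cross_limit => //.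
- exact: boxed_ext.
- exact: boxed_ext.
- by rewrite normrN1.
have [r0 r00 r0P] := margin; exists r0 => // r rr.
have rP : 0 < r by case/andP: rr.
have tk := test_rho rP; have tDk := test_fun_derive (dir R i) tk.
rewrite cross_B//; have [C _ CP] := test_bounded tk; have [C' _ CP'] := test_bounded tDk.
have [_ ->] := crossE2 tDk.1 CP' ia iB; have [H ->] := crossE2 tk.1 CP (ia_ i) iB.
rewrite mulN1r -IntN//; apply: eq_Int => y; rewrite /B.
have [->|py] := eqVneq (phi y) 0; first by rewrite mulr0 !mul0r oppr0.
by rewrite kernel_a ?mulrN//; [exact: tk.1|exact: r0P].
Qed.

                                                                           
                                             
(** The weak form of the fact that a Jacobian determinant is a divergence. With both derivatives
    moved to the kernel, the two sides become the pairing of [a] and [B] through a second derivative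
    of [rho r], which is symmetric in [i] and [j]. *)
Lemma jacobian_local i j :
  \int[mu]_z (ext (a_ i) z * B_ j z) = \int[mu]_z (ext (a_ j) z * B_ i z).
Proof.
rewrite -[RHS]mul1r; apply: cross_limit => //.
- exact: boxed_ext.
- exact: boxed_ext.
- by rewrite normr1.
have [r0 r00 r0P] := margin; exists r0 => // r rr; rewrite mul1r.
have rP : 0 < r by case/andP: rr.
have tk := test_rho rP.
have [F FC HF] : exists2 F : 'I_2 -> 'I_2 -> R * R -> R, forall l m z, F l m z = F m l z &
    forall l m, cross (rho r) (ext (a_ l)) (B_ m) =
      \int[mu]_y (B y * - \int[mu]_z (F l m (z - y) * ext a z)).
  exists (fun l m => D l (D m (rho r))) => [l m z|l m].
    by apply: smooth_derive_comm; exact: tk.1.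
  have tDk := test_fun_derive (dir R m) tk; have [C _ CP] := test_bounded tDk.
  rewrite cross_B//; have [_ ->] := crossE2 tDk.1 CP (ia_ l) iB.
  apply: eq_Int => y; rewrite /B.
  have [->|py] := eqVneq (phi y) 0; first by rewrite mulr0 !mul0r.
  congr (_ * _).
  have tt : tst (fun z => D m (rho r) (z - y)).
    have := test_fun_derive (dir R m) (r0P _ _ rr py).
    congr (test_fun _ _); apply/funext => z.
    by have [_ ->] := is_derive_translate y (dir R m) z tk.1.
  by rewrite (kernel_a l tDk.1 tt) opprK.
rewrite (HF i j) (HF j i); apply: eq_Int => y; congr (_ * - _); apply: eq_Int => z.
by rewrite FC.
Qed.

End localized.

End product_rules.

                                             

(** * Vertical integration and its dual *)

Section vertical_primitive.
Variable R : realType.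
Variable M : R.
Hypothesis M0 : 0 < M.
Local Notation leb := (@lebesgue_measure R).
Local Notation tT := (test_fun [set: R * R]).
Implicit Types (z y u : R * R) (r t : R) (f g phi psi : R * R -> R).

Let I : set R := `[0, 2 * M]%classic.

Let mI : measurable (I : set (measurableTypeR R)).
Proof. exact: measurable_itv. Qed.

Let lebI : leb I = (2 * M)%:E.
Proof. by rewrite /I lebesgue_measure_itv/= lte_fin mulr_gt0// -EFinD subr0. Qed.

(** The adjoint of vertical integration from below. If [phi] vanishes above height [M] then, from a
    point of height at least [-M], length [2 M] suffices to see all of [phi] above that point. The
    fixed length preserves smoothness and compact support. *)
Definition vshift phi z : R := \int[leb]_(r in I) phi (z + (0, r)).

Let continuous_vline phi z : continuous phi -> continuous (fun r : R => phi (z + (0, r))).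
Proof.
move=> cphi r; apply: (continuous_comp (f := fun r : R => z + (0, r))); last exact: cphi.
by apply: cvgD; [exact: cvg_cst|exact: (cvg_pair (cvg_cst (0 : R)) cvg_id)].
Qed.

Let integrable_slice phi z : continuous phi ->
  leb.-integrable I (EFin \o (fun r => phi (z + (0, r)))).
Proof.
move=> cphi; apply: continuous_compact_integrable; first exact: segment_compact.
by apply: continuous_subspaceT; exact: continuous_vline.
Qed.

Lemma continuous_vshift phi : tT phi -> continuous (vshift phi).
Proof.
move=> tphi z; have [L L0 LP] := test_lipschitz tphi.
have cphi := smooth_continuous tphi.1.
have bnd w : `|vshift phi z - vshift phi w| <= L * (`|z.1 - w.1| + `|z.2 - w.2|) * (2 * M).
  rewrite /vshift -RintegralB//; [|exact: integrable_slice..].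
  have ii := @integrableB _ _ _ leb I mI _ _ (integrable_slice z cphi) (integrable_slice w cphi).
  rewrite (le_trans (le_normr_Rintegral _ ii))//.
  have -> : L * (`|z.1 - w.1| + `|z.2 - w.2|) * (2 * M) =
      \int[leb]_(r in I) (L * (`|z.1 - w.1| + `|z.2 - w.2|)).
    by rewrite Rintegral_cst//; congr (_ * _); rewrite -[LHS]/(fine (2 * M)%:E) -lebI.
  apply: le_Rintegral => //.
  - exact: integrable_norm.
  - by apply: continuous_compact_integrable; [exact: segment_compact|apply: continuous_subspaceT => ?; exact: cvg_cst].
  - move=> r _; apply: (le_trans (LP _ _)).
    by rewrite /= !addr0 [z.2 + r]addrC [w.2 + r]addrC opprD addrACA subrr add0r.
(* [4 L M] counts two coordinates and length [2 M]; the added 1 avoids division by zero. *)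
apply/cvgrPdist_le => e e0; have P0 : 0 < L * 4 * M + 1 by rewrite ltr_wpDl// !mulr_ge0// ltW.
have : \forall w \near z, ball z (e / (L * 4 * M + 1)) w by apply: nbhsx_ballx; rewrite divr_gt0.
apply: filterS => w [w1 w2]; apply: (le_trans (bnd w)).
move: w1 w2; rewrite /ball/= => /ltW w1 /ltW w2.
apply: (@le_trans _ _ (L * (e / (L * 4 * M + 1) + e / (L * 4 * M + 1)) * (2 * M))).
  by rewrite ler_wpM2r ?mulr_ge0 ?(ltW M0)// ler_wpM2l// lerD.
rewrite (_ : L * _ * _ = e * (L * 4 * M / (L * 4 * M + 1))); last first.
  by field; rewrite gt_eqF.
by rewrite ler_piMr ?(ltW e0)// ler_pdivrMr// mul1r lerDl.
Qed.

Lemma is_derive_vshift phi z u : tT phi -> is_derive z u (vshift phi) (vshift ('D_u phi) z).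
Proof.
move=> tphi; have tD := test_fun_derive u tphi; have [C C0 CP] := test_bounded tD.
have cphi := smooth_continuous tphi.1.
pose f (t r : R) := phi (z + t *: u + (0, r)).
have fD t r : is_derive (t : R) (1 : R) (f ^~ r) ('D_u phi (z + t *: u + (0, r))).
  have -> : f ^~ r = (fun s : R => phi (z + (0, r) + s *: u)) by apply/funext => s; rewrite /f addrAC.
  by apply: is_derive_line; rewrite addrAC; exact: smooth_is_derive tphi.1.
have I0 : `](-1 : R), 1[%classic 0 by rewrite /= in_itv/= ltrN10 ltr01.
have h1 (x : R) : `](-1 : R), 1[%classic x -> leb.-integrable I (EFin \o f x).
  by move=> _; exact: integrable_slice.
have h2 (x r : R) : `](-1 : R), 1[%classic x -> I r -> derivable (f ^~ r) x 1.
  by move=> _ _; have [] := fD x r.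
have h3 : leb.-integrable I (EFin \o (fun _ : R => C)).
  by apply: continuous_compact_integrable; [exact: segment_compact|apply: continuous_subspaceT => ?; exact: cvg_cst].
have h4 (x r : R) : `](-1 : R), 1[%classic x -> I r -> `|partial1of2 f x r| <= C.
  by move=> _ _; rewrite partial1of2E; have [_ ->] := fD x r.
have der := derivable_under_integral mI I0 h1 h2 (fun _ => C0) h3 h4.
have derE := differentiation_under_integral mI I0 h1 h2 (fun _ => C0) h3 h4.
have E : (fun x' => \int[leb]_(y in I) f x' y) = (fun s : R => vshift phi (s *: u + z)).
  by apply/funext => s; rewrite /vshift; apply: eq_Rintegral => r _; rewrite /f [z + _]addrC.
rewrite E in der derE; split; first by apply/derivable1P.
have := @derive_affine R R _ R (vshift phi) (fun s : R => s *: u + z) 0 1 u.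
rewrite scale0r add0r => <-; last by move=> k; rewrite [k *: 1]mulr1 addr0.
have -> : 'D_1 (vshift phi \o (fun s : R => s *: u + z)) 0 =
    (fun s : R => vshift phi (s *: u + z))^`()%classic 0 by rewrite derive1E.
rewrite derE /vshift; apply: eq_Rintegral => r _.
rewrite partial1of2E; have [_ ->] := fD 0 r.
by rewrite scale0r addr0.
Qed.

Lemma smooth_vshift phi : tT phi -> smooth (vshift phi).
Proof.
move=> tphi k; elim: k phi tphi => [|k IH] phi tphi.
  by split=> // z _; exact: continuous_vshift.
apply: (CkSd (df := fun u => vshift ('D_u phi))).
- exact: continuous_vshift.
- by move=> u z; exact: is_derive_vshift.
- by move=> u; apply: IH; exact: test_fun_derive.
Qed.

Lemma derive_vshift phi u z : tT phi -> 'D_u (vshift phi) z = vshift ('D_u phi) z.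
Proof. by move=> tphi; have [_ ->] := is_derive_vshift z u tphi. Qed.

Lemma vshift_eq0 phi z : (forall r, 0 <= r <= 2 * M -> phi (z + (0, r)) = 0) -> vshift phi z = 0.
Proof.
move=> phi0; transitivity (\int[leb]_(r in I) (0 : R)); last first.
  by rewrite Rintegral_cst// mul0r.
by apply: eq_Rintegral => r; rewrite inE /I /= in_itv/= => rI; exact: phi0.
Qed.

Lemma test_vshift phi : tT phi -> tT (vshift phi).
Proof.
move=> tphi; split; first exact: smooth_vshift.
have [N N0 NP] := test_supp tphi.
exists (cbox (- N) N (- N - 2 * M) N); split=> //; first exact: compact_cbox.
move=> z zn; apply: vshift_eq0 => r /andP[r0 rM]; apply: NP.
rewrite oboxE/= addr0 => -[/andP[? ?] /andP[? ?]]; apply: zn.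
by rewrite cboxE; split; apply/andP; split; lra.
Qed.

Definition vanishes_above phi := forall z, M <= z.2 -> phi z = 0.

Lemma vanishes_vshift phi : vanishes_above phi -> vanishes_above (vshift phi).
Proof.
move=> phi0 z zM; apply: vshift_eq0 => r /andP[r0 _]; apply: phi0.
by rewrite /= (le_trans zM)// lerDl.
Qed.

(** The upper endpoint [z.2 + 2 M] lies at height at least [M], where [phi] vanishes; only the lower
    endpoint contributes. *)
Lemma derive2_vshift phi z : tT phi -> vanishes_above phi -> - M <= z.2 ->
  'D_(0, 1) (vshift phi) z = - phi z.
Proof.
move=> tphi phi0 zM; rewrite derive_vshift// /vshift.
have M2 : 0 < 2 * M by rewrite mulr_gt0.
have zE r : z + (0, r) = (z.1, z.2 + r) by rewrite -[LHS]/(z.1 + 0, z.2 + r) addr0.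
have D (r : R) : is_derive (r : R) (1 : R) (fun s : R => phi (z + (0, s))) ('D_(0, 1) phi (z + (0, r))).
  apply: (@is_derive_affine _ _ _ _ phi (fun s : R => z + (0, s)) r 1 (0, 1)).
    by move=> h; rewrite !zE -[RHS]/(h *: 0 + z.1, h *: 1 + (z.2 + r)) scaler0 add0r addrCA.
  exact: smooth_is_derive tphi.1.
have cF (r : R) : {for r, continuous (fun s : R => phi (z + (0, s)))}.
  by apply/differentiable_continuous/derivable1_diffP; have [] := D r.
pose g (r : R) : R := 'D_(0, 1) phi (z + (0, r)).
have cg : continuous g.
  apply: (@continuous_vline ('D_(0, 1) phi) z).
  exact: smooth_continuous (smooth_derive (0, 1) tphi.1).
have E : (\int[leb]_(r in I) (g r)%:E =
    (phi (z + (0, 2 * M)))%:E - (phi (z + (0, 0)))%:E)%E.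
  apply: (@continuous_FTC2 R g (fun s : R => phi (z + (0, s)))) => //.
  - exact: continuous_subspaceT.
  - split=> [x _| |]; first by have [] := D x.
      by apply: cvg_at_right_filter; exact: cF.
    by apply: cvg_at_left_filter; exact: cF.
  - by move=> x _; rewrite derive1E; have [] := D x.
rewrite -/(\int[leb]_(r in I) g r) /Rintegral E/= addr0 phi0; first by rewrite sub0r.
by rewrite /=; move: zM; lra.
Qed.

End vertical_primitive.

Section vertical_integral.
Variable R : realType.
Variable M : R.
Hypothesis M0 : 0 < M.
Local Notation M2 := (measurableTypeR R * measurableTypeR R)%type.
Local Notation mu := (@leb2 R).
Local Notation leb := (@lebesgue_measure R).
Local Notation itg f := (mu.-integrable [set: M2] (EFin \o f)).
Local Notation msr f := (measurable_fun [set: M2] f).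
Local Notation sqi f := (sqi mu f).
Local Notation boxed f := (boxed M f).
Implicit Types (z u : R * R) (x y s : R) (f g h phi psi : R * R -> R).

Let sq : set (R * R) := obox (- M) M (- M) M.
Let ivl : set R := `]- M, M[%classic.

(** The vertical primitive from below. Cutting it off to the square keeps it square integrable, and
    is harmless against functions that vanish above height [M] when [f] itself lives in the
    square. *)
Definition vint f z : R :=
  \1_sq z * \int[leb]_s (\1_[set s | s < z.2] s * f (z.1, s)).

Lemma boxed_vint f : boxed (vint f).
Proof. by move=> z zM; rewrite /vint indicE memNset// mul0r. Qed.

Lemma measurable_vint f : msr f -> msr (vint f).
Proof.
move=> mf; apply: measurable_funM; first by apply: measurable_indic; exact: measurable_obox.
pose A := [set w : M2 * measurableTypeR R | w.2 < w.1.2].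
have mA : measurable A.
  have := @measurable_fun_ltr _ (M2 * measurableTypeR R)%type R setT (fun w => w.2) (fun w => w.1.2).
  move=> /(_ _ _ measurableT [set true]); rewrite setTI; apply => //.
    exact: measurable_snd.
  exact: (measurableT_comp measurable_snd measurable_fst).
pose F (w : M2 * measurableTypeR R) : R := \1_A w * f (w.1.1, w.2).
have mF : measurable_fun setT F.
  apply: measurable_funM; first exact: measurable_indic.
  apply: (measurableT_comp mf); apply: measurable_fun_pair; last exact: measurable_snd.
  exact: measurableT_comp measurable_fst measurable_fst.
have mF' : measurable_fun setT (EFin \o F) by exact/measurable_EFinP.
have mp := @measurable_fun_fubini_tonelli_F _ _ M2 (measurableTypeR R) R leb _
  (measurable_funepos mF') (fun w => funepos_ge0 _ w).
have mn := @measurable_fun_fubini_tonelli_F _ _ M2 (measurableTypeR R) R leb _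
  (measurable_funeneg mF') (fun w => funeneg_ge0 _ w).
rewrite (_ : (fun z => _) = fine \o (fun z => \int[leb]_s (EFin \o F) (z, s))%E).
  apply: measurableT_comp => //.
  rewrite (_ : (fun z => _) = (fun z => fubini_F leb ((EFin \o F)^\+)%E z - fubini_F leb ((EFin \o F)^\-)%E z)%E).
    exact: emeasurable_funB.
  apply/funext => z; rewrite [LHS]integralE.
  by congr (_ - _)%E; apply: eq_integral => s _; rewrite ?funeposE ?funenegE.
by apply/funext => z; congr fine; apply: eq_integral => s _; rewrite /F /A !indicE.
Qed.

Lemma ae_fst (P : R -> Prop) : (\forall x \ae leb, P x) -> \forall z \ae mu, P z.1.
Proof.
move=> [N [mN N0 PN]]; exists (N `*` setT); split.
- exact: measurableX.
- have -> : mu (N `*` setT) = (leb N * leb setT)%E by exact: product_measure1E.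
  by rewrite [X in (X * _)%E]N0 mul0e.
- by move=> z /= nP; split => //; apply: PN.
Qed.

Lemma sq_ivl z : sq z <-> ivl z.1 /\ ivl z.2.
Proof. by rewrite /sq oboxE /ivl/= !in_itv. Qed.

Let lebivl : leb ivl = (2 * M)%:E.
Proof.
rewrite /ivl lebesgue_measure_itv/= lte_fin ifT; last by rewrite gtrN.
by rewrite -EFinD opprK; congr EFin; ring.
Qed.

Let mivl : measurable (ivl : set (measurableTypeR R)). Proof. exact: measurable_itv. Qed.

Let Int_ivl : \int[leb]_s (\1_ivl s : R) = 2 * M.
Proof.
by rewrite /Rintegral integral_indic// setIT -[RHS]/(fine (2 * M)%:E) -lebivl.
Qed.

Let ivl_itg : leb.-integrable setT (EFin \o (\1_ivl : R -> R)).
Proof. by apply: itg_indic => //; apply: (@le_lt_trans _ _ (2 * M)%:E); [rewrite -lebivl|exact: ltry]. Qed.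

(** Cauchy-Schwarz on an interval of length [2 M]: the square of [|F| - c] is integrated over the
    interval, with [c] the mean of [|F|]. The factor [k] will be the indicator of a half line. *)
Lemma norm_Int_ivl_le (k F : R -> R) : measurable_fun setT k -> (forall s, `|k s| <= 1) ->
  leb.-integrable setT (EFin \o (fun s => F s ^+ 2)) -> leb.-integrable setT (EFin \o F) ->
  (forall s, ~ ivl s -> F s = 0) ->
  (\int[leb]_s (k s * F s)) ^+ 2 <= 2 * M * \int[leb]_s (F s ^+ 2).
Proof.
move=> mk k1 F2 Fi F0; have Fn := itg_norm Fi.
have le1 : `|\int[leb]_s (k s * F s)| <= \int[leb]_s `|F s|.
  apply: le_Int_norm => //.
    by move=> s; rewrite normrM ler_piMl.
  by apply: measurable_funM => //; exact: itg_msr Fi.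
set J := \int[leb]_s `|F s| in le1; have J0 : 0 <= J by apply: Int_ge0.
have MM : 0 < 2 * M by rewrite mulr_gt0.
apply: (@le_trans _ _ (J ^+ 2)).
  by rewrite -(real_normK (num_real (\int[leb]_s _))) lerXn2r ?nnegrE.
pose c := J / (2 * M).
have : 0 <= \int[leb]_s (F s ^+ 2 - 2 * c * `|F s| + c ^+ 2 * \1_ivl s).
  apply: Int_ge0 => s; rewrite indicE; have [sI|sI] := pselect (ivl s).
    rewrite (mem_set sI) mulr1 -(real_normK (num_real (F s))).
    by rewrite [leRHS](_ : _ = (`|F s| - c) ^+ 2) ?sqr_ge0//; ring.
  by rewrite memNset// F0// expr0n normr0 !mulr0 subr0 addr0.
have i1 := itgZ (2 * c) Fn; have i2 := itgZ (c ^+ 2) ivl_itg.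
have -> : \int[leb]_s (F s ^+ 2 - 2 * c * `|F s| + c ^+ 2 * \1_ivl s) =
    \int[leb]_s (F s ^+ 2) - 2 * c * J + c ^+ 2 * (2 * M).
  rewrite (IntD (itgB F2 i1) i2) (IntB F2 i1) (IntZ _ Fn) (IntZ _ ivl_itg).
  by rewrite Int_ivl.
have -> : c ^+ 2 * (2 * M) = c * J by rewrite /c; field; rewrite gt_eqF.
move=> H; rewrite -ler_pdivrMl//.
have -> : (2 * M)^-1 * J ^+ 2 = c * J by rewrite /c; field; rewrite gt_eqF.
by move: H; lra.
Qed.

Lemma slice_facts f : sqi f -> boxed f -> \forall x \ae leb,
  [/\ leb.-integrable setT (EFin \o (fun s => f (x, s) ^+ 2)),
      leb.-integrable setT (EFin \o (fun s => f (x, s))) &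
      forall s, ~ ivl s -> f (x, s) = 0].
Proof.
move=> sf fB; have fi := sqi_boxed fB sf.
have H1 := @ae_integrable1 _ _ _ _ R leb leb (EFin \o (fun z => f z ^+ 2)) sf.2.
have H2 := @ae_integrable1 _ _ _ _ R leb leb (EFin \o f) fi.
apply: filterS2 H1 H2 => x h1 h2; split=> // s sI.
by apply: fB; apply: contra_not sI => /sq_ivl[].
Qed.

Lemma sqi_vint f : sqi f -> boxed f -> sqi (vint f).
Proof.
move=> sf fB; have mf := sf.1; have mv := measurable_vint mf.
pose N x : R := 2 * M * \int[leb]_s (f (x, s) ^+ 2).
have iN : leb.-integrable setT (EFin \o N).
  by apply: itgZ; exact: (Int_prod1 sf.2).1.
have N0 x : 0 <= N x.
  by rewrite mulr_ge0 ?mulr_ge0 ?(ltW M0)// Int_ge0// => s; exact: sqr_ge0.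
pose G z : R := N z.1 * \1_ivl z.2.
have mG : msr G.
  apply: measurable_funM; first exact: measurableT_comp (itg_msr iN) measurable_fst.
  exact: measurableT_comp (measurable_indic mivl) measurable_snd.
have G0 z : 0 <= G z by rewrite mulr_ge0// indicE.
have iG : itg G.
  apply: (@itg_prodP _ _ _ _ R leb leb G (fun x y => N x * \1_ivl y)) => //.
  - by move=> x y; rewrite ger0_norm.
  - by move=> x; exact: itgZ ivl_itg.
  - apply: (itg_eq _ (itgZ (2 * M) iN)) => x.
    by rewrite (IntZ _ ivl_itg) Int_ivl mulrC.
(* The bound by [G] is available only on almost every vertical line, so integrability is shown for
   the minimum with [G], which equals the square almost everywhere. *)
split=> //; pose u z := Num.min (vint f z ^+ 2) (G z).
have iu : itg u.
  apply: itg_le iG; first by apply: measurable_minr => //; exact: measurable_funX.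
  by move=> z; rewrite ger0_norm ?le_min ?sqr_ge0 ?G0// ge_min lexx orbT.
apply: itg_ae iu; first exact: measurable_funX.
have H := ae_fst (slice_facts sf fB); apply: filterS H => z [h1 h2 h3].
rewrite /u; apply/min_idPl; rewrite /G /vint indicE [in leRHS]indicE.
have [zq|zq] := pselect (sq z); last by rewrite memNset// mul0r expr0n mulr_ge0.
have /sq_ivl[_ z2] := zq; rewrite !mem_set// mul1r mulr1.
apply: (@norm_Int_ivl_le (\1_[set s | s < z.2]) (fun s => f (z.1, s))) => //.
  apply: measurable_indic; rewrite (_ : [set s | _] = `]-oo, z.2[%classic)//.
by move=> s; rewrite indicE; case: (_ \in _); rewrite ?normr1 ?normr0.
Qed.

(** The hypotheses make [G (x, s)] the integral of [phi (x, y)] for [y] from [s] to [M]. On almost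
    every vertical line both sides are therefore the integral of [f (x, s) phi (x, y)] over the
    triangle [s < y], in the two orders. *)
Lemma vint_duality f phi G : sqi f -> boxed f -> smooth phi -> smooth G ->
  (forall x, G (x, M) = 0) -> (forall z, - M <= z.2 -> 'D_(0, 1) G z = - phi z) ->
  \int[mu]_z (vint f z * phi z) = \int[mu]_z (f z * G z).
Proof.
move=> sf fB sphi sG GM DG; have sv := sqi_vint sf fB.
have bounded_box (h : R * R -> R) : smooth h -> exists2 C : R, 0 <= C & forall z, sq z -> `|h z| <= C.
  move=> sh; have [C C0 CP] := bounded_on_box (- M) M (- M) M (smooth_continuous sh).
  exists C => // z; rewrite /sq oboxE => -[/andP[? ?] /andP[? ?]]; apply: CP.
  by rewrite cboxE !ltW.
have itgB (g h : R * R -> R) : sqi g -> boxed g -> smooth h -> itg (fun z => g z * h z).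
  move=> sg gB sh; have [C C0 CP] := bounded_box h sh.
  apply: (@itg_le _ _ _ mu _ (fun z => C * `|g z|)).
  - by apply: measurable_funM; [exact: sg.1|exact: smooth_msr].
  - move=> z; rewrite normrM mulrC; have [zq|zq] := pselect (sq z).
      by rewrite ler_wpM2r// CP.
    by rewrite gB// normr0 !mulr0.
  - exact: (itgZ _ (itg_norm (sqi_boxed gB sg))).
have i1 := itgB _ _ sv (@boxed_vint f) sphi; have i2 := itgB _ _ sf fB sG.
have [j1 ->] := Int_prod1 i1; have [j2 ->] := Int_prod1 i2.
apply: Int_ae; [exact: itg_msr j1|exact: itg_msr j2|].
have H := slice_facts sf fB.
apply: (@filterS _ _ (ae_filter_ringOfSetsType leb) _ _ _ H) => x [h1 h2 h3].
have [xI|xI] := pselect (ivl x); last first.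
  transitivity (\int[leb]_y (0 : R)); last apply: eq_Int => y.
    by apply: eq_Int => y; rewrite boxed_vint ?mul0r// => /sq_ivl[].
  by rewrite fB ?mul0r// => /sq_ivl[].
(* On the line through [x], the pair [w = (s, y)] collects the two vertical variables, and [K] is
   the integrand on the triangle. *)
have [C C0 CP] := bounded_box phi sphi.
pose K (w : R * R) : R := f (x, w.1) * (\1_[set w | w.1 < w.2] w * (\1_ivl w.2 * phi (x, w.2))).
have mA : measurable ([set w | w.1 < w.2] : set M2).
  have := @measurable_fun_ltr _ M2 R setT fst snd measurable_fst measurable_snd measurableT [set true].
  by rewrite setTI; apply.
have mphi : measurable_fun setT (fun y : R => phi (x, y)).
  by apply: continuous_measurable_fun; exact: (continuous_slice2 (x := x) (smooth_continuous sphi)).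
have mK : msr K.
  apply: measurable_funM; first exact: (measurableT_comp (itg_msr h2) measurable_fst).
  apply: measurable_funM; first exact: measurable_indic.
  apply: (@measurableT_comp _ _ _ _ _ _ (fun y : R => \1_ivl y * phi (x, y)) _ snd) => //.
  by apply: measurable_funM => //; exact: measurable_indic.
have iK : itg K.
  apply: (@itg_prodP _ _ _ _ R leb leb K (fun s y => (`|f (x, s)| * C) * \1_ivl y)) => //.
  - move=> s y; rewrite /K !normrM -mulrA ler_wpM2l// !indicE.
    apply: (@le_trans _ _ (`|(y \in ivl)%:R| * `|phi (x, y)|)).
      by rewrite ler_piMl ?mulr_ge0//; case: (_ \in _); rewrite ?normr1 ?normr0.
    have [yI|yI] := pselect (ivl y); last by rewrite memNset// normr0 mul0r mulr0.
    by rewrite mem_set// normr1 mul1r mulr1; apply: CP; apply/sq_ivl.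
  - by move=> s; exact: itgZ ivl_itg.
  - apply: (itg_eq _ (itgZ (C * (2 * M)) (itg_norm h2))) => s.
    by rewrite (IntZ _ ivl_itg) Int_ivl; ring.
have [_ E1] := Int_prod1 iK; have [_ E2] := Int_prod2 iK.
transitivity (\int[leb]_y \int[leb]_s K (s, y)).
  apply: eq_Int => y; rewrite /vint indicE.
  rewrite (_ : (_ \in _) = (y \in ivl)); last first.
    by apply/idP/idP => /[!inE]; [move=> /sq_ivl[]|move=> yI; apply/sq_ivl].
  transitivity (\int[leb]_s (\1_ivl y * phi (x, y) * (\1_[set s | s < y] s * f (x, s)))); last first.
    by apply: eq_Int => s; rewrite /K /= !indicE; ring.
  rewrite IntZ; first by rewrite indicE; ring.
  apply: (itgMb (k := 1)) h2.
    apply: measurable_indic; rewrite (_ : [set s | _] = `]-oo, y[%classic)//.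
  by move=> s; rewrite indicE; case: (_ \in _); rewrite ?normr1 ?normr0.
rewrite -E2 E1; apply: eq_Int => s; rewrite /K.
have [sI|sI] := pselect (ivl s); last first.
  by rewrite h3// mul0r -[RHS](Int0 leb); apply: eq_Int => y; rewrite mul0r.
have sM : - M < s < M by move: sI; rewrite /ivl/= in_itv.
have /andP[s1 s2] := sM.
have D (y : R) : is_derive (y : R) (1 : R) (fun r : R => G (x, r)) ('D_(0, 1) G (x, y)).
  exact: is_derive_slice2.
have cg : continuous (fun y : R => 'D_(0, 1) G (x, y)).
  exact: (continuous_slice2 (x := x) (smooth_continuous (smooth_derive (0, 1) sG))).
have E : (\int[leb]_(y in `[s, M]) ('D_(0, 1) G (x, y))%:E =
    (G (x, M))%:E - (G (x, s))%:E)%E.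
  apply: (@continuous_FTC2 R (fun y => 'D_(0, 1) G (x, y)) (fun y : R => G (x, y))) => //.
  - exact: continuous_subspaceT.
  - have cF (y : R) : {for y, continuous (fun r : R => G (x, r))}.
      by apply/differentiable_continuous/derivable1_diffP; have [] := D y.
    split=> [y _| |]; first by have [] := D y.
      by apply: cvg_at_right_filter; exact: cF.
    by apply: cvg_at_left_filter; exact: cF.
  - by move=> y _; rewrite derive1E; have [] := D y.
pose J : set R := `]s, M[%classic.
have JI (y : R) : J y -> ivl y.
  by rewrite /J /ivl/= !in_itv/= => /andP[sy ->]; rewrite (lt_trans s1 sy).
pose h (y : R) : R := (\1_J y * phi (x, y)) * \1_ivl y.
have ih : leb.-integrable setT (EFin \o h).
  apply: (itgMb (k := C)) ivl_itg.
    by apply: measurable_funM => //; apply: measurable_indic; exact: measurable_itv.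
  move=> y; rewrite indicE; have [yJ|yJ] := pselect (J y).
    by rewrite mem_set// mul1r; apply: CP; apply/sq_ivl; split=> //; exact: JI.
  by rewrite memNset// mul0r normr0.
have Eh : \int[leb]_y h y = G (x, s).
  have -> : G (x, s) = - \int[leb]_(y in J) ('D_(0, 1) G (x, y)).
    have := E; rewrite integral_itv_bndoo; last first.
      by apply: measurable_funTS; apply/measurable_EFinP; exact: continuous_measurable_fun.
    by rewrite /Rintegral => ->; rewrite /= GM sub0r opprK.
  rewrite (_ : \int[leb]_(y in J) _ = \int[leb]_y (-1 * h y)).
    by rewrite (IntZ _ ih) mulN1r opprK.
  rewrite [LHS]Rintegral_mkcond; apply: eq_Int => y; rewrite patchE /h indicE.
  case: ifPn => [/[!inE] yJ|/negP/[!inE] yJ]; last by rewrite mul0r mul0r mulr0.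
  rewrite indicE (mem_set (JI _ yJ)) DG ?mulN1r ?mul1r ?mulr1//=.
  by move: (JI _ yJ); rewrite /ivl/= in_itv/= => /andP[/ltW].
rewrite -Eh -(IntZ _ ih); apply: eq_Int => y; rewrite /h /= !indicE; congr (_ * _).
rewrite mulrA [in RHS]mulrAC; congr (_ * _).
have -> : (y \in J) = ((s, y) \in [set w : R * R | w.1 < w.2]) && (y \in ivl).
  apply/idP/andP => [/[!inE] yJ|[]].
    split; last exact: JI.
    by move: yJ; rewrite /J/= in_itv/= => /andP[].
  by rewrite !inE /J /ivl/= !in_itv/= => -> /andP[_ ->].
by case: (_ \in [set w | _]); case: (y \in ivl); rewrite /= ?mulr0 ?mul0r ?mulr1.
Qed.

End vertical_integral.

(** * The potential of a divergence-free symmetric field *)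

Section stress_potential.
Variable R : realType.
Variable Omega : set (R * R).
Hypothesis oO : open Omega.
Variable M : R.
Hypothesis M0 : 0 < M.
Hypothesis OM : Omega `<=` obox (- M) M (- M) M.
Local Notation M2 := (measurableTypeR R * measurableTypeR R)%type.
Local Notation mu := (@leb2 R).
Local Notation itg f := (mu.-integrable [set: M2] (EFin \o f)).
Local Notation msr f := (measurable_fun [set: M2] f).
Local Notation sqi f := (sqi mu f).
Local Notation tT := (test_fun [set: R * R]).
Local Notation tst := (test_fun Omega).
Local Notation ext := (ext Omega).
Local Notation boxed := (boxed M).
Local Notation vint := (vint M).
Local Notation vshift := (vshift M).
Local Notation vanishes_above := (vanishes_above M).
Implicit Types (z u : R * R) (f g p q s phi psi : R * R -> R) (i j : 'I_2).

Lemma vint_vshift f phi : sqi f -> boxed f -> tT phi -> vanishes_above phi ->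
  \int[mu]_z (vint f z * phi z) = \int[mu]_z (f z * vshift phi z).
Proof.
move=> sf fB tphi phi0; apply: vint_duality => //; [exact: tphi.1| | |].
- exact: (smooth_vshift M0).
- by move=> x; rewrite (@vanishes_vshift _ _ phi).
- by move=> z zM; exact: (derive2_vshift M0).
Qed.

(** Strictly above height [M] this is local; at height [M] itself it follows from continuity of the
    derivative. *)
Lemma vanishes_derive phi u : tT phi -> vanishes_above phi ->
  vanishes_above ('D_u phi).
Proof.
move=> tphi phi0; have D0 w : M < w.2 -> 'D_u phi w = 0.
  move=> wM; rewrite -(derive_cst (0 : R) w u); apply: near_eq_derive.
  have : \forall y \near w, y.2 > M.
    have e0 : 0 < w.2 - M by rewrite subr_gt0.
    exists (setT, ball w.2 (w.2 - M)); first by split; [exact: filterT|exact: nbhsx_ballx].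
    move=> y [_]; rewrite /ball/= => /ltr_normlP[]; lra.
  by apply: filterS => y yM; rewrite phi0// ltW.
move=> z zM; apply/eqP/negPn/negP => Dz.
have cD : continuous ('D_u phi) by exact: (smooth_continuous (smooth_derive u tphi.1)).
have /near_plane[r r0] : \forall w \near z, 'D_u phi w != 0 by exact: (@cvgr_neq0 _ _ _ _ _ ('D_u phi) _ (cD z) Dz).
move=> /(_ (z.1, z.2 + r / 2))/=; rewrite subrr normr0 addrAC subrr add0r => /(_ r0).
rewrite gtr0_norm ?divr_gt0// ltr_pdivrMr// ltr_pMr// ltr1n => /(_ isT).
by rewrite D0 ?eqxx//=; apply: (le_lt_trans zM); rewrite ltrDl divr_gt0.
Qed.

Lemma test_vanishes phi : tst phi -> tT phi /\ vanishes_above phi.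
Proof.
move=> tphi; split; first exact: test_funS tphi.
case: tphi => _ [K [_ KO phi0]] z zM; apply: phi0 => /KO/OM.
by rewrite oboxE => -[_ /andP[_]]; lra.
Qed.

(** The divergence of [(f, g)] vanishes across the boundary of [Omega] as well, since the test
    functions are not confined to [Omega]. Their class is stable under derivatives and [vshift]. *)
Definition divfree f g := forall psi, tT psi -> vanishes_above psi ->
  \int[mu]_z (f z * 'D_(1, 0) psi z) = - \int[mu]_z (g z * 'D_(0, 1) psi z).

Lemma Int_D2_vshift f phi : boxed f -> tT phi -> vanishes_above phi ->
  sqi f ->
  \int[mu]_z (f z * 'D_(0, 1) (vshift phi) z) = - \int[mu]_z (f z * phi z).
Proof.
move=> fB tphi phi0 sf; rewrite -IntN; last exact: itgM_test tphi (sqi_boxed fB sf).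
apply: eq_Int => z; have [zM|zM] := pselect (obox (- M) M (- M) M z).
  rewrite (derive2_vshift M0 tphi phi0) ?mulrN//.
  by move: zM; rewrite oboxE => -[_ /andP[/ltW]].
by rewrite fB// !mul0r oppr0.
Qed.

Lemma vshift_derive f phi u : tT phi ->
  \int[mu]_z (f z * vshift ('D_u phi) z) = \int[mu]_z (f z * 'D_u (vshift phi) z).
Proof. by move=> tphi; apply: eq_Int => z; rewrite derive_vshift. Qed.

Lemma vint_partial2 f phi : sqi f -> boxed f -> tT phi -> vanishes_above phi ->
  \int[mu]_z (vint f z * 'D_(0, 1) phi z) = - \int[mu]_z (f z * phi z).
Proof.
move=> sf fB tphi phi0.
rewrite vint_vshift ?vshift_derive ?Int_D2_vshift//; first exact: test_fun_derive.
exact: vanishes_derive.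
Qed.

(** Under the vertical integral the horizontal derivative of [f] is minus the vertical derivative of
    [g], whose primitive is [- g]. *)
Lemma vint_partial1 f g phi : sqi f -> boxed f -> sqi g -> boxed g -> divfree f g ->
  tT phi -> vanishes_above phi ->
  \int[mu]_z (vint f z * 'D_(1, 0) phi z) = \int[mu]_z (g z * phi z).
Proof.
move=> sf fB sg gB fg tphi phi0.
rewrite vint_vshift ?vshift_derive//; [|exact: test_fun_derive|exact: vanishes_derive].
rewrite fg ?Int_D2_vshift ?opprK//; first exact: (test_vshift M0).
exact: vanishes_vshift.
Qed.

(** The horizontal derivative of [vint f] is [- g] and the vertical derivative of [vint g] is
    [g]. *)
Lemma divfree_vint f g : sqi f -> boxed f -> sqi g -> boxed g -> divfree f g ->
  divfree (vint f) (vint g).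
Proof.
move=> sf fB sg gB fg psi tpsi psi0.
by rewrite vint_partial2// (vint_partial1 sf fB sg gB fg)// opprK.
Qed.

Lemma sqi_ext f : sqi f -> sqi (ext f).
Proof.
move=> sf; apply: (sqiMb (k := 1)) sf; first by apply: measurable_indic; exact: (mO oO).
by move=> z; rewrite indicE; case: (_ \in _); rewrite ?normr1 ?normr0.
Qed.

Lemma weak_partial_boxed i f g : sqi f -> sqi g ->
  (forall phi, tT phi -> vanishes_above phi ->
     \int[mu]_z (f z * 'D_(dir R i) phi z) = - \int[mu]_z (g z * phi z)) ->
  is_weak_partial Omega i f g.
Proof.
move=> sf sg H; apply/is_weak_partialE.
split; [exact: (sqi_loc (sqi_ext sf))|exact: (sqi_loc (sqi_ext sg))|move=> phi tphi].
have E h psi z : tst psi -> ext h z * psi z = h z * psi z.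
  move=> [_ [K [_ KO psi0]]]; have [zO|zO] := pselect (Omega z); first by rewrite extE.
  by rewrite psi0 ?mulr0// => /KO.
under eq_Int do rewrite (E _ _ _ (test_fun_derive (dir R i) tphi)).
under [in RHS]eq_Int do rewrite (E _ _ _ tphi).
by apply: H; have [] := test_vanishes tphi.
Qed.

(** [Phi] is the double vertical primitive of [p]. Its vertical derivative is [vint p], its
    horizontal derivative [- vint q] because the pair of primitives is again divergence free. One
    more differentiation gives the Hessian entries [s], [- q], [p], the cofactor matrix of the
    stress. *)
Theorem stress_potential p q s :
  sqi p -> sqi q -> sqi s -> boxed p -> boxed q -> boxed s ->
  divfree p q -> divfree q s ->
  exists Phi : R * R -> R, sobolev Omega 2 Phi /\
    exists P Q : R * R -> R,
    [/\ W12 Omega Phi (fun i => if i == 0 then P else Q),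
        W12 Omega P (fun i => if i == 0 then s else fun z => - q z) &
        W12 Omega Q (fun i => if i == 0 then fun z => - q z else p)].
Proof.
move=> sp sq ss pB qB sB pq qs.
pose P1 := vint p; pose P2 := vint q; pose Phi := vint P1.
have sP1 : sqi P1 by exact: sqi_vint.
have sP2 : sqi P2 by exact: sqi_vint.
have P1B : boxed P1 by exact: boxed_vint.
have P2B : boxed P2 by exact: boxed_vint.
have sPhi : sqi Phi by exact: sqi_vint.
have P12 := divfree_vint sp pB sq qB pq.
have wPhi : W12 Omega Phi (fun i => if i == 0 then fun z => - P2 z else P1).
  split=> [|i|i]; first exact: sqi_ext.
    by case: ifP => _; apply: sqi_ext => //; exact: sqiN.
  apply: weak_partial_boxed => //; first by case: ifP => // _; exact: sqiN.
  rewrite /dir; case: ifP => _ phi tphi phi0; last exact: vint_partial2.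
  rewrite (vint_partial1 sP1 P1B sP2 P2B P12)// -IntN ?opprK.
    by apply: eq_Int => z; rewrite mulNr opprK.
  exact: (itgM_test tphi (itgN (sqi_boxed P2B sP2))).
have wP1 : W12 Omega P1 (fun i => if i == 0 then fun z => - q z else p).
  split=> [|i|i]; first exact: sqi_ext.
    by case: ifP => _; apply: sqi_ext => //; exact: sqiN.
  apply: weak_partial_boxed => //; first by case: ifP => // _; exact: sqiN.
  rewrite /dir; case: ifP => _ phi tphi phi0; last exact: vint_partial2.
  rewrite (vint_partial1 sp pB sq qB pq)// -IntN ?opprK.
    by apply: eq_Int => z; rewrite mulNr opprK.
  exact: (itgM_test tphi (itgN (sqi_boxed qB sq))).
have wP2 : W12 Omega (fun z => - P2 z) (fun i => if i == 0 then s else fun z => - q z).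
  have N f phi : tT phi -> sqi f -> boxed f ->
      \int[mu]_z (- f z * phi z) = - \int[mu]_z (f z * phi z).
    move=> tphi sf fB; rewrite -IntN; last exact: itgM_test tphi (sqi_boxed fB sf).
    by apply: eq_Int => z; rewrite mulNr.
  split=> [|i|i]; first exact/sqi_ext/sqiN.
    by case: ifP => _; apply: sqi_ext => //; exact: sqiN.
  apply: weak_partial_boxed; [exact: sqiN|by case: ifP => // _; exact: sqiN|].
  move=> phi tphi phi0; rewrite N//; last exact: test_fun_derive.
  rewrite /dir; case: ifP => _; last by rewrite vint_partial2// N.
  by rewrite (vint_partial1 sq qB ss sB qs).
have L (f : R * R -> R) (f_ : 'I_2 -> R * R -> R) : W12 Omega f f_ -> sobolev Omega 1 f.
  move=> [sf sf_ wf]; split; first exact/(sqi_L2 oO).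
  by move=> i; exists (f_ i) => //; split=> //; exact/(sqi_L2 oO).
exists Phi; split; last by exists (fun z => - P2 z), P1.
split; first by apply/(sqi_L2 oO); case: wPhi.
move=> i; exists (if i == 0 then fun z => - P2 z else P1); first by case: wPhi.
by case: ifP => _; [exact: L wP2|exact: L wP1].
Qed.

End stress_potential.

                                       

(** * Second-order behaviour at a minimum, and nonnegative forms *)

Section hessian.
Variables (R : realType) (V : normedModType R).
Variables (N : set V) (f : V -> R) (a : V).
Hypotheses (Na : \forall x \near a, N x) (f2 : Ck_on 2 N f).
Implicit Types (x u v w : V).

Definition hess u v : R := 'D_v ('D_u f) a.

Let derf x u : N x -> derivable f x u.
Proof. by move=> Nx; case: f2 => _ /(_ u)[/(_ x Nx)]. Qed.

Let contDf x u : N x -> {for x, continuous ('D_u f)}.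
Proof. by move=> Nx; case: f2 => _ /(_ u)[_ [/(_ x Nx)]]. Qed.

Let derDf x u v : N x -> derivable ('D_u f) x v.
Proof. by move=> Nx; case: f2 => _ /(_ u)[_ [_ /(_ v)[/(_ x Nx)]]]. Qed.

Let contDDf x u v : N x -> {for x, continuous ('D_v ('D_u f))}.
Proof. by move=> Nx; case: f2 => _ /(_ u)[_ [_ /(_ v)[_ [/(_ x Nx)]]]]. Qed.

Let Naa : N a. Proof. exact: nbhs_singleton. Qed.

Lemma derive_scale (g : V -> R) x u (k : R) : derivable g x u ->
  'D_(k *: u) g x = k * 'D_u g x.
Proof.
move=> gd; pose L (s : R) := x + s *: u.
have L0 : L 0 = x by rewrite /L scale0r addr0.
have aff (c h : R) : L (h *: c + 0) = h *: (c *: u) + L 0.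
  by rewrite L0 /L addr0 scalerA addrC.
have aff1 (h : R) : L (h *: 1 + 0) = h *: u + L 0 by rewrite aff scale1r.
rewrite -L0 -(derive_affine g (aff k)) -(derive_affine g aff1).
have dg : differentiable (g \o L) (0 : R).
  by apply/derivable1_diffP; rewrite (derivable_affine g aff1) L0.
rewrite !deriveE//; have -> : 'd (g \o L) (0 : R) k = 'd (g \o L) (0 : R) (k *: 1).
  by congr ('d _ _ _); rewrite -[RHS]/(k * 1) mulr1.
by rewrite linearZ.
Qed.

Lemma hessDr u v w : hess u (v + w) = hess u v + hess u w.
Proof.
apply: (derive_val (is_derive := _)); apply: derive_add.
- by apply: filterS Na => x; exact: derDf.
- exact: contDDf.
- exact: derDf.
Qed.

Lemma hessZr k u v : hess u (k *: v) = k * hess u v.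
Proof. by rewrite /hess derive_scale//; exact: derDf. Qed.

Lemma hessDl u v w : hess (u + v) w = hess u w + hess v w.
Proof.
rewrite /hess (_ : 'D_w ('D_(u + v) f) a = 'D_w ('D_u f \+ 'D_v f) a).
  by rewrite deriveD//; exact: derDf.
apply: near_eq_derive; have := near_join Na; apply: filterS => x Nx.
apply: (derive_val (is_derive := _)); apply: derive_add.
- by apply: filterS Nx => y; exact: derf.
- by apply: contDf; exact: nbhs_singleton Nx.
- by apply: derf; exact: nbhs_singleton Nx.
Qed.

Lemma hessZl k u v : hess (k *: u) v = k * hess u v.
Proof.
rewrite /hess (_ : 'D_v ('D_(k *: u) f) a = 'D_v (k *: 'D_u f) a).
  by rewrite deriveZ//; exact: derDf.
by apply: near_eq_derive; apply: filterS Na => x Nx; rewrite derive_scale//; exact: derf.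
Qed.

Lemma hess_invariant (L : V -> V) (Ll : linear L) : f \o L = f -> L a = a ->
  forall u v, hess (L u) (L v) = hess u v.
Proof.
move=> fL La u v; have aff x w (h : R) : L (h *: w + x) = h *: L w + L x by rewrite Ll.
have E w : 'D_w f = 'D_(L w) f \o L.
  by apply/funext => x; rewrite -{1}fL (derive_affine f (aff x w)).
by rewrite /hess (E u) -{1}La -(derive_affine ('D_(L u) f) (aff a v)).
Qed.

Hypotheses (f_ge0 : forall x, 0 <= f x) (fa : f a = 0).

Let near_derf u : exists2 r : R, 0 < r & forall t, `|t| <= r ->
  is_derive t (1 : R) (fun s : R => f (a + s *: u)) ('D_u f (a + t *: u)).
Proof.
have [r r0 rP] := near_line u Na; exists r => // t tr; apply: is_derive_line.
by apply: derivableP; apply: derf; apply: rP => //; rewrite subrr normr0 ltW.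
Qed.

Lemma derive_min u : 'D_u f a = 0.
Proof.
have [r r0 D] := near_derf u.
have itv0 : (0 : R) \in `](- r), r[ by rewrite in_itv/= oppr_lt0 r0.
have rr : - r <= r by apply: ltW; rewrite (lt_trans _ r0)// oppr_lt0.
have dmin : is_derive (0 : R) (1 : R) (fun s : R => f (a + s *: u)) 0.
  apply: (derive1_at_min rr) => // [t|t _]; last by rewrite scale0r addr0 fa.
  rewrite in_itv/= => /andP[h1 h2]; have [|] := D t => //.
  by rewrite ler_norml !ltW.
have D0 : is_derive (0 : R) (1 : R) (fun s : R => f (a + s *: u)) ('D_u f a).
  by have := D 0; rewrite normr0 scale0r addr0; apply; exact: ltW.
by rewrite -(@derive_val _ _ _ _ _ _ _ D0); exact: (@derive_val _ _ _ _ _ _ _ dmin).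
Qed.

(** Taylor's formula with Peano remainder on a line: the mean value theorem for [f] minus its
    quadratic part, whose derivative is small compared with [s] by the definition of the second
    derivative and [derive_min]. *)
Lemma taylor2 u (e : R) : 0 < e -> exists2 r : R, 0 < r & forall t, `|t| <= r ->
  `|f (a + t *: u) - hess u u / 2 * t ^+ 2| <= e * t ^+ 2.
Proof.
have pos w : 0 < e -> exists2 r : R, 0 < r & forall t, 0 <= t <= r ->
    `|f (a + t *: w) - hess w w / 2 * t ^+ 2| <= e * t ^+ 2.
  move=> e0; have [r1 r10 D] := near_derf w; set H := hess w w.
  have /cvgrPdist_le/(_ e e0) : h^-1 *: ('D_w f (h *: w + a) - 'D_w f a) @[h --> (0 : R)^'] --> H.
    exact: (derDf (u := w) (v := w) Naa).
  move=> [r2 /= r20 r2P]; pose r := Num.min r1 (r2 / 2).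
  have r0 : 0 < r by rewrite lt_min r10 divr_gt0.
  have [rr1 rr2] : r <= r1 /\ r < r2.
    split; first by rewrite ge_min lexx.
    by rewrite (@le_lt_trans _ _ (r2 / 2)) ?ge_min ?lexx ?orbT// ltr_pdivrMr// ltr_pMr// ltr1n.
  exists r => // t /andP[]; rewrite le_eqVlt => /predU1P[<- _|t0 tr].
    by rewrite scale0r addr0 fa expr0n !mulr0 subrr normr0.
  pose g (s : R) : R := f (a + s *: w) - H / 2 * s ^+ 2.
  have Dg s : `|s| <= r -> is_derive s (1 : R) g ('D_w f (a + s *: w) - H * s).
    move=> sr; have Df := D s (le_trans sr rr1).
    have Dq : is_derive s (1 : R) (fun s : R => H / 2 * s ^+ 2) (H * s).
      by apply: is_derive_eq; rewrite -[LHS]/(H / 2 * (s * 1 + s * 1)); field.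
    exact: is_deriveB.
  have [s||s] := @MVT R g (fun s => 'D_w f (a + s *: w) - H * s) 0 t t0.
  - by rewrite in_itv/= => /andP[s0 st]; apply: Dg; rewrite gtr0_norm// (le_trans (ltW st)).
  - apply: derivable_within_continuous => s; rewrite in_itv/= => /andP[s0 st].
    by have [|] := Dg s => //; rewrite ger0_norm// (le_trans st).
  rewrite in_itv/= => /andP[s0 st]; rewrite /g scale0r addr0 fa expr0n mulr0 !subr0 => ->.
  have := r2P s; rewrite /ball_/= sub0r normrN gtr0_norm// => /(_ (lt_trans st (le_lt_trans tr rr2))).
  rewrite gt_eqF// => /(_ isT); rewrite derive_min subr0 [s *: w + a]addrC => Hs.
  rewrite normrM (gtr0_norm t0) expr2 mulrA ler_wpM2r ?(ltW t0)//.
  apply: (@le_trans _ _ (e * s)); last by rewrite ler_wpM2l ?ltW.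
  rewrite (_ : _ - _ = - (s * (H - s^-1 *: 'D_w f (a + s *: w)))).
    by rewrite normrN normrM (gtr0_norm s0) [e * s]mulrC ler_wpM2l// ltW.
  by rewrite -[s^-1 *: _]/(s^-1 * _); field; rewrite gt_eqF.
move=> e0; have [r1 r10 H1] := pos u e0; have [r2 r20 H2] := pos (- u) e0.
exists (Num.min r1 r2); first by rewrite lt_min r10.
move=> t; rewrite le_min => /andP[tr1 tr2]; have [t0|t0] := leP 0 t.
  by apply: H1; rewrite t0 -(ger0_norm t0).
have := H2 (- t); rewrite sqrrN scaleNr scalerN opprK.
have -> : hess (- u) (- u) = hess u u.
  by rewrite -(scaleN1r u) hessZl hessZr !mulN1r opprK.
apply.
by rewrite oppr_ge0 ltW// -(ltr0_norm t0).
Qed.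

Lemma hess_ge0 u : 0 <= hess u u.
Proof.
rewrite leNgt; apply/negP => H.
have e0 : 0 < - hess u u / 4 by rewrite divr_gt0// oppr_gt0.
have [r r0 /(_ r)] := taylor2 u e0; rewrite gtr0_norm// => /(_ (lexx _)).
have := f_ge0 (a + r *: u); have : 0 < r ^+ 2 by rewrite exprn_gt0.
rewrite ler_norml => r2 f0 /andP[_]; nra.
Qed.

End hessian.

Section positive_forms.
Variables (R : realType) (V : lmodType R) (b : V -> V -> R).
Implicit Types (u v w : V) (k : R).
Hypotheses (bDl : forall u v w, b (u + v) w = b u w + b v w)
  (bDr : forall u v w, b u (v + w) = b u v + b u w)
  (bZl : forall k u v, b (k *: u) v = k * b u v)
  (bZr : forall k u v, b u (k *: v) = k * b u v)
  (b_ge0 : forall u, 0 <= b u u).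

(** Nonnegativity at [u + k v] reads [k^2 b v v + k s >= 0] for all [k], which forces the linear
    coefficient [s] to vanish. *)
Lemma form_kernel u v : b u u = 0 -> b u v + b v u = 0.
Proof.
move=> u0; set s := b u v + b v u; have v0 := b_ge0 v.
have H k : 0 <= k ^+ 2 * b v v + k * s.
  have := b_ge0 (u + k *: v).
  rewrite bDl !bDr !bZl !bZr u0 add0r.
  by rewrite (_ : _ + _ = k ^+ 2 * b v v + k * s)// /s; ring.
have p : 0 < 1 + b v v by rewrite ltr_pwDl.
(* This value of [k] turns the expression into minus a square; the 1 keeps the denominator
   positive. *)
have := H (- s / (1 + b v v)); rewrite (_ : _ + _ = - (s / (1 + b v v)) ^+ 2); last first.
  by field; rewrite gt_eqF.
rewrite oppr_ge0 => H0.
have : (s / (1 + b v v)) ^+ 2 == 0 by rewrite eq_le H0 sqr_ge0.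
rewrite sqrf_eq0 mulf_eq0 invr_eq0 => /orP[/eqP//|/eqP E].
by move: p; rewrite E ltxx.
Qed.

End positive_forms.

(** * Isotropic quadratic forms on 3 by 3 matrices *)

Section matrices3.
Variable R : realType.
Implicit Types (F Q u v : 'M[R]_3).

(** Entries in row-major order, so that matrix identities split into nine identities for [ring]. *)
Definition mx3 (a b c d e f g h k : R) : 'M[R]_3 :=
  \matrix_(i, j) nth 0 [:: a; b; c; d; e; f; g; h; k] (i * 3 + j)%N.

Let o0 : 'I_3 := @Ordinal 3 0 isT.
Let o1 : 'I_3 := @Ordinal 3 1 isT.
Let o2 : 'I_3 := @Ordinal 3 2 isT.

Lemma forall_ord3 (P : 'I_3 -> Prop) : P o0 -> P o1 -> P o2 -> forall i, P i.
Proof.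
move=> p0 p1 p2 [[|[|[|//]]] im]; first by have -> : Ordinal im = o0 by exact: val_inj.
  by have -> : Ordinal im = o1 by exact: val_inj.
by have -> : Ordinal im = o2 by exact: val_inj.
Qed.

Lemma sum_ord3 (x : 'I_3 -> R) : \sum_i x i = x o0 + x o1 + x o2.
Proof.
rewrite !big_ord_recl big_ord0 addr0 addrA.
by congr (x _ + x _ + x _); exact: val_inj.
Qed.

Lemma mx3P F : F = mx3 (F o0 o0) (F o0 o1) (F o0 o2) (F o1 o0) (F o1 o1) (F o1 o2)
  (F o2 o0) (F o2 o1) (F o2 o2).
Proof. by apply/matrixP; apply: forall_ord3; apply: forall_ord3; rewrite mxE. Qed.

Lemma mx3D a b c d e f g h k a' b' c' d' e' f' g' h' k' :
  mx3 a b c d e f g h k + mx3 a' b' c' d' e' f' g' h' k' =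
  mx3 (a + a') (b + b') (c + c') (d + d') (e + e') (f + f') (g + g') (h + h') (k + k').
Proof. by apply/matrixP; apply: forall_ord3; apply: forall_ord3; rewrite !mxE. Qed.

Lemma mx3Z x a b c d e f g h k : x *: mx3 a b c d e f g h k =
  mx3 (x * a) (x * b) (x * c) (x * d) (x * e) (x * f) (x * g) (x * h) (x * k).
Proof. by apply/matrixP; apply: forall_ord3; apply: forall_ord3; rewrite !mxE. Qed.

Lemma mx3_tr a b c d e f g h k : (mx3 a b c d e f g h k)^T = mx3 a d g b e h c f k.
Proof. by apply/matrixP; apply: forall_ord3; apply: forall_ord3; rewrite !mxE. Qed.

Lemma mx3M a b c d e f g h k a' b' c' d' e' f' g' h' k' :
  mx3 a b c d e f g h k *m mx3 a' b' c' d' e' f' g' h' k' =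
  mx3 (a * a' + b * d' + c * g') (a * b' + b * e' + c * h') (a * c' + b * f' + c * k')
      (d * a' + e * d' + f * g') (d * b' + e * e' + f * h') (d * c' + e * f' + f * k')
      (g * a' + h * d' + k * g') (g * b' + h * e' + k * h') (g * c' + h * f' + k * k').
Proof.
by apply/matrixP; apply: forall_ord3; apply: forall_ord3; rewrite mxE sum_ord3 !mxE.
Qed.

Lemma mx3_1 : 1%:M = mx3 1 0 0 0 1 0 0 0 1.
Proof. by apply/matrixP; apply: forall_ord3; apply: forall_ord3; rewrite !mxE. Qed.

Lemma mxtrace3 a b c d e f g h k : \tr (mx3 a b c d e f g h k) = a + e + k.
Proof. by rewrite /mxtrace sum_ord3 !mxE. Qed.

Lemma det_mx3 a b c d e f g h k : \det (mx3 a b c d e f g h k) =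
  a * (e * k - f * h) - b * (d * k - f * g) + c * (d * h - e * g).
Proof.
rewrite (expand_det_row _ o0) sum_ord3 !mxE /cofactor/=.
rewrite !(expand_det_row _ ord0) !big_ord_recl !big_ord0 /cofactor !det_mx11 !mxE /=.
rewrite /bump /= !addn0 !add0n /=; ring.
Qed.

Lemma inner_mx3 a b c d e f g h k a' b' c' d' e' f' g' h' k' :
  inner (mx3 a b c d e f g h k) (mx3 a' b' c' d' e' f' g' h' k') =
  a * a' + b * b' + c * c' + d * d' + e * e' + f * f' + g * g' + h * h' + k * k'.
Proof. by rewrite /inner !sum_ord3 !mxE /= !addrA. Qed.

Lemma sqr_frob n (A : 'M[R]_n) : frob A ^+ 2 = inner A A.
Proof.
rewrite /frob sqr_sqrtr// /inner; apply: sumr_ge0 => i _; apply: sumr_ge0 => j _.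
by rewrite -expr2 sqr_ge0.
Qed.

Lemma sym_mx3 a b c d e f g h k : sym (mx3 a b c d e f g h k) =
  mx3 a ((b + d) / 2) ((c + g) / 2) ((b + d) / 2) e ((f + h) / 2) ((c + g) / 2) ((f + h) / 2) k.
Proof. by rewrite /sym mx3_tr mx3D mx3Z; congr mx3; field. Qed.

Lemma SO3_mx3 a b c d e f g h k :
  a * a + d * d + g * g = 1 -> b * b + e * e + h * h = 1 -> c * c + f * f + k * k = 1 ->
  a * b + d * e + g * h = 0 -> a * c + d * f + g * k = 0 -> b * c + e * f + h * k = 0 ->
  a * (e * k - f * h) - b * (d * k - f * g) + c * (d * h - e * g) = 1 ->
  SO3 (mx3 a b c d e f g h k).
Proof.
move=> aa bb cc ab ac bc det1; split; last by rewrite det_mx3.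
rewrite mx3_tr mx3M mx3_1 aa bb cc ab ac bc.
by rewrite [b * a]mulrC [e * d]mulrC [h * g]mulrC ab [c * a]mulrC [f * d]mulrC [k * g]mulrC ac
  [c * b]mulrC [f * e]mulrC [k * h]mulrC bc.
Qed.

Section isotropic_forms.
Variable b : 'M[R]_3 -> 'M[R]_3 -> R.
Hypotheses (bDl : forall u v w, b (u + v) w = b u w + b v w)
  (bDr : forall u v w, b u (v + w) = b u v + b u w)
  (bZl : forall k u v, b (k *: u) v = k * b u v)
  (bZr : forall k u v, b u (k *: v) = k * b u v)
  (b_ge0 : forall u, 0 <= b u u)
  (bJ : forall Q u v, SO3 Q -> b (Q *m u *m Q^T) (Q *m v *m Q^T) = b u v)
  (b_rot : b (mx3 0 1 0 (-1) 0 0 0 0 0) (mx3 0 1 0 (-1) 0 0 0 0 0) = 0).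

(** A symmetric form with [b F F = c F F / 2]. *)
Let c u v := b u v + b v u.
Let cC u v : c u v = c v u. Proof. by rewrite /c addrC. Qed.
Let cDl u v w : c (u + v) w = c u w + c v w. Proof. by rewrite /c bDl bDr; ring. Qed.
Let cZl k u v : c (k *: u) v = k * c u v. Proof. by rewrite /c bZl bZr; ring. Qed.
Let cDr u v w : c u (v + w) = c u v + c u w. Proof. by rewrite /c bDl bDr; ring. Qed.
Let cZr k u v : c u (k *: v) = k * c u v. Proof. by rewrite /c bZl bZr; ring. Qed.
Let cJ Q u v : SO3 Q -> c (Q *m u *m Q^T) (Q *m v *m Q^T) = c u v.
Proof. by move=> QS; rewrite /c !bJ. Qed.

Let E1 := mx3 1 0 0 0 0 0 0 0 0.
Let E2 := mx3 0 0 0 0 1 0 0 0 0.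
Let E3 := mx3 0 0 0 0 0 0 0 0 1.
Let S12 := mx3 0 1 0 1 0 0 0 0 0.
Let S23 := mx3 0 0 0 0 0 1 0 1 0.
Let S31 := mx3 0 0 1 0 0 0 1 0 0.
Let A12 := mx3 0 1 0 (-1) 0 0 0 0 0.
Let A23 := mx3 0 0 0 0 0 1 0 (-1) 0.
Let A31 := mx3 0 0 (-1) 0 0 0 1 0 0.

(** The rotations exploited: the cyclic permutation of the axes here, the half turns about the first
    and second axes below, and a rotation by 45 degrees in [cSd]. *)
Let cyc := mx3 0 0 1 1 0 0 0 1 0.
Let cycS : SO3 cyc. Proof. by apply: SO3_mx3; ring. Qed.
Let flip1 := mx3 1 0 0 0 (-1) 0 0 0 (-1).
Let flip1S : SO3 flip1. Proof. by apply: SO3_mx3; ring. Qed.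
Let flip2 := mx3 (-1) 0 0 0 1 0 0 0 (-1).
Let flip2S : SO3 flip2. Proof. by apply: SO3_mx3; ring. Qed.

Ltac conj_mx3 := by rewrite ?mx3Z mx3_tr !mx3M; congr mx3; ring.

Let cycE : [/\ cyc *m E1 *m cyc^T = E2, cyc *m E2 *m cyc^T = E3 & cyc *m E3 *m cyc^T = E1].
Proof. by split; conj_mx3. Qed.
Let cycSS : [/\ cyc *m S12 *m cyc^T = S23 & cyc *m S23 *m cyc^T = S31].
Proof. by split; conj_mx3. Qed.
Let cycA : [/\ cyc *m A12 *m cyc^T = A23 & cyc *m A23 *m cyc^T = A31].
Proof. by split; conj_mx3. Qed.

Let flip1E : [/\ flip1 *m E1 *m flip1^T = E1, flip1 *m E2 *m flip1^T = E2 & flip1 *m E3 *m flip1^T = E3].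
Proof. by split; conj_mx3. Qed.
Let flip2E : [/\ flip2 *m E1 *m flip2^T = E1, flip2 *m E2 *m flip2^T = E2 & flip2 *m E3 *m flip2^T = E3].
Proof. by split; conj_mx3. Qed.
Let flip1SS : [/\ flip1 *m S12 *m flip1^T = (-1) *: S12, flip1 *m S31 *m flip1^T = (-1) *: S31 &
  flip1 *m S23 *m flip1^T = S23].
Proof. by split; conj_mx3. Qed.
Let flip2SS : [/\ flip2 *m S12 *m flip2^T = (-1) *: S12, flip2 *m S23 *m flip2^T = (-1) *: S23 &
  flip2 *m S31 *m flip2^T = S31].
Proof. by split; conj_mx3. Qed.

(** Invariance gives [c u v = - c u v]; this makes shears orthogonal to stretches and to each
    other. *)
Let flip_eq0 Q u v : SO3 Q -> Q *m u *m Q^T = u -> Q *m v *m Q^T = (-1) *: v -> c u v = 0.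
Proof. by move=> QS uE vE; have := cJ u v QS; rewrite uE vE cZr; lra. Qed.

Let cE1S : [/\ c E1 S12 = 0, c E1 S23 = 0 & c E1 S31 = 0].
Proof.
case: flip1E flip2E flip1SS flip2SS => [? ? ?] [? ? ?] [? ? ?] [? ? ?].
by split; first [exact: (flip_eq0 flip1S)|exact: (flip_eq0 flip2S)].
Qed.
Let cE2S : [/\ c E2 S12 = 0, c E2 S23 = 0 & c E2 S31 = 0].
Proof.
case: flip1E flip2E flip1SS flip2SS => [? ? ?] [? ? ?] [? ? ?] [? ? ?].
by split; first [exact: (flip_eq0 flip1S)|exact: (flip_eq0 flip2S)].
Qed.
Let cE3S : [/\ c E3 S12 = 0, c E3 S23 = 0 & c E3 S31 = 0].
Proof.
case: flip1E flip2E flip1SS flip2SS => [? ? ?] [? ? ?] [? ? ?] [? ? ?].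
by split; first [exact: (flip_eq0 flip1S)|exact: (flip_eq0 flip2S)].
Qed.
Let cSS : [/\ c S23 S12 = 0, c S23 S31 = 0 & c S31 S12 = 0].
Proof.
case: flip1SS flip2SS => [? ? ?] [? ? ?].
by split; first [exact: (flip_eq0 flip1S)|exact: (flip_eq0 flip2S)].
Qed.

Let cEE : [/\ c E2 E2 = c E1 E1, c E3 E3 = c E1 E1, c E2 E3 = c E1 E2 & c E1 E3 = c E1 E2].
Proof.
have [e1 e2 e3] := cycE; have H u v := cJ u v cycS.
have := H E1 E1; have := H E2 E2; have := H E1 E2; have := H E2 E3.
rewrite e1 e2 e3 => h1 h2 h3 h4; split=> //; first by rewrite h3.
by rewrite cC h1.
Qed.

(** Rotating by 45 degrees about the third axis carries [E1 - E2] to the shear [S12], which ties the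
    shear modulus to the stretches and leaves two constants. *)
Let cSd : [/\ c S12 S12 = 2 * (c E1 E1 - c E1 E2), c S23 S23 = c S12 S12 & c S31 S31 = c S12 S12].
Proof.
have [e1 e2] := cycSS; have H u v := cJ u v cycS.
have := H S12 S12; have := H S23 S23; rewrite e1 e2 => h1 h2.
split=> //; last by rewrite h1.
pose r : R := Num.sqrt (2^-1); have r2 : r * r = 2^-1.
  by rewrite -expr2 sqr_sqrtr// invr_ge0.
pose Q := mx3 r (- r) 0 r r 0 0 0 1.
have QS : SO3 Q by apply: SO3_mx3; lra.
have QE : Q *m (E1 + (-1) *: E2) *m Q^T = S12.
  by rewrite mx3Z mx3D mx3_tr !mx3M; congr mx3; lra.
have [cE _ _ _] := cEE.
rewrite -{1 2}QE cJ// !cDl !cDr !cZl !cZr cE [c E2 E1]cC; ring.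
Qed.

Let c_skew v : [/\ c A12 v = 0, c A23 v = 0 & c A31 v = 0].
Proof.
have [a1 a2] := cycA; have b2 : b A23 A23 = 0 by rewrite -a1 bJ.
have b3 : b A31 A31 = 0 by rewrite -a2 bJ.
by split; apply: form_kernel.
Qed.

(** In the basis of stretches [E], shears [S] and skew matrices [A], the skew part lies in the
    kernel, shears decouple, and everything is expressed by [c E1 E1] and [c E1 E2]. The sign of
    [mu] is nonnegativity at [E1 - E2]. *)
Lemma isotropic_form : exists mu lambda : R, 0 <= mu /\
  forall F, b F F = 2 * mu * frob (sym F) ^+ 2 + lambda * `|\tr F| ^+ 2.
Proof.
exists ((c E1 E1 - c E1 E2) / 4), (c E1 E2 / 2); split.
  have := b_ge0 (E1 + (-1) *: E2); have [cE _ _ _] := cEE.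
  have -> : b (E1 + (-1) *: E2) (E1 + (-1) *: E2) = c (E1 + (-1) *: E2) (E1 + (-1) *: E2) / 2.
    by rewrite /c; field.
  rewrite !cDl !cDr !cZl !cZr cE [c E2 E1]cC; lra.
move=> F; rewrite real_normK ?num_real// sqr_frob.
have -> : b F F = c F F / 2 by rewrite /c; field.
rewrite [F]mx3P; move: (F _ _) (F _ _) (F _ _) (F _ _) (F _ _) (F _ _) (F _ _) (F _ _) (F _ _).
move=> f9 f8 f7 f6 f5 f4 f3 f2 f1.
rewrite mxtrace3 sym_mx3 inner_mx3.
pose S : 'M[R]_3 := f1 *: E1 + f5 *: E2 + f9 *: E3 + ((f2 + f4) / 2) *: S12 + ((f6 + f8) / 2) *: S23
  + ((f3 + f7) / 2) *: S31.
pose K : 'M[R]_3 := ((f2 - f4) / 2) *: A12 + ((f6 - f8) / 2) *: A23 + ((f7 - f3) / 2) *: A31.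
have -> : mx3 f1 f2 f3 f4 f5 f6 f7 f8 f9 = S + K.
  by rewrite /S /K !mx3Z !mx3D; congr mx3; field.
have cK v : c K v = 0.
  by have [a1 a2 a3] := c_skew v; rewrite /K !cDl !cZl a1 a2 a3; ring.
rewrite cDl cK addr0 cDr [c S K]cC cK addr0.
have [e1 e2 e3] := cE1S; have [e4 e5 e6] := cE2S; have [e7 e8 e9] := cE3S.
have [s1 s2 s3] := cSS; have [d1 d2 d3 d4] := cEE; have [t1 t2 t3] := cSd.
rewrite /S !cDl !cDr !cZl !cZr.
rewrite [c E2 E1]cC [c E3 E1]cC [c E3 E2]cC [c S12 E1]cC [c S12 E2]cC [c S12 E3]cC
  [c S23 E1]cC [c S23 E2]cC [c S23 E3]cC [c S31 E1]cC [c S31 E2]cC [c S31 E3]cC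
  [c S12 S23]cC [c S31 S23]cC [c S12 S31]cC.
rewrite e1 e2 e3 e4 e5 e6 e7 e8 e9 s1 s2 s3 d1 d2 d3 d4 t2 t3 t1; by field.
Qed.

End isotropic_forms.
End matrices3.

(** * The quadratic forms of the density *)

Section density.
Variables (R : realType) (W : 'M[R]_3 -> R).
Hypotheses (W_ge0 : forall F, 0 <= W F)
  (W_frame : forall Q F, SO3 Q -> W (Q *m F) = W F)
  (W_id : W 1%:M = 0)
  (W_C2 : exists2 delta : R, 0 < delta &
            Ck_on 2 [set F : 'M[R]_3 | dist_SO3 F < delta] W)
  (W_isotropic : forall F Q, SO3 Q -> W (F *m Q) = W F).

Lemma SO3_1 : SO3 (1%:M : 'M[R]_3).
Proof. by split; rewrite ?det1// trmx1 mulmx1. Qed.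

Lemma SO3_tr (Q : 'M[R]_3) : SO3 Q -> SO3 Q^T.
Proof. by move=> [QQ dQ]; split; [rewrite trmxK; exact: mulmx1C|rewrite det_tr]. Qed.

Lemma dist_SO3_near (delta : R) : 0 < delta ->
  \forall F \near (1%:M : 'M[R]_3), [set F | dist_SO3 F < delta] F.
Proof.
move=> d0; have d4 : 0 < delta / 4 by rewrite divr_gt0.
exists (fun i j => ball ((1%:M : 'M[R]_3) i j) (delta / 4)).
  by move=> i j; exact: nbhsx_ballx.
move=> F /= F1; apply: (@le_lt_trans _ _ (frob (F - 1%:M))).
  apply: ge_inf; first by exists 0 => _ [Q _ <-]; exact: sqrtr_ge0.
  by exists 1%:M => //; exact: SO3_1.
apply: (@le_lt_trans _ _ (3 * (delta / 4))); last by lra.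
have r0 : 0 <= 3 * (delta / 4) by rewrite mulr_ge0// ltW.
have f0 : 0 <= frob (F - 1%:M) by exact: sqrtr_ge0.
suff : frob (F - 1%:M) ^+ 2 <= (3 * (delta / 4)) ^+ 2 by rewrite ler_sqr ?nnegrE.
rewrite sqr_frob.
apply: (@le_trans _ _ (\sum_(i < 3) \sum_(j < 3) (delta / 4) ^+ 2)).
  apply: ler_sum => i _; apply: ler_sum => j _; rewrite -expr2 -(real_normK (num_real _)).
  rewrite lerXn2r ?nnegrE ?(ltW d4)//; have := F1 i j.
  by rewrite /ball/= distrC => /ltW; rewrite !mxE.
by rewrite !sum_ord3; lra.
Qed.

                                                                             
                                                                                 
(** Polar decomposition: [1 + t A] is a rotation times the stretch of the first two axes by
    [sqrt (1 + t^2)], and [W] ignores the rotation. *)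
Lemma W_rotation_generator (t : R) :
  W (1%:M + t *: mx3 0 1 0 (-1) 0 0 0 0 0) =
  W (1%:M + (Num.sqrt (1 + t ^+ 2) - 1) *: mx3 1 0 0 0 1 0 0 0 0).
Proof.
set s := Num.sqrt _; have s2 : s ^+ 2 = 1 + t ^+ 2.
  by rewrite sqr_sqrtr// addr_ge0// sqr_ge0.
have s0 : 0 < s by rewrite sqrtr_gt0 ltr_pwDl// sqr_ge0.
have sn : s != 0 by rewrite gt_eqF.
pose Q := mx3 s^-1 (t / s) 0 (- t / s) s^-1 0 0 0 1.
have ss : s^-1 * s^-1 * (1 + t ^+ 2) = 1 by rewrite -s2; field.
have QS : SO3 Q by apply: SO3_mx3; move: ss; rewrite ?mulNr; set r := s^-1; lra.
rewrite -[RHS](W_frame _ QS); congr W.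
rewrite mx3_1 !mx3Z !mx3D mx3M; congr mx3; by field.
Qed.

Definition W_hess := hess W 1%:M.

Let hessP : exists N, [/\ \forall x \near (1%:M : 'M[R]_3), N x & Ck_on 2 N W].
Proof. by have [d d0 WN] := W_C2; exists [set F | dist_SO3 F < d]; split => //; exact: dist_SO3_near. Qed.

(** The stretch in [W_rotation_generator] differs from the identity by at most [t^2] along [D], so
    [W (1 + t A)] is of order [t^4], whereas a positive second derivative along [A] would make it at
    least a multiple of [t^2]. *)
Lemma W_hess_rotation_generator :
  W_hess (mx3 0 1 0 (-1) 0 0 0 0 0) (mx3 0 1 0 (-1) 0 0 0 0 0) = 0.
Proof.
have [N [N1 N2]] := hessP; set A := mx3 0 1 0 (-1) 0 0 0 0 0; pose D : 'M[R]_3 := mx3 1 0 0 0 1 0 0 0 0.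
have HA0 : 0 <= W_hess A A by exact: (hess_ge0 N1).
have HD0 : 0 <= W_hess D D by exact: (hess_ge0 N1).
set H := W_hess A A in HA0 *; set h := W_hess D D in HD0.
apply/eqP; rewrite eq_le HA0 andbT leNgt; apply/negP => H0.
have [r1 r10 T1] := taylor2 N1 N2 W_ge0 W_id D (@ltr01 R).
have e0 : 0 < H / 4 by rewrite divr_gt0.
have [r2 r20 T2] := taylor2 N1 N2 W_ge0 W_id A e0.
have {}T1 : forall t : R, `|t| <= r1 -> `|W (1%:M + t *: D) - h / 2 * t ^+ 2| <= 1 * t ^+ 2 := T1.
have {}T2 : forall t : R, `|t| <= r2 -> `|W (1%:M + t *: A) - H / 2 * t ^+ 2| <= H / 4 * t ^+ 2 := T2.
clearbody h H.
have k0 : 0 < h + 2 by rewrite ltr_wpDl.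
(* For [t] below [r3] and 1 the upper bound [(h / 2 + 1) t^4] is less than the lower bound
   [(H / 4) t^2]. *)
pose r3 := H / (h + 2) / 4.
have r30 : 0 < r3 by rewrite !divr_gt0.
pose t := Num.min (Num.min r1 1) (Num.min r2 (Num.min r3 1)).
have t0 : 0 < t by rewrite !lt_min r10 r20 r30 !ltr01.
have t1 : t <= r1 by rewrite !ge_min lexx.
have tl : t <= 1 by rewrite !ge_min lexx !orbT.
have t2 : t <= r2 by rewrite !ge_min lexx !orbT.
have t3 : t <= r3 by rewrite !ge_min lexx !orbT.
have := T2 t; rewrite gtr0_norm// => /(_ t2); rewrite W_rotation_generator -/D.
set s := Num.sqrt _; have s2 : s ^+ 2 = 1 + t ^+ 2.
  by rewrite sqr_sqrtr// addr_ge0// sqr_ge0.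
have s1 : 1 <= s by rewrite -[leLHS]sqrtr1 ler_wsqrtr// lerDl sqr_ge0.
have u0 : 0 <= s - 1 by rewrite subr_ge0.
have ut : s - 1 <= t ^+ 2 by have := s2; nra.
have tt : t ^+ 2 <= t by rewrite expr2 ger_pMl.
have := T1 (s - 1); rewrite ger0_norm// => /(_ (le_trans ut (le_trans tt t1))).
rewrite !ler_norml => /andP[_ w1] /andP[w2 _].
have r3E : r3 * (h + 2) * 4 = H by rewrite /r3; field; rewrite gt_eqF.
set w := W _ in w1 w2.
have a1 : w <= (h / 2 + 1) * (s - 1) ^+ 2 by lra.
have a2 : (s - 1) ^+ 2 <= t ^+ 2 * t ^+ 2 by rewrite -expr2 lerXn2r ?nnegrE ?sqr_ge0.
have a3 : w <= (h / 2 + 1) * (t ^+ 2 * t ^+ 2).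
  by rewrite (le_trans a1)// ler_wpM2l//; lra.
have tt0 : 0 < t ^+ 2 by rewrite exprn_gt0.
have a4 : H / 4 * t ^+ 2 <= (h / 2 + 1) * (t ^+ 2 * t ^+ 2) by lra.
have a5 : H / 4 <= (h / 2 + 1) * t ^+ 2 by rewrite -(ler_pM2r tt0) -[leRHS]mulrA.
have a6 : H / 4 <= (h / 2 + 1) * r3.
  rewrite (le_trans a5)// ler_wpM2l//; last exact: le_trans tt t3.
  by lra.
by move: a6 r3E; lra.
Qed.

Lemma Q3_isotropic : exists mu lambda : R, 0 <= mu /\
  forall F, Q3 W F = 2 * mu * frob (sym F) ^+ 2 + lambda * `|\tr F| ^+ 2.
Proof.
have [N [N1 N2]] := hessP; apply: (@isotropic_form _ W_hess).
- by move=> u v w; exact: (hessDl N1 N2).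
- by move=> u v w; exact: (hessDr N1 N2).
- by move=> k u v; exact: (hessZl N1 N2).
- by move=> k u v; exact: (hessZr N1 N2).
- by move=> u; exact: (hess_ge0 N1 N2 W_ge0 W_id).
- move=> Q u v QS; apply: (@hess_invariant _ _ _ _ (fun F => Q *m F *m Q^T)).
  + by move=> k x y; rewrite mulmxDr mulmxDl -scalemxAr -scalemxAl.
  + apply/funext => F /=; rewrite W_isotropic; last exact: SO3_tr.
    exact: W_frame.
  + by rewrite mulmx1; have [QQ _] := SO3_tr QS; move: QQ; rewrite trmxK.
- exact: W_hess_rotation_generator.
Qed.

(** This is [|sym F|^2 + (tr F)^2] in terms of entries. *)
Definition normQ2 (F : 'M[R]_2) : R :=
  F 0 0 ^+ 2 + F 1 1 ^+ 2 + 2^-1 * (F 0 1 + F 1 0) ^+ 2 + (F 0 0 + F 1 1) ^+ 2.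

(** On trace-free extensions the [lambda] term disappears and the corner entry is [- tr F], which
    accounts for the squared trace; the other out-of-plane entries only add squares and are optimal
    at zero. *)
Lemma Q2In_isotropic (mu lambda : R) (F : 'M[R]_2) : 0 <= mu ->
  (forall F, Q3 W F = 2 * mu * frob (sym F) ^+ 2 + lambda * `|\tr F| ^+ 2) ->
  Q2In W F = 2 * mu * normQ2 F.
Proof.
move=> mu0 Q3E.
have Q3m a b c d e f g h k : a + e + k = 0 -> Q3 W (mx3 a b c d e f g h k) =
    2 * mu * (a ^+ 2 + e ^+ 2 + 2^-1 * (b + d) ^+ 2 + (a + e) ^+ 2 +
              2^-1 * (c + g) ^+ 2 + 2^-1 * (f + h) ^+ 2).
  move=> t0; rewrite Q3E mxtrace3 t0 normr0 expr0n mulr0 addr0 sym_mx3 sqr_frob inner_mx3.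
  by have -> : k = - (a + e) by [lra]; field.
have minE a b c d e f g h k : minor22 (mx3 a b c d e f g h k) = F ->
    [/\ F 0 0 = a, F 0 1 = b, F 1 0 = d & F 1 1 = e].
  by move=> <-; split; rewrite !mxE.
apply/eqP; rewrite eq_le; apply/andP; split.
  pose Ft := mx3 (F 0 0) (F 0 1) 0 (F 1 0) (F 1 1) 0 0 0 (- (F 0 0 + F 1 1)).
  have -> : 2 * mu * normQ2 F = Q3 W Ft.
    by rewrite Q3m ?subrr// /normQ2; field.
  apply: ge_inf.
    exists 0 => _ [G [_ trG] <-]; rewrite Q3E trG normr0 expr0n mulr0 addr0.
    by rewrite mulr_ge0 ?sqr_ge0// mulr_ge0.
  exists Ft => //; split; last by rewrite mxtrace3 subrr.
  apply/matrixP => i j; rewrite !mxE.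
  case: i => [[|[|//]] i2]; case: j => [[|[|//]] j2]; rewrite /=;
    by congr (F _ _); exact: val_inj.
apply: lb_le_inf.
  exists (Q3 W (mx3 (F 0 0) (F 0 1) 0 (F 1 0) (F 1 1) 0 0 0 (- (F 0 0 + F 1 1)))).
  exists (mx3 (F 0 0) (F 0 1) 0 (F 1 0) (F 1 1) 0 0 0 (- (F 0 0 + F 1 1))) => //.
  split; last by rewrite mxtrace3 subrr.
  apply/matrixP => i j; rewrite !mxE.
  case: i => [[|[|//]] i2]; case: j => [[|[|//]] j2]; rewrite /=;
    by congr (F _ _); exact: val_inj.
move=> _ [G [GF trG] <-]; move: GF trG; rewrite [G]mx3P.
move: (G _ _) (G _ _) (G _ _) (G _ _) (G _ _) (G _ _) (G _ _) (G _ _) (G _ _).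
move=> k h g f e d c b a /minE[Fa Fb Fd Fe]; rewrite mxtrace3 => t0.
rewrite (Q3m _ _ _ _ _ _ _ _ _ t0) ler_wpM2l ?mulr_ge0// /normQ2 Fa Fb Fd Fe.
have := sqr_ge0 (c + g); have := sqr_ge0 (f + h); lra.
Qed.

End density.

                                           

(** * The first variation of the energy *)

Section quadratic_energy.
Context d (T : measurableType d) (R : realType).
Variable m : {measure set T -> \bar R}.
Local Notation itg f := (m.-integrable [set: T] (EFin \o f)).
Local Notation sqi f := (sqi m f).
Implicit Types (a b c f g : T -> R).

(** [normQ2] as a function of the diagonal entries [a], [b] and of the sum [c] of the two
    off-diagonal ones. *)
Definition qform (a b c : R) : R := a ^+ 2 + b ^+ 2 + 2^-1 * c ^+ 2 + (a + b) ^+ 2.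

Definition qpolar (a b c a' b' c' : R) : R :=
  a * a' + b * b' + 2^-1 * (c * c') + (a + b) * (a' + b').

Lemma qform_ge0 (a b c : R) : 0 <= qform a b c.
Proof. by rewrite /qform !addr_ge0 ?sqr_ge0// mulr_ge0// sqr_ge0. Qed.

Lemma itg_qpolar a b c a' b' c' : sqi a -> sqi b -> sqi c -> sqi a' -> sqi b' -> sqi c' ->
  itg (fun x => qpolar (a x) (b x) (c x) (a' x) (b' x) (c' x)).
Proof.
move=> sa sb sc sa' sb' sc'; apply: itgD; last exact: sqiM (sqiD sa sb) (sqiD sa' sb').
apply: itgD; last exact: itgZ (sqiM sc sc').
by apply: itgD; exact: sqiM.
Qed.

Lemma itg_qform a b c : sqi a -> sqi b -> sqi c -> itg (fun x => qform (a x) (b x) (c x)).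
Proof.
move=> sa sb sc; apply: itg_eq (itg_qpolar sa sb sc sa sb sc) => x.
by rewrite /qform /qpolar; ring.
Qed.

(** The strain is quadratic in [t] because of the tensor square of the gradient of [v], so the
    energy has degree 4. Only the coefficient of [t] matters for criticality; the higher ones are
    left anonymous. *)
Lemma Int_qform_path a b c a1 b1 c1 a2 b2 c2 :
  sqi a -> sqi b -> sqi c -> sqi a1 -> sqi b1 -> sqi c1 -> sqi a2 -> sqi b2 -> sqi c2 ->
  exists k2 k3 k4 : R, forall t : R,
    \int[m]_x qform (a x + t * a1 x + t ^+ 2 * a2 x) (b x + t * b1 x + t ^+ 2 * b2 x)
      (c x + t * c1 x + t ^+ 2 * c2 x) =
    \int[m]_x qform (a x) (b x) (c x) +
    t * (2 * \int[m]_x qpolar (a x) (b x) (c x) (a1 x) (b1 x) (c1 x)) +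
    t ^+ 2 * k2 + t ^+ 3 * k3 + t ^+ 4 * k4.
Proof.
move=> sa sb sc sa1 sb1 sc1 sa2 sb2 sc2.
have i0 := itg_qform sa sb sc; have i1 := itg_qpolar sa sb sc sa1 sb1 sc1.
have i2 := itg_qform sa1 sb1 sc1; have i2' := itg_qpolar sa sb sc sa2 sb2 sc2.
have i3 := itg_qpolar sa1 sb1 sc1 sa2 sb2 sc2; have i4 := itg_qform sa2 sb2 sc2.
set f0 := (fun x => qform (a x) _ _) in i0; set f1 := (fun x => qpolar _ _ _ _ _ _) in i1.
set f2 := (fun x => qform _ _ _) in i2; set f2' := (fun x => qpolar _ _ _ _ _ _) in i2'.
set f3 := (fun x => qpolar _ _ _ _ _ _) in i3; set f4 := (fun x => qform _ _ _) in i4.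
exists (\int[m]_x (f2 x + 2 * f2' x)), (2 * \int[m]_x f3 x), (\int[m]_x f4 x) => t.
have j2 := itgD i2 (itgZ 2 i2').
have l1 := itgZ (t * 2) i1; have l2 := itgZ (t ^+ 2) j2.
have l3 := itgZ (t ^+ 3 * 2) i3; have l4 := itgZ (t ^+ 4) i4.
rewrite !mulrA -(IntZ _ i1) -(IntZ _ i3) -(IntZ _ i4) -(IntZ _ j2).
rewrite -(IntD i0 l1) -(IntD (itgD i0 l1) l2) -(IntD (itgD (itgD i0 l1) l2) l3).
rewrite -(IntD (itgD (itgD (itgD i0 l1) l2) l3) l4); apply: eq_Int => x.
by rewrite /f0 /f1 /f2 /f2' /f3 /f4 /qform /qpolar; ring.
Qed.

Lemma is_derive_quartic (k0 k1 k2 k3 k4 : R) :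
  is_derive (0 : R) (1 : R)
    (fun t : R => k0 + t * k1 + t ^+ 2 * k2 + t ^+ 3 * k3 + t ^+ 4 * k4) k1.
Proof.
rewrite (_ : (fun t : R => _) = horner (Poly [:: k0; k1; k2; k3; k4])).
  have E : k1 = (Poly [:: k0; k1; k2; k3; k4])^`().[0].
    by rewrite horner_coef0 coef_deriv coef_Poly mulr1n.
  by rewrite [X in is_derive _ _ _ X]E; exact: is_derive_poly.
by apply/funext => t; rewrite horner_Poly/=; ring.
Qed.

End quadratic_energy.

Section smooth_fields.
Variable R : realType.
Variable Omega : set (R * R).
Hypothesis oO : open Omega.
Variable M : R.
Hypothesis M0 : 0 < M.
Hypothesis OM : Omega `<=` obox (- M) M (- M) M.
Local Notation M2 := (measurableTypeR R * measurableTypeR R)%type.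
Local Notation mu := (@leb2 R).
Local Notation itg f := (mu.-integrable [set: M2] (EFin \o f)).
Local Notation msr f := (measurable_fun [set: M2] f).
Local Notation sqi f := (sqi mu f).
Local Notation tst := (test_fun Omega).
Local Notation ext := (ext Omega).
Local Notation D i f := ('D_(dir R i) f).
Local Notation wp i f := (wpartial Omega i f).
Implicit Types (z : R * R) (f g h phi psi : R * R -> R) (i j : 'I_2) (t : R).

Lemma ext_test f phi z : tst phi -> ext f z * phi z = f z * phi z.
Proof.
move=> [_ [K [_ KO phi0]]]; have [zO|zO] := pselect (Omega z); first by rewrite extE.
by rewrite phi0 ?mulr0// => /KO.
Qed.

Lemma ext_smooth g : smooth g -> msr (ext g) /\ exists2 k : R, 0 <= k & forall z, `|ext g z| <= k.
Proof.
move=> sg; split.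
  by apply: measurable_funM; [apply: measurable_indic; exact: mO|exact: smooth_msr].
have [k k0 kP] := bounded_on_box (- M) M (- M) M (smooth_continuous sg).
exists k => // z; have [zO|zO] := pselect (Omega z); last by rewrite ext0// normr0.
rewrite extE//; apply: kP; have := OM zO; rewrite oboxE cboxE => -[/andP[? ?] /andP[? ?]].
by rewrite !ltW.
Qed.

Lemma sqi_ext_smooth g : smooth g -> sqi (ext g).
Proof.
move=> /ext_smooth[mg [k k0 kP]]; apply: (@sqi_bounded _ _ k (- M) M (- M) M) => // z zM.
apply: ext0; apply: contra_not zM => /OM; rewrite oboxE cboxE => -[/andP[? ?] /andP[? ?]].
by rewrite !ltW.
Qed.

Lemma sqi_extM_smooth f g : sqi (ext f) -> smooth g -> sqi (ext (fun z => f z * g z)).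
Proof.
move=> sf /ext_smooth[mg [k k0 kP]]; have := sqiMb mg kP sf.
by congr (sqi _); apply/funext => z; rewrite extM mulrC.
Qed.

Lemma smooth_weak_partial i g : smooth g -> is_weak_partial Omega i g (D i g).
Proof.
move=> sg; have sDg := smooth_derive (dir R i) sg; apply/is_weak_partialE.
split; [exact: (sqi_loc (sqi_ext_smooth sg))|exact: (sqi_loc (sqi_ext_smooth sDg))|].
move=> phi tphi; under eq_Int do rewrite (ext_test _ _ (test_fun_derive (dir R i) tphi)).
under [in RHS]eq_Int do rewrite (ext_test _ _ tphi).
exact: (Int_byparts i sg tphi).
Qed.

Definition agree f g := forall z, Omega z -> f z = g z.

Lemma smooth_closure_agree f : smooth_closure Omega f -> exists2 g, smooth g & agree f g.
Proof.
move=> [g sg fg]; exists g => // z zO; apply: fg; rewrite inE; exact: subset_closure.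
Qed.

Lemma agree_ext f g : agree f g -> ext f = ext g.
Proof.
move=> fg; apply/funext => z; have [zO|zO] := pselect (Omega z); last by rewrite !ext0.
by rewrite !extE// fg.
Qed.

Lemma weak_partial_perturb i f f' f1 h g t : is_weak_partial Omega i f f' ->
  loc_integrable Omega f1 -> (\forall z \ae mu, Omega z -> f1 z = f z + t * h z) ->
  smooth g -> agree h g ->
  is_weak_partial Omega i f1 (fun z => f' z + t * D i g z).
Proof.
move=> ff' f1i f1E sg hg; have H := weak_partialD ff' (weak_partialZ t (smooth_weak_partial i sg)).
have [_ Di _] := (is_weak_partialE _ _ _ _).1 H.
apply: weak_partial_ae H _ _ _ _ => //; last exact: nearW.
apply: filterS f1E => z E zO; by rewrite E// hg.
Qed.

End smooth_fields.

Section euler_lagrange.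
Variable R : realType.
Variable Omega : set (R * R).
Hypothesis oO : open Omega.
Variable M : R.
Hypothesis M0 : 0 < M.
Hypothesis OM : Omega `<=` obox (- M) M (- M) M.
Local Opaque wpartial.
Variables (W : 'M[R]_3 -> R) (lm : R) (eps_g kappa_g : R * R -> 'M[R]_3).
Hypotheses (lm0 : 0 < lm) (Q2E : forall F, Q2In W F = 2 * lm * normQ2 F).
Hypotheses (eps_smooth : forall i j, smooth_closure Omega (fun x => eps_g x i j))
  (kappa_smooth : forall i j, smooth_closure Omega (fun x => kappa_g x i j)).
Local Notation M2 := (measurableTypeR R * measurableTypeR R)%type.
Local Notation mu := (@leb2 R).
Local Notation itg f := (mu.-integrable [set: M2] (EFin \o f)).
Local Notation msr f := (measurable_fun [set: M2] f).
Local Notation sqi f := (sqi mu f).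
Local Notation tst := (test_fun Omega).
Local Notation ext := (ext Omega).
Local Notation D i f := ('D_(dir R i) f).
Local Notation wp i f := (wpartial Omega i f).
Local Notation energy := (energy Omega W eps_g kappa_g).
Implicit Types (z : R * R) (f g h phi psi : R * R -> R) (i j : 'I_2) (t : R).
Implicit Types (w : R * R -> 'cV[R]_2) (v : R * R -> R).

Definition sym22 (A : R * R -> 'M[R]_3) i j z : R := minor22 (sym (A z)) i j.

Local Notation ee := (sym22 eps_g).
Local Notation kk := (sym22 kappa_g).

Lemma smooth_closure_sym22 (A : R * R -> 'M[R]_3) i j :
  (forall i' j' : 'I_3, smooth_closure Omega (fun x => A x i' j')) ->
  smooth_closure Omega (sym22 A i j).
Proof.
move=> sA; pose i3 : 'I_3 := @lshift 2 1 i; pose j3 : 'I_3 := @lshift 2 1 j.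
have [g sg gE] := sA i3 j3; have [h sh hE] := sA j3 i3.
exists (fun z => 2^-1 * (g z + h z)); first by apply: smoothZ; exact: smoothD.
by move=> z zO; rewrite /sym22 /minor22 /sym !mxE -gE// -hE.
Qed.

Definition strain11 w v z : R := wp 0 (fun y => w y 0 0) z + 2^-1 * wp 0 v z ^+ 2 - ee 0 0 z.
Definition strain22 w v z : R := wp 1 (fun y => w y 1 0) z + 2^-1 * wp 1 v z ^+ 2 - ee 1 1 z.
                                    
(** The sum of both off-diagonal entries, as [qform] expects; [bend12] follows the same
    convention. *)
Definition strain12 w v z : R := wp 1 (fun y => w y 0 0) z + wp 0 (fun y => w y 1 0) z
  + wp 0 v z * wp 1 v z - (ee 0 1 z + ee 1 0 z).
Definition bend11 v z : R := wp 0 (wp 0 v) z + kk 0 0 z.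
Definition bend22 v z : R := wp 1 (wp 1 v) z + kk 1 1 z.
Definition bend12 v z : R := wp 1 (wp 0 v) z + wp 0 (wp 1 v) z + (kk 0 1 z + kk 1 0 z).

Lemma normQ2_strain_mx (J E : 'M[R]_2) (a : 'cV[R]_2) :
  normQ2 (sym J + 2^-1 *: tensor a a - E) =
  qform (J 0 0 + 2^-1 * a 0 0 ^+ 2 - E 0 0) (J 1 1 + 2^-1 * a 1 0 ^+ 2 - E 1 1)
    (J 0 1 + J 1 0 + a 0 0 * a 1 0 - (E 0 1 + E 1 0)).
Proof.
rewrite /normQ2 /qform /sym /tensor !mxE !big_ord1 !mxE.
move: (J _ _) (J _ _) (J _ _) (J _ _) (a _ _) (a _ _) (E _ _) (E _ _) (E _ _) (E _ _).
by move=> *; field.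
Qed.

Lemma normQ2_strain w v z :
  normQ2 (sym (wjac Omega w z) + 2^-1 *: tensor (wgrad Omega v z) (wgrad Omega v z)
          - minor22 (sym (eps_g z))) =
  qform (strain11 w v z) (strain22 w v z) (strain12 w v z).
Proof.
rewrite /strain11 /strain22 /strain12 /sym22; move: (minor22 _) => E.
by rewrite normQ2_strain_mx !mxE.
Qed.

Lemma normQ2_bend_mx (H E : 'M[R]_2) : normQ2 (H + E) =
  qform (H 0 0 + E 0 0) (H 1 1 + E 1 1) (H 0 1 + H 1 0 + (E 0 1 + E 1 0)).
Proof.
rewrite /normQ2 /qform !mxE.
by move: (H _ _) (H _ _) (H _ _) (H _ _) (E _ _) (E _ _) (E _ _) (E _ _) => *; ring.
Qed.

Lemma normQ2_bend v z : normQ2 (whess Omega v z + minor22 (sym (kappa_g z))) =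
  qform (bend11 v z) (bend22 v z) (bend12 v z).
Proof.
rewrite /bend11 /bend22 /bend12 /sym22; move: (minor22 _) => E.
by rewrite normQ2_bend_mx !mxE.
Qed.

Lemma energyE w v : energy w v =
  ((2^-1)%:E * \int[mu]_(x in Omega)
     (2 * lm * qform (strain11 w v x) (strain22 w v x) (strain12 w v x))%:E +
   (24^-1)%:E * \int[mu]_(x in Omega)
     (2 * lm * qform (bend11 v x) (bend22 v x) (bend12 v x))%:E)%E.
Proof.
rewrite /Defs.energy; congr (_ * _ + _ * _)%E; apply: eq_integral => x _.
  by rewrite Q2E normQ2_strain.
by rewrite Q2E normQ2_bend.
Qed.

Lemma integral_qform_mkcond k f g h :
  (\int[mu]_(x in Omega) (k * qform (f x) (g x) (h x))%:E =
   \int[mu]_x (k * qform (ext f x) (ext g x) (ext h x))%:E)%E.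
Proof.
rewrite integral_mkcond; apply: eq_integral => x _.
rewrite patchE; case: ifPn => [/[!inE] xO|/negP/[!inE] xO]; first by rewrite !extE.
have -> : qform (ext f x) (ext g x) (ext h x) = 0 by rewrite !ext0// /qform; ring.
by rewrite mulr0.
Qed.

Lemma measurable_qform f g h : msr f -> msr g -> msr h ->
  msr (fun z => qform (f z) (g z) (h z)).
Proof.
move=> mf mg mh; apply: measurable_funD; last by apply: measurable_funX; exact: measurable_funD.
apply: measurable_funD; last by apply: measurable_funM => //; exact: measurable_funX.
by apply: measurable_funD; exact: measurable_funX.
Qed.

Lemma integral_qform k f g h A B C : msr (ext f) -> msr (ext g) -> msr (ext h) ->
  sqi A -> sqi B -> sqi C ->
  (\forall z \ae mu, [/\ ext f z = A z, ext g z = B z & ext h z = C z]) ->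
  (\int[mu]_(x in Omega) (k * qform (f x) (g x) (h x))%:E =
   (k * \int[mu]_x qform (A x) (B x) (C x))%:E)%E.
Proof.
move=> mf mg mh sA sB sC E; rewrite integral_qform_mkcond.
have iq := itg_qform sA sB sC; have ikq := itgZ k iq.
rewrite -(IntZ _ iq) /Rintegral fineK; last exact: (integrable_fin_num _ ikq).
apply: ae_eq_integral => //.
- by apply/measurable_EFinP; apply: measurable_funM => //; exact: measurable_qform.
- exact: (measurable_int _ ikq).
- by apply: filterS E => z [-> -> ->].
Qed.

Lemma sqi_of_integral_qform k f g h : 0 < k -> msr (ext f) -> msr (ext g) -> msr (ext h) ->
  (\int[mu]_(x in Omega) (k * qform (f x) (g x) (h x))%:E < +oo)%E ->
  [/\ sqi (ext f), sqi (ext g) & sqi (ext h)].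
Proof.
move=> k0 mf mg mh; rewrite integral_qform_mkcond => fin.
have mq := measurable_qform mf mg mh.
have iq : itg (fun x => k * qform (ext f x) (ext g x) (ext h x)).
  apply/integrableP; split; first by apply/measurable_EFinP; exact: measurable_funM.
  apply: le_lt_trans fin; rewrite le_eqVlt; apply/orP; left; apply/eqP.
  by apply: eq_integral => x _; rewrite /= ger0_norm// mulr_ge0 ?(ltW k0) ?qform_ge0.
have {}iq := itgZ (2 * k^-1) iq.
have bnd (a b c : R) : [/\ a ^+ 2 <= 2 * qform a b c, b ^+ 2 <= 2 * qform a b c &
    c ^+ 2 <= 2 * qform a b c].
  have a2 := sqr_ge0 a; have b2 := sqr_ge0 b; have c2 := sqr_ge0 c.
  have ab2 := sqr_ge0 (a + b).
  by rewrite /qform; split; lra.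
have E x : 2 * k^-1 * (k * qform (ext f x) (ext g x) (ext h x)) =
    2 * qform (ext f x) (ext g x) (ext h x) by field; rewrite gt_eqF.
split; split=> //; apply: (itg_le _ _ iq); try exact: measurable_funX.
- by move=> x; rewrite E ger0_norm ?sqr_ge0//; case: (bnd (ext f x) (ext g x) (ext h x)).
- by move=> x; rewrite E ger0_norm ?sqr_ge0//; case: (bnd (ext f x) (ext g x) (ext h x)).
- by move=> x; rewrite E ger0_norm ?sqr_ge0//; case: (bnd (ext f x) (ext g x) (ext h x)).
Qed.

Definition measurable_partials w v := [/\ forall i j, msr (ext (wp j (fun y => w y i 0))),
  forall i, msr (ext (wp i v)) & forall i j, msr (ext (wp j (wp i v)))].

Lemma measurable_closure f : smooth_closure Omega f -> msr (ext f).
Proof.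
move=> /smooth_closure_agree[g sg fg]; rewrite (agree_ext fg).
by have [] := ext_smooth oO OM sg.
Qed.

Lemma measurable_strain w v : measurable_partials w v ->
  [/\ msr (ext (strain11 w v)), msr (ext (strain22 w v)) & msr (ext (strain12 w v))].
Proof.
move=> [mw mv _]; have me i j := measurable_closure (smooth_closure_sym22 i j eps_smooth).
have e1 f g h : ext (fun z => f z + 2^-1 * g z ^+ 2 - h z) =
    fun z => ext f z + 2^-1 * ext g z ^+ 2 - ext h z.
  apply/funext => z; have [zO|zO] := pselect (Omega z); first by rewrite !extE.
  by rewrite !ext0// expr0n/=; ring.
have e2 f f' g g' h h' : ext (fun z => f z + f' z + g z * g' z - (h z + h' z)) =
    fun z => ext f z + ext f' z + ext g z * ext g' z - (ext h z + ext h' z).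
  apply/funext => z; have [zO|zO] := pselect (Omega z); first by rewrite !extE.
  by rewrite !ext0//; ring.
split; [rewrite e1|rewrite e1|rewrite e2].
- apply: measurable_funB => //; apply: measurable_funD => //.
  by apply: measurable_funM => //; exact: measurable_funX.
- apply: measurable_funB => //; apply: measurable_funD => //.
  by apply: measurable_funM => //; exact: measurable_funX.
- apply: measurable_funB; last exact: measurable_funD.
  by apply: measurable_funD; [exact: measurable_funD|exact: measurable_funM].
Qed.

Lemma measurable_bend w v : measurable_partials w v ->
  [/\ msr (ext (bend11 v)), msr (ext (bend22 v)) & msr (ext (bend12 v))].
Proof.
move=> [_ _ mv]; have mk i j := measurable_closure (smooth_closure_sym22 i j kappa_smooth).
have e1 f g : ext (fun z => f z + g z) = fun z => ext f z + ext g z.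
  by apply/funext => z; rewrite extD.
by split; rewrite e1; apply: measurable_funD => //; rewrite e1; exact: measurable_funD.
Qed.

(** Square integrability of the nonlinear strain is drawn from the finiteness of the energy, [qform]
    being coercive in its three arguments. *)
Lemma energy_finite w v : measurable_partials w v -> (energy w v < +oo)%E ->
  [/\ sqi (ext (strain11 w v)), sqi (ext (strain22 w v)) & sqi (ext (strain12 w v))] /\
  [/\ sqi (ext (bend11 v)), sqi (ext (bend22 v)) & sqi (ext (bend12 v))].
Proof.
move=> mwv; have [m1 m2 m3] := measurable_strain mwv; have [m4 m5 m6] := measurable_bend mwv.
rewrite energyE; set I1 := (\int[mu]_(x in _) _)%E; set I2 := (\int[mu]_(x in _) _)%E.
have k0 : 0 < 2 * lm by rewrite mulr_gt0.
have I10 : (0 <= I1)%E.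
  by apply: integral_ge0 => x _; rewrite lee_fin mulr_ge0 ?(ltW k0) ?qform_ge0.
have I20 : (0 <= I2)%E.
  by apply: integral_ge0 => x _; rewrite lee_fin mulr_ge0 ?(ltW k0) ?qform_ge0.
have fin (k : R) (I : \bar R) : 0 < k -> (0 <= I)%E -> (k%:E * I < +oo)%E -> (I < +oo)%E.
  by move=> kp; case: I => [r||]//; rewrite ?ltry// gt0_muley ?lte_fin.
have p2 : 0 < (2^-1 : R) by rewrite invr_gt0.
have p24 : 0 < (24^-1 : R) by rewrite invr_gt0.
move=> H; split.
  apply: (sqi_of_integral_qform k0 m1 m2 m3); apply: (fin _ _ p2 I10).
  by apply: le_lt_trans H; rewrite leeDl// mule_ge0// lee_fin ltW.
apply: (sqi_of_integral_qform k0 m4 m5 m6); apply: (fin _ _ p24 I20).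
by apply: le_lt_trans H; rewrite leeDr// mule_ge0// lee_fin ltW.
Qed.

Lemma energy_fin_expr w v A B C A' B' C' : measurable_partials w v ->
  sqi A -> sqi B -> sqi C -> sqi A' -> sqi B' -> sqi C' ->
  (\forall z \ae mu, [/\ ext (strain11 w v) z = A z, ext (strain22 w v) z = B z &
     ext (strain12 w v) z = C z]) ->
  (\forall z \ae mu, [/\ ext (bend11 v) z = A' z, ext (bend22 v) z = B' z &
     ext (bend12 v) z = C' z]) ->
  fine (energy w v) = lm * \int[mu]_x qform (A x) (B x) (C x) +
    lm / 12 * \int[mu]_x qform (A' x) (B' x) (C' x).
Proof.
move=> mwv sA sB sC sA' sB' sC' E E'; rewrite energyE.
have [m1 m2 m3] := measurable_strain mwv; have [m4 m5 m6] := measurable_bend mwv.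
rewrite (integral_qform _ m1 m2 m3 sA sB sC E) (integral_qform _ m4 m5 m6 sA' sB' sC' E').
by rewrite -!EFinM -EFinD /=; field.
Qed.

(** [wpartial] is a choice, so its dependence on [t] is affine only almost everywhere, by uniqueness
    of weak derivatives. *)
Lemma wpartial_perturb i f f1 g t : is_weak_partial Omega i f (wp i f) ->
  loc_integrable Omega f1 -> (\forall z \ae mu, Omega z -> f1 z = f z + t * g z) ->
  smooth g -> [/\ loc_integrable Omega (wp i f1), msr (ext (wp i f1)) &
    \forall z \ae mu, Omega z -> wp i f1 z = wp i f z + t * D i g z].
Proof.
move=> wf f1i f1E sg; have gg : agree Omega g g by [].
have H := weak_partial_perturb oO OM wf f1i f1E sg gg.
have [_ H1 _] := (is_weak_partialE _ _ _ _).1 (weak_partial_wpartial H).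
split=> //; first exact: loc_msr.
exact: wpartial_ae H.
Qed.

Definition perturb_w w (g : 'I_2 -> R * R -> R) t : R * R -> 'cV[R]_2 :=
  fun x => w x + t *: (\col_i g i x).

Definition perturb_v v psi t : R * R -> R := fun x => v x + t * psi x.

Lemma loc_integrable_perturb f g t : sqi (ext f) -> smooth g ->
  loc_integrable Omega (fun z => f z + t * g z).
Proof.
move=> sf sg; apply: loc_integrableD; first exact: sqi_loc.
exact: (loc_integrableZ t (sqi_loc (sqi_ext_smooth oO OM sg))).
Qed.

Lemma perturb_partials w v (g : 'I_2 -> R * R -> R) psi t : (forall i, sobolev Omega 1 (fun x => w x i 0)) ->
  sobolev Omega 2 v -> (forall i, smooth (g i)) -> smooth psi ->
  measurable_partials (perturb_w w g t) (perturb_v v psi t) /\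
  \forall z \ae mu, Omega z ->
    [/\ forall i j, wp j (fun y => perturb_w w g t y i 0) z =
          wp j (fun y => w y i 0) z + t * D j (g i) z,
        forall i, wp i (perturb_v v psi t) z = wp i v z + t * D i psi z &
        forall i j, wp j (wp i (perturb_v v psi t)) z =
          wp j (wp i v) z + t * D j (D i psi) z].
Proof.
move=> sw sv sg spsi; have [v0 v1 v2] := sobolev2_wpartial oO sv.
have Hw i j : [/\ loc_integrable Omega (wp j (fun y => perturb_w w g t y i 0)),
    msr (ext (wp j (fun y => perturb_w w g t y i 0))) &
    \forall z \ae mu, Omega z -> wp j (fun y => perturb_w w g t y i 0) z =
      wp j (fun y => w y i 0) z + t * D j (g i) z].
  have [w0 w1 w2] := sobolev1_wpartial oO (sw i).
  have E z : perturb_w w g t z i 0 = w z i 0 + t * g i z by rewrite /perturb_w !mxE.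
  apply: wpartial_perturb => //; last by apply: nearW => z _.
  have -> : (fun y => perturb_w w g t y i 0) = (fun y => w y i 0 + t * g i y) by exact/funext.
  exact: loc_integrable_perturb.
have Hv i : [/\ loc_integrable Omega (wp i (perturb_v v psi t)),
    msr (ext (wp i (perturb_v v psi t))) &
    \forall z \ae mu, Omega z -> wp i (perturb_v v psi t) z = wp i v z + t * D i psi z].
  apply: wpartial_perturb => //; last by apply: nearW => z _.
  exact: loc_integrable_perturb.
have Hvv i j : [/\ loc_integrable Omega (wp j (wp i (perturb_v v psi t))),
    msr (ext (wp j (wp i (perturb_v v psi t)))) &
    \forall z \ae mu, Omega z -> wp j (wp i (perturb_v v psi t)) z =
      wp j (wp i v) z + t * D j (D i psi) z].
  have [l1 _ e1] := Hv i; have [_ h1 _] := sobolev1_wpartial oO (v2 i).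
  by apply: wpartial_perturb => //; exact: smooth_derive.
split; first by split=> [i j|i|i j]; [case: (Hw i j)|case: (Hv i)|case: (Hvv i j)].
have F1 : \forall z \ae mu, forall i j, Omega z -> wp j (fun y => perturb_w w g t y i 0) z =
    wp j (fun y => w y i 0) z + t * D j (g i) z.
  by apply: filter_forall => i; apply: filter_forall => j; case: (Hw i j).
have F2 : \forall z \ae mu, forall i, Omega z ->
    wp i (perturb_v v psi t) z = wp i v z + t * D i psi z.
  by apply: filter_forall => i; case: (Hv i).
have F3 : \forall z \ae mu, forall i j, Omega z -> wp j (wp i (perturb_v v psi t)) z =
    wp j (wp i v) z + t * D j (D i psi) z.
  by apply: filter_forall => i; apply: filter_forall => j; case: (Hvv i j).
by apply: filterS3 F1 F2 F3 => z f1 f2 f3 zO; split=> *; [exact: f1|exact: f2|exact: f3].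
Qed.

Let ext_path f f0 f1 f2 t z : (Omega z -> f z = f0 z + t * f1 z + t ^+ 2 * f2 z) ->
  ext f z = ext f0 z + t * ext f1 z + t ^+ 2 * ext f2 z.
Proof.
have [zO|zO] := pselect (Omega z); first by rewrite !extE//; exact.
by rewrite !ext0// !mulr0 !addr0.
Qed.

Let path_square (a a1 b b1 e t : R) : a + t * a1 + 2^-1 * (b + t * b1) ^+ 2 - e =
  a + 2^-1 * b ^+ 2 - e + t * (a1 + b * b1) + t ^+ 2 * (2^-1 * (b1 * b1)).
Proof. by field. Qed.

Let path_product (a a1 a' a1' b b1 c c1 e t : R) :
  a + t * a1 + (a' + t * a1') + (b + t * b1) * (c + t * c1) - e =
  a + a' + b * c - e + t * (a1 + a1' + (b * c1 + c * b1)) + t ^+ 2 * (b1 * c1).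
Proof. by ring. Qed.

Let path_sum (a a1 b b1 k t : R) : a + t * a1 + (b + t * b1) + k =
  a + b + k + t * (a1 + b1) + t ^+ 2 * 0.
Proof. by ring. Qed.

Lemma sobolev_measurable_partials w v : (forall i, sobolev Omega 1 (fun x => w x i 0)) ->
  sobolev Omega 2 v -> measurable_partials w v.
Proof.
move=> sw sv; have [_ _ sv1] := sobolev1_wpartial oO (sobolevS oO sv).
have [_ _ v2] := sobolev2_wpartial oO sv; split=> [i j|i|i j].
- by have [_ _ /(_ j)[]] := sobolev1_wpartial oO (sw i).
- exact: (sv1 i).1.
- by have [_ _ /(_ j)[]] := sobolev1_wpartial oO (v2 i).
Qed.

(** The energy along the perturbation is a quartic polynomial in [t], and the derivative at 0 reads
    off its linear coefficient. The factor [12^-1] is the ratio of the bending weight [24^-1] to the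
    stretching weight [2^-1]. *)
Lemma weak_euler_lagrange w v (g : 'I_2 -> R * R -> R) psi : (forall i, sobolev Omega 1 (fun x => w x i 0)) ->
  sobolev Omega 2 v -> critical_point Omega W eps_g kappa_g w v ->
  (forall i, smooth (g i)) -> smooth psi ->
  itg (fun x => qpolar (ext (strain11 w v) x) (ext (strain22 w v) x) (ext (strain12 w v) x)
    (ext (fun z => D 0 (g 0) z + wp 0 v z * D 0 psi z) x)
    (ext (fun z => D 1 (g 1) z + wp 1 v z * D 1 psi z) x)
    (ext (fun z => D 1 (g 0) z + D 0 (g 1) z + (wp 0 v z * D 1 psi z + wp 1 v z * D 0 psi z)) x)) /\
  \int[mu]_x qpolar (ext (strain11 w v) x) (ext (strain22 w v) x) (ext (strain12 w v) x)
    (ext (fun z => D 0 (g 0) z + wp 0 v z * D 0 psi z) x)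
    (ext (fun z => D 1 (g 1) z + wp 1 v z * D 1 psi z) x)
    (ext (fun z => D 1 (g 0) z + D 0 (g 1) z + (wp 0 v z * D 1 psi z + wp 1 v z * D 0 psi z)) x)
  + 12^-1 * \int[mu]_x qpolar (ext (bend11 v) x) (ext (bend22 v) x) (ext (bend12 v) x)
    (ext (D 0 (D 0 psi)) x) (ext (D 1 (D 1 psi)) x)
    (ext (fun z => D 1 (D 0 psi) z + D 0 (D 1 psi) z) x) = 0.
Proof.
move=> sw sv [fin crit] sg spsi.
have sDg i j := smooth_derive (dir R j) (sg i); have sDp i := smooth_derive (dir R i) spsi.
have sDDp i j := smooth_derive (dir R j) (sDp i).
have [_ _ sv1] := sobolev1_wpartial oO (sobolevS oO sv).
have mwv := sobolev_measurable_partials sw sv.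
have [[S1 S2 S3] [B1 B2 B3]] := energy_finite mwv fin.
have sS f : smooth f -> sqi (ext f) by exact: sqi_ext_smooth oO M OM f.
have sM i j : sqi (ext (fun z => wp i v z * D j psi z)).
  exact: (sqi_extM_smooth oO OM (sv1 i) (sDp j)).
have sDD f g' : sqi (ext f) -> sqi (ext g') -> sqi (ext (fun z => f z + g' z)).
  move=> sf sg'; have := sqiD sf sg'; congr (sqi _).
  by apply/funext => z; rewrite extD.
have sa i : sqi (ext (fun z => D i (g i) z + wp i v z * D i psi z)).
  by apply: sDD => //; exact: sS.
have sc : sqi (ext (fun z => D 1 (g 0) z + D 0 (g 1) z + (wp 0 v z * D 1 psi z + wp 1 v z * D 0 psi z))).
  exact: (sDD _ _ (sDD _ _ (sS _ (sDg 0 1)) (sS _ (sDg 1 0))) (sDD _ _ (sM 0 1) (sM 1 0))).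
have sa2 i : sqi (ext (fun z => 2^-1 * (D i psi z * D i psi z))).
  by apply: sS; apply: smoothZ; exact: smoothM.
have sc2 : sqi (ext (fun z => D 0 psi z * D 1 psi z)) by apply: sS; exact: smoothM.
have sk : sqi (ext (fun z => D 1 (D 0 psi) z + D 0 (D 1 psi) z)).
  by apply: sS; exact: smoothD.
have s0 : sqi (ext (fun=> 0)) by apply: sS; exact: smooth_cst.
have [k2 [k3 [k4 P1]]] := Int_qform_path S1 S2 S3 (sa 0) (sa 1) sc (sa2 0) (sa2 1) sc2.
split; first exact: itg_qpolar S1 S2 S3 (sa 0) (sa 1) sc.
have [l2 [l3 [l4 P2]]] := Int_qform_path B1 B2 B3 (sS _ (sDDp 0 0)) (sS _ (sDDp 1 1)) sk s0 s0 s0.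
set I1 := \int[mu]_x qpolar _ _ _ _ _ _ in P1 *; set I2 := \int[mu]_x qpolar _ _ _ _ _ _ in P2 *.
set J1 := \int[mu]_x qform _ _ _ in P1; set J2 := \int[mu]_x qform _ _ _ in P2.
(* The exceptional null set depends on [t], which is harmless since integrals are compared at a
   fixed [t]. *)
have E t : fine (energy (perturb_w w g t) (perturb_v v psi t)) =
    lm * (J1 + t * (2 * I1) + t ^+ 2 * k2 + t ^+ 3 * k3 + t ^+ 4 * k4) +
    lm / 12 * (J2 + t * (2 * I2) + t ^+ 2 * l2 + t ^+ 3 * l3 + t ^+ 4 * l4).
  have [mt aet] := perturb_partials t sw sv sg spsi.
  have sZ f : sqi (ext f) -> sqi (fun x => t * ext f x) by exact: sqiZ.
  have sZ2 f : sqi (ext f) -> sqi (fun x => t ^+ 2 * ext f x) by exact: sqiZ.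
  have cmb f f1 f2 : sqi (ext f) -> sqi (ext f1) -> sqi (ext f2) ->
      sqi (fun x => ext f x + t * ext f1 x + t ^+ 2 * ext f2 x).
    by move=> sf sf1 sf2; apply: sqiD; [apply: sqiD => //; exact: sZ|exact: sZ2].
  rewrite -P1 -P2; apply: (energy_fin_expr mt (cmb _ _ _ S1 (sa 0) (sa2 0)) (cmb _ _ _ S2 (sa 1) (sa2 1))
    (cmb _ _ _ S3 sc sc2) (cmb _ _ _ B1 (sS _ (sDDp 0 0)) s0)
    (cmb _ _ _ B2 (sS _ (sDDp 1 1)) s0) (cmb _ _ _ B3 sk s0)).
  - apply: filterS aet => z H; split; apply: ext_path => zO; have [Hw Hv _] := H zO.
    + by rewrite /strain11 Hw Hv; exact: path_square.
    + by rewrite /strain22 Hw Hv; exact: path_square.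
    + by rewrite /strain12 !Hw !Hv; exact: path_product.
  - apply: filterS aet => z H; split; apply: ext_path => zO; have [_ _ Hv] := H zO.
    + by rewrite /bend11 Hv mulr0 addr0 addrAC.
    + by rewrite /bend22 Hv mulr0 addr0 addrAC.
    + by rewrite /bend12 !Hv; exact: path_sum.
have cg i : smooth_closure Omega (fun x => (\col_i g i x : 'cV[R]_2) i 0).
  by exists (g i) => // z _; rewrite mxE.
have cpsi : smooth_closure Omega psi by exists psi.
have := crit (fun x => \col_i g i x) psi cg cpsi.
have -> : (fun t : R => fine (energy (fun x => w x + t *: \col_i g i x) (fun x => v x + t * psi x))) =
  (fun t => (lm * J1 + lm / 12 * J2) + t * (lm * (2 * I1) + lm / 12 * (2 * I2)) +
    t ^+ 2 * (lm * k2 + lm / 12 * l2) + t ^+ 3 * (lm * k3 + lm / 12 * l3) +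
    t ^+ 4 * (lm * k4 + lm / 12 * l4)).
  by apply/funext => t; rewrite [LHS]E; ring.
move=> D0; have D1 := is_derive_quartic (lm * J1 + lm / 12 * J2)
  (lm * (2 * I1) + lm / 12 * (2 * I2)) (lm * k2 + lm / 12 * l2) (lm * k3 + lm / 12 * l3)
  (lm * k4 + lm / 12 * l4).
have : lm * (2 * I1) + lm / 12 * (2 * I2) = 0.
  by rewrite -(@derive_val _ _ _ _ _ _ _ D1) (@derive_val _ _ _ _ _ _ _ D0).
have -> : lm * (2 * I1) + lm / 12 * (2 * I2) = 2 * lm * (I1 + 12^-1 * I2) by field.
by move/eqP; rewrite mulf_eq0 mulf_eq0 pnatr_eq0 (gt_eqF lm0) /= => /eqP.
Qed.

End euler_lagrange.

                           

(** * Second-order identities in weak form *)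

Section second_order.
Variable R : realType.
Variable Omega : set (R * R).
Hypothesis oO : open Omega.
Variable M : R.
Hypothesis M0 : 0 < M.
Hypothesis OM : Omega `<=` obox (- M) M (- M) M.
Local Opaque wpartial derive.
Local Notation M2 := (measurableTypeR R * measurableTypeR R)%type.
Local Notation mu := (@leb2 R).
Local Notation itg f := (mu.-integrable [set: M2] (EFin \o f)).
Local Notation msr f := (measurable_fun [set: M2] f).
Local Notation sqi f := (sqi mu f).
Local Notation tst := (test_fun Omega).
Local Notation ext := (ext Omega).
Local Notation D i f := ('D_(dir R i) f).
Local Notation wp i f := (wpartial Omega i f).
Implicit Types (z : R * R) (f g h phi chi a b : R * R -> R) (i j : 'I_2).

Definition pair2 f chi : R := \int[mu]_z (ext f z * chi z).
Definition pair3 f g chi : R := \int[mu]_z (ext f z * (ext g z * chi z)).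

Lemma regular_pair2 f chi : regular Omega f chi = pair2 f chi.
Proof. by rewrite regularE. Qed.

Lemma pair3C f g chi : pair3 f g chi = pair3 g f chi.
Proof. by apply: eq_Int => z; ring. Qed.

Lemma itg_pair2 f chi : sqi (ext f) -> tst chi -> itg (fun z => ext f z * chi z).
Proof. by move=> sf tchi; apply: loc_itg_test => //; exact: sqi_loc. Qed.

Lemma itg_pair3 f g chi : sqi (ext f) -> sqi (ext g) -> tst chi ->
  itg (fun z => ext f z * (ext g z * chi z)).
Proof. by move=> sf sg tchi; exact: (sqiM sf (sqiM_test sg tchi)). Qed.

Lemma pair3_split f g h chi chi' : sqi (ext f) -> sqi (ext g) -> sqi (ext h) ->
  tst chi -> tst chi' ->
  \int[mu]_z (ext f z * (ext g z * chi z + ext h z * chi' z)) =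
  pair3 f g chi + pair3 f h chi'.
Proof.
move=> sf sg sh tc tc'; rewrite -(IntD (itg_pair3 sf sg tc) (itg_pair3 sf sh tc')).
by apply: eq_Int => z; rewrite mulrDr.
Qed.

Definition sel (T : Type) (a b : T) (i : 'I_2) : T := if i == 0 then a else b.

(** The single field [h01] serves for both mixed derivatives, so symmetry of the weak Hessian is
    built in. *)
Definition W22 f f0 f1 h00 h01 h11 := [/\ W12 Omega f (sel f0 f1),
  W12 Omega f0 (sel h00 h01) & W12 Omega f1 (sel h01 h11)].

Lemma derive01 phi : tst phi -> D 1 (D 0 phi) = D 0 (D 1 phi).
Proof. by move=> [sphi _]; apply/funext => z; exact: smooth_derive_comm. Qed.

Lemma sum_ord2 (x : 'I_2 -> R) : \sum_i x i = x 0 + x 1.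
Proof. by rewrite !big_ord_recl big_ord0 addr0; congr (x _ + x _); exact: val_inj. Qed.

Lemma dpartial2E (T : distr R) i j phi : dpartial i (dpartial j T) phi = T (D j (D i phi)).
Proof. by rewrite /dpartial opprK. Qed.

Lemma dlaplacianE (T : distr R) phi :
  dlaplacian T phi = T (D 0 (D 0 phi)) + T (D 1 (D 1 phi)).
Proof. by rewrite /dlaplacian sum_ord2 !dpartial2E. Qed.

Lemma W12_sel f a b : sqi (ext f) -> sqi (ext a) -> sqi (ext b) ->
  is_weak_partial Omega 0 f a -> is_weak_partial Omega 1 f b -> W12 Omega f (sel a b).
Proof.
move=> sf sa sb fa fb; have o1 (i : 'I_2) : i = 0 \/ i = 1.
  by case: i => [[|[|//]] i2]; [left|right]; exact: val_inj.
by split=> // i; case: (o1 i) => ->.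
Qed.

Section W22_identities.
Variables (f f0 f1 h00 h01 h11 : R * R -> R).
Hypothesis Wf : W22 f f0 f1 h00 h01 h11.

Lemma W22_sqi : [/\ sqi (ext f), sqi (ext f0) & sqi (ext f1)] /\
  [/\ sqi (ext h00), sqi (ext h01) & sqi (ext h11)].
Proof.
by case: Wf => [[? Hf _] [? H0 _] [? H1 _]]; split; split => //;
  [exact: (H0 0)|exact: (H0 1)|exact: (H1 1)].
Qed.

Let byparts phi : tst phi ->
  [/\ pair2 f (D 0 phi) = - pair2 f0 phi, pair2 f (D 1 phi) = - pair2 f1 phi,
      pair2 f0 (D 0 phi) = - pair2 h00 phi, pair2 f0 (D 1 phi) = - pair2 h01 phi &
      pair2 f1 (D 1 phi) = - pair2 h11 phi].
Proof.
move=> tphi; case: Wf => Wf' W0 W1.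
have a0 := W12_byparts 0 Wf' tphi; have a1 := W12_byparts 1 Wf' tphi.
have b0 := W12_byparts 0 W0 tphi; have b1 := W12_byparts 1 W0 tphi.
by have c1 := W12_byparts 1 W1 tphi.
Qed.

Let tD i phi : tst phi -> tst (D i phi). Proof. exact: test_fun_derive. Qed.

Let pair2_00 phi : tst phi -> pair2 f (D 0 (D 0 phi)) = pair2 h00 phi.
Proof.
move=> tphi; have [e _ _ _ _] := byparts (tD 0 tphi).
have [_ _ e' _ _] := byparts tphi; exact: (etrans e (etrans (congr1 -%R e') (opprK _))).
Qed.

Let pair2_01 phi : tst phi -> pair2 f (D 0 (D 1 phi)) = pair2 h01 phi.
Proof.
move=> tphi; have [e _ _ _ _] := byparts (tD 1 tphi).
have [_ _ _ e' _] := byparts tphi; exact: (etrans e (etrans (congr1 -%R e') (opprK _))).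
Qed.

Let pair2_11 phi : tst phi -> pair2 f (D 1 (D 1 phi)) = pair2 h11 phi.
Proof.
move=> tphi; have [_ e _ _ _] := byparts (tD 1 tphi).
have [_ _ _ _ e'] := byparts tphi; exact: (etrans e (etrans (congr1 -%R e') (opprK _))).
Qed.

Lemma bilaplacianE phi : tst phi -> dlaplacian (dlaplacian (regular Omega f)) phi =
  pair2 h00 (D 0 (D 0 phi)) + pair2 h11 (D 0 (D 0 phi)) +
  (pair2 h00 (D 1 (D 1 phi)) + pair2 h11 (D 1 (D 1 phi))).
Proof.
move=> tphi; have t0 := tD 0 (tD 0 tphi); have t1 := tD 1 (tD 1 tphi).
have E chi h h' : pair2 f (D 0 (D 0 chi)) = pair2 h chi -> pair2 f (D 1 (D 1 chi)) = pair2 h' chi ->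
    dlaplacian (regular Omega f) chi = pair2 h chi + pair2 h' chi.
  by move=> e e'; rewrite dlaplacianE -e -e'; congr (_ + _); exact: regular_pair2.
rewrite dlaplacianE.
exact: (congr2 +%R (E _ _ _ (pair2_00 t0) (pair2_11 t0)) (E _ _ _ (pair2_00 t1) (pair2_11 t1))).
Qed.

(** All these pairings equal [f] tested against the same fourth derivative of [phi], twice in each
    variable, because derivatives of test functions commute. *)
Lemma pair2_compat phi : tst phi -> pair2 h00 (D 1 (D 1 phi)) = pair2 h01 (D 0 (D 1 phi)) /\
  pair2 h11 (D 0 (D 0 phi)) = pair2 h01 (D 0 (D 1 phi)).
Proof.
move=> tphi; have e00 := pair2_00 (tD 1 (tD 1 tphi)).
have e01 := pair2_01 (tD 0 (tD 1 tphi)); have e11 := pair2_11 (tD 0 (tD 0 tphi)).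
have c1 := derive01 (tD 1 tphi); have c0 := derive01 (tD 0 tphi).
have c := derive01 (tD 0 (tD 1 tphi)).
split.
  exact: (etrans (esym e00) (etrans (congr1 (fun chi => pair2 f (D 0 chi)) (esym c1)) e01)).
have d0 := congr1 (fun chi => pair2 f (D 1 chi)) c0.
have d1 := congr1 (fun chi => pair2 f (D 1 (D 0 chi))) (derive01 tphi).
have d2 := congr1 (pair2 f) c.
exact: (etrans (esym e11) (etrans d0 (etrans d1 (etrans d2 e01)))).
Qed.

Let prod := product_rule_local oO M0 OM.
Let jac := jacobian_local oO M0 OM.

(** The weak form of [curl^T curl] of the tensor square of a gradient being [-2] times the Hessian
    determinant. [product_rule_local] removes one derivative from each product, the terms in
    [f0 h01] cancel, and [jacobian_local] removes the last derivative. *)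
Lemma det_byparts phi : tst phi ->
  pair3 f0 f0 (D 1 (D 1 phi)) + pair3 f1 f1 (D 0 (D 0 phi)) - 2 * pair3 f0 f1 (D 0 (D 1 phi)) =
  2 * (pair3 h01 h01 phi - pair3 h00 h11 phi).
Proof.
move=> tphi; have [[sf s0 s1] [s00 s01 s11]] := W22_sqi; case: Wf => _ W0 W1.
have t0 := tD 0 tphi; have t1 := tD 1 tphi.
have e1 : pair3 f0 f0 (D 1 (D 1 phi)) + pair3 f0 h01 (D 1 phi) = - pair3 h01 f0 (D 1 phi).
  by rewrite -(pair3_split s0 s0 s01 (tD 1 t1) t1); exact: (prod W0 W0 t1 1).
have e2 : pair3 f1 f1 (D 0 (D 0 phi)) + pair3 f1 h01 (D 0 phi) = - pair3 h01 f1 (D 0 phi).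
  by rewrite -(pair3_split s1 s1 s01 (tD 0 t0) t0); exact: (prod W1 W1 t0 0).
have e3 : pair3 f0 f1 (D 0 (D 1 phi)) + pair3 f0 h01 (D 1 phi) = - pair3 h00 f1 (D 1 phi).
  by rewrite -(pair3_split s0 s1 s01 (tD 0 t1) t1); exact: (prod W0 W1 t1 0).
have e4 : pair3 h00 f1 (D 1 phi) + pair3 h00 h11 phi = pair3 h01 f1 (D 0 phi) + pair3 h01 h01 phi.
  exact: (etrans (esym (pair3_split s00 s1 s11 t1 tphi))
    (etrans (jac W0 W1 tphi 0 1) (pair3_split s01 s1 s01 t0 tphi))).
have c1 := pair3C f0 h01 (D 1 phi); have c2 := pair3C f1 h01 (D 0 phi).
move: (pair3 f0 f0 _) (pair3 f1 f1 _) (pair3 f0 f1 _) (pair3 h01 h01 _) (pair3 h00 h11 _) e1 e2 e3 e4.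
move: (pair3 f0 h01 _) (pair3 h01 f0 _) (pair3 f1 h01 _) (pair3 h01 f1 _) (pair3 h00 f1 _) c1 c2 => *.
by lra.
Qed.

(** The divergence form of the Airy bracket: rows of the cofactor of a Hessian are divergence free,
    so [[g, f]] is the divergence of that cofactor applied to the gradient of [g]. The two rows are
    [jacobian_local] for the pairs [f1, g0] and [f0, g1]. *)
Lemma airy_byparts g g0 g1 k00 k01 k11 phi : W22 g g0 g1 k00 k01 k11 -> tst phi ->
  pair3 h11 k00 phi + pair3 h00 k11 phi - 2 * pair3 h01 k01 phi =
  - (pair3 h11 g0 (D 0 phi) + pair3 h00 g1 (D 1 phi) - pair3 h01 g0 (D 1 phi) -
     pair3 h01 g1 (D 0 phi)).
Proof.
move=> [_ V0 V1] tphi; have [_ [s00 s01 s11]] := W22_sqi; case: Wf => _ W0 W1.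
have lin (x1 x2 x3 x4 x5 x6 x7 : R) : x1 + x2 = x3 + x4 -> x5 + x6 = x7 + x2 ->
    x4 + x6 - 2 * x2 = - (x3 + x5 - x1 - x7) by move=> *; lra.
have t0 := tD 0 tphi; have t1 := tD 1 tphi.
have r00 : sqi (ext k00) by case: V0 => _ /(_ 0).
have r01 : sqi (ext k01) by case: V0 => _ /(_ 1).
have r11 : sqi (ext k11) by case: V1 => _ /(_ 1).
have r0 : sqi (ext g0) by case: V0.
have r1 : sqi (ext g1) by case: V1.
have e1 : pair3 h01 g0 (D 1 phi) + pair3 h01 k01 phi = pair3 h11 g0 (D 0 phi) + pair3 h11 k00 phi.
  exact: (etrans (esym (pair3_split s01 r0 r01 t1 tphi))
    (etrans (jac W1 V0 tphi 0 1) (pair3_split s11 r0 r00 t0 tphi))).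
have e2 : pair3 h00 g1 (D 1 phi) + pair3 h00 k11 phi = pair3 h01 g1 (D 0 phi) + pair3 h01 k01 phi.
  exact: (etrans (esym (pair3_split s00 r1 r11 t1 tphi))
    (etrans (jac W0 V1 tphi 0 1) (pair3_split s01 r1 r01 t0 tphi))).
exact: lin e1 e2.
Qed.

Lemma W22_whess : \forall z \ae mu, Omega z ->
  [/\ whess Omega f z 0 0 = h00 z, whess Omega f z 0 1 = h01 z,
      whess Omega f z 1 0 = h01 z & whess Omega f z 1 1 = h11 z].
Proof.
case: Wf => -[sf sf_ wf] [s0 s0_ w0] [s1 s1_ w1].
have H i : [/\ is_weak_partial Omega i f (wp i f) &
    \forall z \ae mu, Omega z -> sel f0 f1 i z = wp i f z].
  split; first exact: weak_partial_wpartial (wf i).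
  by have H := wpartial_ae oO (wf i); apply: filterS H => z H zO; rewrite H.
have HH i j g h : is_weak_partial Omega j g h -> (\forall z \ae mu, Omega z -> g z = wp i f z) ->
    \forall z \ae mu, Omega z -> wp j (wp i f) z = h z.
  move=> gh gE; apply: wpartial_ae => //.
  have [/is_weak_partialE[_ li _] _] := H i; have [_ lh _] := (is_weak_partialE _ _ _ _).1 gh.
  by apply: weak_partial_ae gh _ _ gE _ => //; exact: nearW.
have a0 := (H 0).2; have a1 := (H 1).2.
have b00 := HH 0 0 _ _ (w0 0) a0; have b01 := HH 0 1 _ _ (w0 1) a0.
have b10 := HH 1 0 _ _ (w1 0) a1; have b11 := HH 1 1 _ _ (w1 1) a1.
have B1 : \forall z \ae mu, Omega z -> wp 0 (wp 0 f) z = h00 z /\ wp 1 (wp 0 f) z = h01 z.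
  by apply: filterS2 b00 b01 => z c1 c2 zO; split; [exact: c1|exact: c2].
have B2 : \forall z \ae mu, Omega z -> wp 0 (wp 1 f) z = h01 z /\ wp 1 (wp 1 f) z = h11 z.
  by apply: filterS2 b10 b11 => z c1 c2 zO; split; [exact: c1|exact: c2].
apply: filterS2 B1 B2 => z c1 c2 zO; have [d1 d2] := c1 zO; have [d3 d4] := c2 zO.
by split; rewrite mxE.
Qed.

End W22_identities.

Lemma weak_partial_swap f f0 f1 h : is_weak_partial Omega 0 f f0 ->
  is_weak_partial Omega 1 f f1 -> is_weak_partial Omega 1 f0 h -> is_weak_partial Omega 0 f1 h.
Proof.
move=> /is_weak_partialE[_ _ E0] /is_weak_partialE[_ l1 E1] /is_weak_partialE[_ l01 E01].
apply/is_weak_partialE; split; [exact: l1|exact: l01|move=> phi tphi].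
have a1 := E1 _ (test_fun_derive (dir R 0) tphi).
have a0 := E0 _ (test_fun_derive (dir R 1) tphi).
have c := congr1 (fun chi => \int[mu]_z (ext f z * chi z)) (derive01 tphi).
exact: (etrans (oppr_inj (etrans (esym a1) (etrans c a0))) (E01 _ tphi)).
Qed.

(** The mixed representative [wp 1 (wp 0 v)] is also a weak derivative of [wp 1 v], by
    [weak_partial_swap]. *)
Lemma sobolev2_W22 v : sobolev Omega 2 v ->
  W22 v (wp 0 v) (wp 1 v) (wp 0 (wp 0 v)) (wp 1 (wp 0 v)) (wp 1 (wp 1 v)).
Proof.
move=> sv; have [v0 v1 v2] := sobolev2_wpartial oO sv.
have [_ _ s1] := sobolev1_wpartial oO (sobolevS oO sv).
have H i := sobolev1_wpartial oO (v2 i).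
have [q0 w0 s0] := H 0; have [q1 w1 s1'] := H 1.
have W0 : W12 Omega (wp 0 v) (sel (wp 0 (wp 0 v)) (wp 1 (wp 0 v))).
  exact: W12_sel q0 (s0 0) (s0 1) (w0 0) (w0 1).
have Wv := W12_sel v0 q0 q1 (v1 0) (v1 1).
have w10 := weak_partial_swap (v1 0) (v1 1) (w0 1).
exact: And3 Wv W0 (W12_sel q1 (s0 1) (s1' 1) w10 (w1 1)).
Qed.

End second_order.

Section pairings.
Variable R : realType.
Variable Omega : set (R * R).

Local Notation mu := (@leb2 R).
Local Notation sqi f := (sqi mu f).
Local Notation tst := (test_fun Omega).
Local Notation ext := (ext Omega).
Local Notation pair2 := (pair2 Omega).
Local Notation pair3 := (pair3 Omega).
Implicit Types (z : R * R) (f g h chi : R * R -> R) (k : R).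

Lemma eq_pair2 f g chi : agree Omega f g -> pair2 f chi = pair2 g chi.
Proof. by move=> fg; rewrite /pair2 (agree_ext fg). Qed.

Lemma agree_ext_id f : agree Omega (ext f) f.
Proof. by move=> z zO; rewrite extE. Qed.

Lemma pair2_ext f chi : pair2 (ext f) chi = pair2 f chi.
Proof. exact/eq_pair2/agree_ext_id. Qed.

Lemma pair3_ext f g chi : pair3 (ext f) g chi = pair3 f g chi.
Proof. by rewrite /pair3 (agree_ext (@agree_ext_id f)). Qed.

Lemma pair2D f g chi : sqi (ext f) -> sqi (ext g) -> tst chi ->
  pair2 (fun z => f z + g z) chi = pair2 f chi + pair2 g chi.
Proof.
move=> sf sg tchi; rewrite -(IntD (itg_pair2 sf tchi) (itg_pair2 sg tchi)).
by apply: eq_Int => z; rewrite extD mulrDl.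
Qed.

Lemma pair2Z k f chi : sqi (ext f) -> tst chi -> pair2 (fun z => k * f z) chi = k * pair2 f chi.
Proof.
move=> sf tchi; rewrite -(IntZ _ (itg_pair2 sf tchi)).
by apply: eq_Int => z; rewrite extZ mulrA.
Qed.

Lemma pair3N f g chi : sqi (ext f) -> sqi (ext g) -> tst chi ->
  pair3 (fun z => - f z) g chi = - pair3 f g chi.
Proof.
move=> sf sg tchi; rewrite -(IntN (itg_pair3 sf sg tchi)).
apply: eq_Int => z; have [zO|zO] := pselect (Omega z); [rewrite !extE//; ring|rewrite !ext0//; ring].
Qed.

Lemma pair2_square f g h chi : sqi (ext f) -> sqi (ext g) -> sqi (ext h) -> tst chi ->
  pair2 (fun z => f z + 2^-1 * g z ^+ 2 - h z) chi =
  pair2 f chi + 2^-1 * pair3 g g chi - pair2 h chi.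
Proof.
move=> sf sg sh tchi; have i1 := itg_pair2 sf tchi; have i2 := itg_pair3 sg sg tchi.
have i3 := itg_pair2 sh tchi.
rewrite -(IntZ 2^-1 i2) -(IntD i1 (itgZ _ i2)) -(IntB (itgD i1 (itgZ _ i2)) i3).
apply: eq_Int => z; have [zO|zO] := pselect (Omega z); first by rewrite !extE//; ring.
by rewrite !ext0//; ring.
Qed.

Lemma pair2_product f f' g g' h h' chi : sqi (ext f) -> sqi (ext f') -> sqi (ext g) ->
  sqi (ext g') -> sqi (ext h) -> sqi (ext h') -> tst chi ->
  pair2 (fun z => f z + f' z + g z * g' z - (h z + h' z)) chi =
  pair2 f chi + pair2 f' chi + pair3 g g' chi - pair2 (fun z => h z + h' z) chi.
Proof.
move=> sf sf' sg sg' sh sh' tchi; have i1 := itg_pair2 sf tchi; have i1' := itg_pair2 sf' tchi.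
have i2 := itg_pair3 sg sg' tchi; have i3 := itg_pair2 sh tchi; have i3' := itg_pair2 sh' tchi.
rewrite (pair2D sh sh' tchi) -(IntD i1 i1') -(IntD (itgD i1 i1') i2) -(IntD i3 i3').
rewrite -(IntB (itgD (itgD i1 i1') i2) (itgD i3 i3')).
apply: eq_Int => z; have [zO|zO] := pselect (Omega z); first by rewrite !extE//; ring.
by rewrite !ext0//; ring.
Qed.

End pairings.

(** * Cofactors of 2 by 2 matrices and linear elimination *)

Section matrices2.
Variable R : realType.
Implicit Types (A J E : 'M[R]_2) (a : 'cV[R]_2).

Lemma forall_ord2 (P : 'I_2 -> Prop) : P 0 -> P 1 -> forall i, P i.
Proof.
move=> P0 P1 [[|[|//]] i2]; first by have -> : Ordinal i2 = 0 by exact: val_inj.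
by have -> : Ordinal i2 = 1 by exact: val_inj.
Qed.

Lemma cof22 A : [/\ cof A 0 0 = A 1 1, cof A 0 1 = - A 1 0, cof A 1 0 = - A 0 1 &
  cof A 1 1 = A 0 0].
Proof.
have l0 : lift (0 : 'I_2) (0 : 'I_1) = 1 by exact: val_inj.
have l1 : lift (1 : 'I_2) (0 : 'I_1) = 0 by exact: val_inj.
by split; rewrite mxE /cofactor det_mx11 !mxE ?l0 ?l1 /= ?expr0 ?expr1 ?sqrrN ?expr1n ?mul1r ?mulN1r// expr2 mulrNN !mul1r.
Qed.

Lemma inner_cof22 A B : inner A (cof B) = A 0 0 * B 1 1 + A 1 1 * B 0 0 - A 0 1 * B 1 0 - A 1 0 * B 0 1.
Proof.
have [c00 c01 c10 c11] := cof22 B.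
rewrite /inner (sum_ord2 (fun i => \sum_j A i j * cof B i j)) !sum_ord2 c00 c01 c10 c11.
by move: (A _ _) (A _ _) (A _ _) (A _ _) (B _ _) (B _ _) (B _ _) (B _ _) => *; ring.
Qed.

(** Adding the trace on the diagonal turns an entry [a] into [2 a + b], and symmetry of [E] lets one
    half-sum fill both off-diagonal places. *)
Lemma stress_strain (k : R) J E a A : E 0 1 = E 1 0 ->
  A 1 1 = 2 * k * (2 * (J 0 0 + 2^-1 * a 0 0 ^+ 2 - E 0 0) + (J 1 1 + 2^-1 * a 1 0 ^+ 2 - E 1 1)) ->
  A 0 1 = - (k * (J 0 1 + J 1 0 + a 0 0 * a 1 0 - (E 0 1 + E 1 0))) ->
  A 1 0 = - (k * (J 0 1 + J 1 0 + a 0 0 * a 1 0 - (E 0 1 + E 1 0))) ->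
  A 0 0 = 2 * k * ((J 0 0 + 2^-1 * a 0 0 ^+ 2 - E 0 0) + 2 * (J 1 1 + 2^-1 * a 1 0 ^+ 2 - E 1 1)) ->
  cof A = (2 * k) *: (sym J + 2^-1 *: tensor a a - E +
    (J 0 0 + J 1 1 + \tr (2^-1 *: tensor a a - E))%:M).
Proof.
move=> Es A11 A01 A10 A00; have [c00 c01 c10 c11] := cof22 A.
have tE (i j : 'I_2) : tensor a a i j = a i 0 * a j 0 by rewrite /tensor mxE big_ord1 mxE.
have trE : \tr (2^-1 *: tensor a a - E) =
    2^-1 * (a 0 0 * a 0 0) - E 0 0 + (2^-1 * (a 1 0 * a 1 0) - E 1 1).
  by rewrite /mxtrace sum_ord2 !mxE !big_ord1 !mxE.
rewrite trE; apply/matrixP; apply: forall_ord2; apply: forall_ord2.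
- by rewrite c00 A11 /sym !mxE !big_ord1 !mxE /=; field.
- by rewrite c01 A10 /sym !mxE !big_ord1 !mxE /= -Es; field.
- by rewrite c10 A01 /sym !mxE !big_ord1 !mxE /= -Es; field.
- by rewrite c11 A00 /sym !mxE !big_ord1 !mxE /=; field.
Qed.

End matrices2.

Section linear_combinations.
Variables (R : realType) (lm : R).

(** The eliminations of this section are stated over abstract reals, so that linear arithmetic
    treats the integrals as atoms. Here the displacement terms cancel in pairs in [A + B - C]. *)
Lemma strain_lin (A B C w00 w11 w01 w10 x00 x11 x01 e0 e1 e01 y z z' ai cu : R) :
  A = w00 + 2^-1 * x00 - e0 -> B = w11 + 2^-1 * x11 - e1 -> C = w01 + w10 + x01 - e01 ->
  w00 = w01 -> w11 = w10 -> x00 + x11 - 2 * x01 = 2 * (y - z) -> ai = z' + z - 2 * y -> z' = z ->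
  cu = e0 - e01 + e1 -> A + B - C = - 2^-1 * ai - cu.
Proof.
by move=> *; lra.
Qed.

(** The index 0 or 1 tells which repeated second derivative of the test function is paired. The
    relations [s1 = q] and [p0 = q] eliminate [b1] and [a0], and what remains of the bilaplacian is
    [3 lm (a1 + b0 - c1)]. *)
Lemma compat_lin (bi s0 s1 p0 p1 q a0 a1 b0 b1 c1 ai cu : R) :
  bi = s0 + p0 + (s1 + p1) -> s1 = q -> p0 = q -> s0 = 2 * lm * (a0 + 2 * b0) ->
  s1 = 2 * lm * (a1 + 2 * b1) -> p0 = 2 * lm * (2 * a0 + b0) -> p1 = 2 * lm * (2 * a1 + b1) ->
  q = - (lm * c1) -> a1 + b0 - c1 = - 2^-1 * ai - cu -> bi = - (3 * lm / 2) * ai - 3 * lm * cu.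
Proof.
move=> -> E1 E2 E3 E4 E5 E6 E7 E8.
have -> : - (3 * lm / 2) * ai - 3 * lm * cu = 3 * lm * (- 2^-1 * ai - cu) by field.
by rewrite -E8; move: E1 E2; rewrite E3 E4 E5 E6 E7; lra.
Qed.

Lemma div_lin (x00 x01 x01' x10 x11 n0 n1 m m' l0 l1 : R) : x00 = n0 + 2^-1 * n1 -> x01' = x01 ->
  x01 = m + - 2^-1 * m' -> x10 = m' + - 2^-1 * m -> x11 = l1 + 2^-1 * l0 ->
  x00 + x01' + (x10 + x11) = n0 + 2^-1 * n1 + 2^-1 * (m + m') + (2^-1 * l0 + l1).
Proof.
by move=> *; lra.
Qed.

(** As [z00 = x11 = y], the five bending terms add up to twice the bilaplacian plus twice the
    curvature term [dv], which turns [lm / 6] into [lm / 3]. *)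
Lemma equil_lin (bi x00 x11 z00 z11 y ai px sx qx qx' px' sx' nx nx' k10 k20 k11 k21 k12 n00 n10 n01 n11
    vv y' kv m m' dv : R) :
  bi = x00 + x11 + (z00 + z11) -> z00 = y -> x11 = y ->
  px + sx + qx + qx' + lm / 6 * (2 * k10 + k20 + k11 + 2 * k21 + k12) = 0 ->
  ai = - (px' + sx' - nx - nx') -> px' = px -> sx' = sx -> nx = - qx -> nx' = - qx' ->
  k10 = x00 + n00 -> k20 = x11 + n10 -> k11 = z00 + n01 -> k21 = z11 + n11 -> k12 = vv + kv ->
  vv = y + y' -> kv = m + m' -> y' = y ->
  dv = n00 + 2^-1 * n10 + 2^-1 * (m + m') + (2^-1 * n01 + n11) ->
  lm / 3 * bi = ai - lm / 3 * dv.
Proof.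
move=> -> -> -> E -> -> -> -> -> E1 E2 E3 E4 E5 E6 E7 E8 ->.
by move: E; rewrite E1 E2 E3 E4 E5 E6 E7 E8; lra.
Qed.

End linear_combinations.

(** * The Airy potential of a critical point *)

Section airy_potential.
Variable R : realType.
Variable Omega : set (R * R).
Hypothesis oO : open Omega.
Variable M : R.
Hypothesis M0 : 0 < M.
Hypothesis OM : Omega `<=` obox (- M) M (- M) M.
Local Opaque wpartial derive.
Variables (W : 'M[R]_3 -> R) (lm : R) (eps_g kappa_g : R * R -> 'M[R]_3).
Hypotheses (lm0 : 0 < lm) (Q2E : forall F, Q2In W F = 2 * lm * normQ2 F).
Hypotheses (eps_smooth : forall i j, smooth_closure Omega (fun x => eps_g x i j))
  (kappa_smooth : forall i j, smooth_closure Omega (fun x => kappa_g x i j)).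
Variables (w : R * R -> 'cV[R]_2) (v : R * R -> R).
Hypotheses (sw : forall i, sobolev Omega 1 (fun x => w x i 0)) (sv : sobolev Omega 2 v)
  (crit : critical_point Omega W eps_g kappa_g w v).
Local Notation M2 := (measurableTypeR R * measurableTypeR R)%type.
Local Notation mu := (@leb2 R).
Local Notation itg f := (mu.-integrable [set: M2] (EFin \o f)).
Local Notation sqi f := (sqi mu f).
Local Notation tst := (test_fun Omega).
Local Notation ext := (ext Omega).
Local Notation pair2 := (pair2 Omega).
Local Notation pair3 := (pair3 Omega).
Local Notation D i f := ('D_(dir R i) f).
Local Notation wp i f := (wpartial Omega i f).
Local Notation ee := (sym22 eps_g).
Local Notation kk := (sym22 kappa_g).
Implicit Types (z : R * R) (f g h phi psi chi : R * R -> R) (i j : 'I_2).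

Let a := strain11 Omega eps_g w v.
Let b := strain22 Omega eps_g w v.
Let c := strain12 Omega eps_g w v.
Let k1 := bend11 Omega kappa_g v.
Let k2 := bend22 Omega kappa_g v.
Let k12 := bend12 Omega kappa_g v.

(** The components of [2 lm] times strain plus trace of the strain. The off-diagonal one has the
    factor [lm] only, since [c] is already twice the off-diagonal strain. *)
Definition stress11 z : R := 2 * lm * (2 * a z + b z).
Definition stress22 z : R := 2 * lm * (a z + 2 * b z).
Definition stress12 z : R := lm * c z.
Local Notation p := stress11.
Local Notation q := stress12.
Local Notation s := stress22.

Let sqi_fields : [/\ sqi (ext a), sqi (ext b) & sqi (ext c)] /\
  [/\ sqi (ext k1), sqi (ext k2) & sqi (ext k12)].
Proof.
have [fin _] := crit.
exact: (energy_finite oO OM lm0 Q2E eps_smooth kappa_smooth (sobolev_measurable_partials oO sw sv) fin).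
Qed.

Let sqi_stress : [/\ sqi (ext p), sqi (ext q) & sqi (ext s)].
Proof.
have [[sa sb sc] _] := sqi_fields.
have L (k l n : R) : sqi (ext (fun z => k * (l * a z + n * b z))).
  have := sqiZ k (sqiD (sqiZ l sa) (sqiZ n sb)); congr (sqi _).
  apply/funext => z; have [zO|zO] := pselect (Omega z); first by rewrite !extE.
  by rewrite !ext0// !mulr0 addr0 mulr0.
split; [have := L (2 * lm) 2 1|have := sqiZ lm sc|have := L (2 * lm) 1 2]; congr (sqi _).
- by apply/funext => z; congr (_ * _); rewrite /p mul1r.
- by apply/funext => z; rewrite extZ.
- by apply/funext => z; congr (_ * _); rewrite /s mul1r.
Qed.

Let bending_pointwise K1 K2 K12 X00 X11 X10 X01 x :
  ext (fun z => 2 * K1 z + K2 z) x * X00 x + ext (fun z => K1 z + 2 * K2 z) x * X11 x +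
  ext (fun z => 2^-1 * K12 z) x * (X10 x + X01 x) =
  qpolar (ext K1 x) (ext K2 x) (ext K12 x) (ext X00 x) (ext X11 x) (ext (fun z => X10 z + X01 z) x).
Proof.
have [xO|xO] := pselect (Omega x); last by rewrite !ext0// /qpolar; ring.
by rewrite !extE// /qpolar; field.
Qed.

Let membrane_pointwise A B C V0 V1 G00 G11 G10 G01 P0 P1 x :
  ext (fun z => 2 * lm * (2 * A z + B z)) x * (G00 x + ext V0 x * P0 x)
  + ext (fun z => 2 * lm * (A z + 2 * B z)) x * (G11 x + ext V1 x * P1 x)
  + ext (fun z => lm * C z) x * (G10 x + G01 x + (ext V0 x * P1 x + ext V1 x * P0 x)) =
  2 * lm * qpolar (ext A x) (ext B x) (ext C x) (ext (fun z => G00 z + V0 z * P0 z) x)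
    (ext (fun z => G11 z + V1 z * P1 z) x)
    (ext (fun z => G10 z + G01 z + (V0 z * P1 z + V1 z * P0 z)) x).
Proof.
have [xO|xO] := pselect (Omega x); last by rewrite !ext0// /qpolar; ring.
by rewrite !extE// /qpolar; field.
Qed.

(** [weak_euler_lagrange] multiplied by [2 lm], with the polar form read as stress against variation
    of strain; [lm / 6] is [2 lm / 12]. *)
Lemma stress_euler_lagrange (g : 'I_2 -> R * R -> R) psi : (forall i, smooth (g i)) ->
  smooth psi ->
  \int[mu]_x (ext p x * (D 0 (g 0) x + ext (wp 0 v) x * D 0 psi x)
    + ext s x * (D 1 (g 1) x + ext (wp 1 v) x * D 1 psi x)
    + ext q x * (D 1 (g 0) x + D 0 (g 1) x
        + (ext (wp 0 v) x * D 1 psi x + ext (wp 1 v) x * D 0 psi x)))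
  + lm / 6 * \int[mu]_x (ext (fun z => 2 * k1 z + k2 z) x * D 0 (D 0 psi) x
    + ext (fun z => k1 z + 2 * k2 z) x * D 1 (D 1 psi) x
    + ext (fun z => 2^-1 * k12 z) x * (D 1 (D 0 psi) x + D 0 (D 1 psi) x)) = 0.
Proof.
move=> sg spsi.
have [i1 H] := weak_euler_lagrange oO OM lm0 Q2E eps_smooth kappa_smooth sw sv crit sg spsi.
have lin (x y X Y : R) : x + 12^-1 * y = 0 -> X = 2 * lm * x -> Y = y -> X + lm / 6 * Y = 0.
  move=> h -> ->; transitivity (2 * lm * (x + 12^-1 * y)); first by field.
  by rewrite h mulr0.
apply: (lin _ _ _ _ H); last by apply: eq_Int => x; exact: bending_pointwise.
by apply: (etrans _ (IntZ (2 * lm) i1)); apply: eq_Int => x; exact: membrane_pointwise.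
Qed.

Let D0E (u z : R * R) : 'D_u (fun=> 0 : R) z = 0. Proof. exact: derive_cst. Qed.

Let DD0E (u u' z : R * R) : 'D_u ('D_u' (fun=> 0 : R)) z = 0.
Proof.
have E : 'D_u' (fun=> 0 : R) = (fun=> 0) :> (R * R -> R) by apply/funext => y; exact: D0E.
exact: (etrans (congr1 (fun h => 'D_u h z) E) (D0E u z)).
Qed.

Let divfree_of f g : sqi f -> sqi g -> boxed M f -> boxed M g ->
  (forall psi, smooth psi -> \int[mu]_x (f x * D 0 psi x + g x * D 1 psi x) = 0) ->
  divfree M f g.
Proof.
move=> sf sg fB gB H psi tpsi _.
have i0 := itgM_test (test_fun_derive (dir R 0) tpsi) (sqi_boxed fB sf).
have i1 := itgM_test (test_fun_derive (dir R 1) tpsi) (sqi_boxed gB sg).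
have := H psi tpsi.1; rewrite (IntD i0 i1) => /eqP.
by rewrite addr_eq0 => /eqP.
Qed.

(** In-plane variations [(psi, 0)] and [(0, psi)], with [psi] unrestricted at the boundary, give one
    row each. *)
Let divfree_pq : divfree M (ext p) (ext q) /\ divfree M (ext q) (ext s).
Proof.
have [sp sq ss] := sqi_stress; have s0 := @smooth_cst R 0.
have z0 : \int[mu]_x (ext (fun z => 2 * k1 z + k2 z) x * D 0 (D 0 (fun=> 0)) x
    + ext (fun z => k1 z + 2 * k2 z) x * D 1 (D 1 (fun=> 0)) x
    + ext (fun z => 2^-1 * k12 z) x * (D 1 (D 0 (fun=> 0)) x + D 0 (D 1 (fun=> 0)) x)) = 0.
  rewrite -[RHS](Int0 mu); apply: eq_Int => x.
  by rewrite !DD0E addr0 !mulr0 !addr0.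
have lin1 (P Q S A B C E V0 V1 x y : R) : C = 0 -> E = 0 -> x = 0 -> y = 0 ->
    P * A + Q * B = P * (A + V0 * x) + S * (C + V1 * y) + Q * (B + E + (V0 * y + V1 * x)).
  by move=> -> -> -> ->; ring.
have lin2 (P Q S A B C E V0 V1 x y : R) : C = 0 -> E = 0 -> x = 0 -> y = 0 ->
    Q * A + S * B = P * (C + V0 * x) + S * (B + V1 * y) + Q * (E + A + (V0 * y + V1 * x)).
  by move=> -> -> -> ->; ring.
split; apply: divfree_of => //; try exact: boxed_ext.
- move=> psi spsi; have sg i : smooth (sel psi (fun=> 0) i) by rewrite /sel; case: ifP.
  have := stress_euler_lagrange sg s0; rewrite z0 mulr0 addr0 => H; rewrite -[RHS]H.
  apply: eq_Int => x.
  exact: (lin1 _ _ _ _ _ _ _ _ _ _ _ (D0E (dir R 1) x) (D0E (dir R 0) x) (D0E (dir R 0) x) (D0E (dir R 1) x)).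
- move=> psi spsi; have sg i : smooth (sel (fun=> 0) psi i) by rewrite /sel; case: ifP.
  have := stress_euler_lagrange sg s0; rewrite z0 mulr0 addr0 => H; rewrite -[RHS]H.
  apply: eq_Int => x.
  exact: (lin2 _ _ _ _ _ _ _ _ _ _ _ (D0E (dir R 0) x) (D0E (dir R 1) x) (D0E (dir R 0) x) (D0E (dir R 1) x)).
Qed.

Let bending_split K1 K2 K12 (A B C C' : R) x : C' = C ->
  ext (fun z => 2 * K1 z + K2 z) x * A + ext (fun z => K1 z + 2 * K2 z) x * B +
  ext (fun z => 2^-1 * K12 z) x * (C' + C) =
  2 * (ext K1 x * A) + ext K2 x * A + ext K1 x * B + 2 * (ext K2 x * B) + ext K12 x * C.
Proof.
move=> ->; have [xO|xO] := pselect (Omega x); last by rewrite !ext0//; ring.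
by rewrite !extE//; field.
Qed.

Lemma bending_euler_lagrange phi : tst phi ->
  pair3 p (wp 0 v) (D 0 phi) + pair3 s (wp 1 v) (D 1 phi) + pair3 q (wp 0 v) (D 1 phi) +
  pair3 q (wp 1 v) (D 0 phi) + lm / 6 * (2 * pair2 k1 (D 0 (D 0 phi)) +
    pair2 k2 (D 0 (D 0 phi)) + pair2 k1 (D 1 (D 1 phi)) + 2 * pair2 k2 (D 1 (D 1 phi)) +
    pair2 k12 (D 0 (D 1 phi))) = 0.
Proof.
move=> tphi; have [sp sq ss] := sqi_stress; have [_ [sk1 sk2 sk12]] := sqi_fields.
have [_ _ s1] := sobolev1_wpartial oO (sobolevS oO sv).
have t0 := test_fun_derive (dir R 0) tphi; have t1 := test_fun_derive (dir R 1) tphi.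
have t00 := test_fun_derive (dir R 0) t0; have t11 := test_fun_derive (dir R 1) t1.
have t01 := test_fun_derive (dir R 0) t1.
have sg (i : 'I_2) : smooth (fun=> 0 : R) := @smooth_cst R 0.
have H := stress_euler_lagrange sg tphi.1.
have i1 := itg_pair3 sp (s1 0) t0; have i2 := itg_pair3 ss (s1 1) t1.
have i3 := itg_pair3 sq (s1 0) t1; have i4 := itg_pair3 sq (s1 1) t0.
have j1 := itg_pair2 sk1 t00; have j2 := itg_pair2 sk2 t00; have j3 := itg_pair2 sk1 t11.
have j4 := itg_pair2 sk2 t11; have j5 := itg_pair2 sk12 t01.
have E1 := IntD (itgD (itgD i1 i2) i3) i4; have E2 := IntD (itgD i1 i2) i3; have E3 := IntD i1 i2.
have F1 := IntD (itgD (itgD (itgD (itgZ 2 j1) j2) j3) (itgZ 2 j4)) j5.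
have F2 := IntD (itgD (itgD (itgZ 2 j1) j2) j3) (itgZ 2 j4).
have F3 := IntD (itgD (itgZ 2 j1) j2) j3; have F4 := IntD (itgZ 2 j1) j2.
have F5 := IntZ 2 j1; have F6 := IntZ 2 j4.
have lin (X Y x1 x2 x3 x4 x12 x123 y1 y2 y3 y4 y5 y12 y123 y1234 z1 z4 X' Y' : R) :
    X + lm / 6 * Y = 0 -> X' = x123 + x4 -> x123 = x12 + x3 -> x12 = x1 + x2 ->
    Y' = y1234 + y5 -> y1234 = y123 + z4 -> y123 = y12 + y3 -> y12 = z1 + y2 ->
    z1 = 2 * y1 -> z4 = 2 * y4 -> X = X' -> Y = Y' ->
    x1 + x2 + x3 + x4 + lm / 6 * (2 * y1 + y2 + y3 + 2 * y4 + y5) = 0.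
  by move=> h -> -> -> -> -> -> -> -> -> e e'; move: h; rewrite e e'.
apply: (lin _ _ _ _ _ _ _ _ _ _ _ _ _ _ _ _ _ _ _ _ H E1 E2 E3 F1 F2 F3 F4 F5 F6).
- apply: eq_Int => x; have lin1 (P Q S V0 V1 C C' E E' A B : R) : C = 0 -> C' = 0 ->
      E = 0 -> E' = 0 -> P * (C + V0 * A) + S * (C' + V1 * B) + Q * (E + E' + (V0 * B + V1 * A)) =
      P * (V0 * A) + S * (V1 * B) + Q * (V0 * B) + Q * (V1 * A).
    by move=> -> -> -> ->; ring.
  exact: (lin1 _ _ _ _ _ _ _ _ _ _ _ (D0E _ x) (D0E _ x) (D0E _ x) (D0E _ x)).
- apply: eq_Int => x; have c10 := congr1 (fun h => h x) (derive01 tphi).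
  exact: bending_split.
Qed.

Section potential.
Variables (Phi P Q : R * R -> R).
Hypothesis sPhi : sobolev Omega 2 Phi.
Hypothesis WPhi : W22 Omega Phi P Q (ext s) (fun z => - ext q z) (ext p).

Let minor22_sym (A : 'M[R]_3) : minor22 (sym A) 0 1 = minor22 (sym A) 1 0.
Proof. by rewrite !mxE addrC. Qed.

(** [WPhi] says that the Hessian of [Phi] is the cofactor of the stress, and [cof] is an involution
    on 2 by 2 matrices. *)
Lemma stress_cof : \forall x \ae mu, Omega x -> cof (whess Omega Phi x) =
  (2 * lm) *: (sym (wjac Omega w x) + 2^-1 *: tensor (wgrad Omega v x) (wgrad Omega v x)
    - minor22 (sym (eps_g x))
    + (wdiv Omega w x + \tr (2^-1 *: tensor (wgrad Omega v x) (wgrad Omega v x)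
        - minor22 (sym (eps_g x))))%:M).
Proof.
have H := W22_whess oO WPhi; apply: filterS H => z H zO; have [h00 h01 h10 h11] := H zO.
have -> : wdiv Omega w z = wjac Omega w z 0 0 + wjac Omega w z 1 1.
  by rewrite /wdiv sum_ord2 !mxE.
apply: stress_strain.
- exact: minor22_sym.
- by rewrite h11 extE// /stress11 /a /b /strain11 /strain22 /sym22; move: (minor22 _) => E; rewrite !mxE.
- by rewrite h01 extE// /stress12 /c /strain12 /sym22; move: (minor22 _) => E; rewrite !mxE.
- by rewrite h10 extE// /stress12 /c /strain12 /sym22; move: (minor22 _) => E; rewrite !mxE.
- by rewrite h00 extE// /stress22 /a /b /strain11 /strain22 /sym22; move: (minor22 _) => E; rewrite !mxE.
Qed.

Let sqi_closure f : smooth_closure Omega f -> sqi (ext f).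
Proof.
move=> /smooth_closure_agree[g sg fg]; rewrite (agree_ext fg).
exact: sqi_ext_smooth oO M OM g sg.
Qed.

Let sqi_ee i j : sqi (ext (ee i j)). Proof. exact/sqi_closure/smooth_closure_sym22. Qed.
Let sqi_kk i j : sqi (ext (kk i j)). Proof. exact/sqi_closure/smooth_closure_sym22. Qed.

Let Wv := sobolev2_W22 oO sv.
Let tD i phi : tst phi -> tst (D i phi). Proof. exact: test_fun_derive. Qed.

Let sqi_extD f g : sqi (ext f) -> sqi (ext g) -> sqi (ext (fun z => f z + g z)).
Proof.
by move=> sf sg; have := sqiD sf sg; congr (sqi _); apply/funext => z; rewrite extD.
Qed.

Let sqi_extZ (k : R) f : sqi (ext f) -> sqi (ext (fun z => k * f z)).
Proof. by move=> sf; have := sqiZ k sf; congr (sqi _); apply/funext => z; rewrite extZ. Qed.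

Let pair2_lin (k l n : R) f g chi : sqi (ext f) -> sqi (ext g) -> tst chi ->
  pair2 (fun z => k * (l * f z + n * g z)) chi = k * (l * pair2 f chi + n * pair2 g chi).
Proof.
move=> sf sg tchi; have [slf sng] := (sqi_extZ l sf, sqi_extZ n sg).
by rewrite (pair2Z k (sqi_extD slf sng) tchi) (pair2D slf sng tchi) !pair2Z.
Qed.

Let pair2_p chi : tst chi -> pair2 p chi = 2 * lm * (2 * pair2 a chi + pair2 b chi).
Proof.
move=> tchi; have [[sa sb _] _] := sqi_fields; rewrite -[pair2 b chi]mul1r.
rewrite -(pair2_lin (2 * lm) 2 1 sa sb tchi).
by apply: eq_pair2 => z _; rewrite /stress11 mul1r.
Qed.

Let pair2_s chi : tst chi -> pair2 s chi = 2 * lm * (pair2 a chi + 2 * pair2 b chi).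
Proof.
move=> tchi; have [[sa sb _] _] := sqi_fields; rewrite -[pair2 a chi]mul1r.
rewrite -(pair2_lin (2 * lm) 1 2 sa sb tchi).
by apply: eq_pair2 => z _; rewrite /stress22 mul1r.
Qed.

Let pair2_q chi : tst chi -> pair2 q chi = lm * pair2 c chi.
Proof. by move=> tchi; have [[_ _ sc] _] := sqi_fields; exact: pair2Z. Qed.

Let pair2_nq chi : tst chi -> pair2 (fun z => - ext q z) chi = - pair2 q chi.
Proof.
move=> tchi; have [_ sq _] := sqi_stress; rewrite -mulN1r -(pair2Z (-1) sq tchi).
by apply: eq_pair2 => z zO; rewrite extE// mulN1r.
Qed.

                                                                               
(** Saint-Venant compatibility, one cancellation per component of the displacement: both sides are
    that component tested against the same third derivative of [phi]. *)
Let displacement_compat f f0 f1 g g0 g1 phi : is_weak_partial Omega 0 f f0 ->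
  is_weak_partial Omega 1 f f1 -> is_weak_partial Omega 0 g g0 ->
  is_weak_partial Omega 1 g g1 -> tst phi ->
  pair2 f0 (D 1 (D 1 phi)) = pair2 f1 (D 0 (D 1 phi)) /\
  pair2 g1 (D 0 (D 0 phi)) = pair2 g0 (D 0 (D 1 phi)).
Proof.
move=> /is_weak_partialE[_ _ F0] /is_weak_partialE[_ _ F1] /is_weak_partialE[_ _ G0].
move=> /is_weak_partialE[_ _ G1] tphi; have t0 := tD 0 tphi; have t1 := tD 1 tphi.
have c1 := congr1 (pair2 f) (derive01 t1); have c0 := congr1 (pair2 g) (derive01 t0).
have cc := congr1 (fun chi => pair2 g (D 0 chi)) (derive01 tphi).
split; apply: oppr_inj.
  exact: (etrans (esym (F0 _ (tD 1 t1))) (etrans (esym c1) (F1 _ (tD 0 t1)))).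
exact: (etrans (esym (G1 _ (tD 0 t0))) (etrans c0 (etrans cc (G0 _ (tD 0 t1))))).
Qed.

Let inner_cof_pairing (G F : 'M[R]_2) (x00 x01 x11 y00 y01 y11 t : R) :
  F 0 0 = x00 -> F 0 1 = x01 -> F 1 0 = x01 -> F 1 1 = x11 ->
  G 0 0 = y00 -> G 0 1 = y01 -> G 1 0 = y01 -> G 1 1 = y11 ->
  inner G (cof F) * t = x11 * (y00 * t) + x00 * (y11 * t) - 2 * (x01 * (y01 * t)).
Proof. by move=> e1 e2 e3 e4 e5 e6 e7 e8; rewrite inner_cof22 e1 e2 e3 e4 e5 e6 e7 e8; ring. Qed.

Let ext_inner_cof (G F : R * R -> 'M[R]_2) : ext (fun z => inner (G z) (cof (F z))) =
  fun z => ext (fun z => G z 0 0) z * ext (fun z => F z 1 1) z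
    + ext (fun z => G z 1 1) z * ext (fun z => F z 0 0) z
    - ext (fun z => G z 0 1) z * ext (fun z => F z 1 0) z
    - ext (fun z => G z 1 0) z * ext (fun z => F z 0 1) z.
Proof.
apply/funext => z; have [zO|zO] := pselect (Omega z); first by rewrite !extE// inner_cof22.
by rewrite !ext0// !mulr0 addr0 !subr0.
Qed.

(** The bracket is defined with chosen representatives of second derivatives; they agree almost
    everywhere with the fields of any [W22] structure. *)
Lemma regular_airy f f0 f1 h00 h01 h11 g g0 g1 k00 k01 k11 phi :
  sobolev Omega 2 f -> sobolev Omega 2 g -> W22 Omega f f0 f1 h00 h01 h11 ->
  W22 Omega g g0 g1 k00 k01 k11 -> tst phi ->
  regular Omega (airy Omega g f) phi =
  pair3 h11 k00 phi + pair3 h00 k11 phi - 2 * pair3 h01 k01 phi.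
Proof.
move=> sf sg Wf Wg tphi; have [_ [s00 s01 s11]] := W22_sqi Wf.
have [_ [r00 r01 r11]] := W22_sqi Wg.
have i1 := itg_pair3 s11 r00 tphi; have i2 := itg_pair3 s00 r11 tphi.
have i3 := itgZ 2 (itg_pair3 s01 r01 tphi).
have E1 := IntD i1 i2; have E2 := IntB (itgD i1 i2) i3; have E3 := IntZ 2 (itg_pair3 s01 r01 tphi).
apply: (etrans _ (etrans E2 (congr2 (fun x y => x - y) E1 E3))); rewrite regularE.
have mw (h : R * R -> R) i j : sobolev Omega 2 h ->
    measurable_fun [set: M2] (ext (fun z => whess Omega h z i j)).
  move=> sh; have [_ _ sh1] := sobolev2_wpartial oO sh.
  have [_ _ /(_ j)[mh _]] := sobolev1_wpartial oO (sh1 i).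
  by rewrite (agree_ext (g := wp j (wp i h)))// => z _; rewrite mxE.
apply: Int_ae; last 1 first.
- apply: filterS2 (W22_whess oO Wf) (W22_whess oO Wg) => z Hf Hg.
  have [zO|zO] := pselect (Omega z); last by rewrite !ext0//; ring.
  have [f00 f01 f10 f11] := Hf zO; have [g00 g01 g10 g11] := Hg zO.
  rewrite !extE//; exact: inner_cof_pairing.
- apply: measurable_funM; last exact: test_msr tphi.
  rewrite (_ : ext _ = fun z => ext (fun z => whess Omega g z 0 0) z * ext (fun z => whess Omega f z 1 1) z
    + ext (fun z => whess Omega g z 1 1) z * ext (fun z => whess Omega f z 0 0) z
    - ext (fun z => whess Omega g z 0 1) z * ext (fun z => whess Omega f z 1 0) z
    - ext (fun z => whess Omega g z 1 0) z * ext (fun z => whess Omega f z 0 1) z).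
    have mg i j := mw g i j sg; have mf i j := mw f i j sf.
    exact: (measurable_funB (measurable_funB (measurable_funD (measurable_funM (mg 0 0) (mf 1 1))
      (measurable_funM (mg 1 1) (mf 0 0))) (measurable_funM (mg 0 1) (mf 1 0)))
      (measurable_funM (mg 1 0) (mf 0 1))).
  exact: ext_inner_cof.
- exact: itg_msr (itgB (itgD i1 i2) i3).
Qed.

Let dpartial2_pair2 i j f phi :
  dpartial i (dpartial j (regular Omega f)) phi = pair2 f (D j (D i phi)).
Proof. exact: etrans (dpartial2E _ _ _ _) (regular_pair2 _ _ _). Qed.

Let curlTcurl_pair2 A phi : curlTcurl Omega A phi =
  pair2 (fun x => A x 0 0) (D 1 (D 1 phi)) - pair2 (fun x => A x 0 1 + A x 1 0) (D 1 (D 0 phi))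
  + pair2 (fun x => A x 1 1) (D 0 (D 0 phi)).
Proof.
have e := dpartial2_pair2; exact: (congr2 +%R (congr2 (fun x y => x - y) (e 1 1 _ phi) (e 0 1 _ phi)) (e 0 0 _ phi)).
Qed.

Let sum_ord22 (F : 'I_2 -> 'I_2 -> R) :
  \sum_i \sum_j F i j = F 0 0 + F 0 1 + (F 1 0 + F 1 1).
Proof. by rewrite sum_ord2 !sum_ord2. Qed.

Let divTdiv_pair2 A phi : divTdiv Omega A phi =
  pair2 (fun x => A x 0 0) (D 0 (D 0 phi)) + pair2 (fun x => A x 0 1) (D 1 (D 0 phi))
  + (pair2 (fun x => A x 1 0) (D 0 (D 1 phi)) + pair2 (fun x => A x 1 1) (D 1 (D 1 phi))).
Proof.
have e := dpartial2_pair2.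
apply: (etrans (sum_ord22 (fun i j => dpartial i (dpartial j (regular Omega (fun x => A x i j))) phi))).
exact: (congr2 +%R (congr2 +%R (e 0 0 _ phi) (e 0 1 _ phi)) (congr2 +%R (e 1 0 _ phi) (e 1 1 _ phi))).
Qed.

(** [curl^T curl] sees only the sum of the off-diagonal entries, so [eps_g] may be symmetrised. *)
Let curlTcurlE phi : tst phi -> curlTcurl Omega (fun x => minor22 (eps_g x)) phi =
  pair2 (ee 0 0) (D 1 (D 1 phi)) - pair2 (fun z => ee 0 1 z + ee 1 0 z) (D 0 (D 1 phi))
  + pair2 (ee 1 1) (D 0 (D 0 phi)).
Proof.
move=> tphi; apply: (etrans (curlTcurl_pair2 _ _)).
have cc := congr1 (pair2 (fun z => ee 0 1 z + ee 1 0 z)) (derive01 tphi).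
have eqs (f g : R * R -> R) chi : (forall z, f z = g z) -> pair2 f chi = pair2 g chi.
  by move=> fg; apply: eq_pair2 => z _.
have h (x : R) : x = 2^-1 * (x + x) by field.
have h2 (x y : R) : x + y = 2^-1 * (x + y) + 2^-1 * (y + x) by field.
apply: (congr2 +%R (congr2 (fun x y => x - y) _ (etrans _ cc))); apply: eqs => z;
  rewrite /sym22 /minor22 /sym !mxE; [exact: h|exact: h2|exact: h].
Qed.

(** The left side is [curl^T curl] of the strain: the displacement drops out by
    [displacement_compat] and the quadratic term is evaluated by [det_byparts]. *)
Let strain_compat phi : tst phi ->
  pair2 a (D 1 (D 1 phi)) + pair2 b (D 0 (D 0 phi)) - pair2 c (D 0 (D 1 phi)) =
  - 2^-1 * regular Omega (airy Omega v v) phi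
  - curlTcurl Omega (fun x => minor22 (eps_g x)) phi.
Proof.
move=> tphi; have t0 := tD 0 tphi; have t1 := tD 1 tphi.
have [_ _ sv1] := sobolev1_wpartial oO (sobolevS oO sv).
have [_ w0 sw0] := sobolev1_wpartial oO (sw 0); have [_ w1 sw1] := sobolev1_wpartial oO (sw 1).
have ea := pair2_square (sw0 0) (sv1 0) (sqi_ee 0 0) (tD 1 t1).
have eb := pair2_square (sw1 1) (sv1 1) (sqi_ee 1 1) (tD 0 t0).
have ec := pair2_product (sw0 1) (sw1 0) (sv1 0) (sv1 1) (sqi_ee 0 1) (sqi_ee 1 0) (tD 0 t1).
have [d0 d1] := displacement_compat (w0 0) (w0 1) (w1 0) (w1 1) tphi.
have dv := det_byparts oO M0 OM Wv tphi.
have av := regular_airy sv sv Wv Wv tphi.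
have cv := pair3C Omega (wp 1 (wp 1 v)) (wp 0 (wp 0 v)) phi.
have cE := curlTcurlE tphi.
exact: (strain_lin ea eb ec d0 d1 dv av cv cE).
Qed.

(** The bilaplacian of [Phi] is a sum of stress pairings, and symmetry of its Hessian
    ([pair2_compat]) supplies the two extra relations with which [compat_lin] inverts the
    stress-strain law. *)
Lemma airy_compatibility phi : tst phi ->
  dlaplacian (dlaplacian (regular Omega Phi)) phi =
  - (3 * lm / 2) * regular Omega (airy Omega v v) phi
  - 3 * lm * curlTcurl Omega (fun x => minor22 (eps_g x)) phi.
Proof.
move=> tphi; have t0 := tD 0 tphi; have t1 := tD 1 tphi.
have e := bilaplacianE WPhi tphi; have [c0 c1] := pair2_compat WPhi tphi.
have s0 := etrans (@pair2_ext R Omega s _) (pair2_s (tD 0 t0)).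
have s1 := etrans (@pair2_ext R Omega s _) (pair2_s (tD 1 t1)).
have p0 := etrans (@pair2_ext R Omega p _) (pair2_p (tD 0 t0)).
have p1 := etrans (@pair2_ext R Omega p _) (pair2_p (tD 1 t1)).
have q1 := etrans (pair2_nq (tD 0 t1)) (congr1 -%R (pair2_q (tD 0 t1))).
exact: (compat_lin e c0 c1 s0 s1 p0 p1 q1 (strain_compat tphi)).
Qed.

Let divTdivE phi : tst phi -> divTdiv Omega
    (fun x => minor22 (sym (kappa_g x)) + 2^-1 *: cof (minor22 (sym (kappa_g x)))) phi =
  pair2 (kk 0 0) (D 0 (D 0 phi)) + 2^-1 * pair2 (kk 1 1) (D 0 (D 0 phi)) +
  2^-1 * (pair2 (kk 0 1) (D 0 (D 1 phi)) + pair2 (kk 1 0) (D 0 (D 1 phi))) +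
  (2^-1 * pair2 (kk 0 0) (D 1 (D 1 phi)) + pair2 (kk 1 1) (D 1 (D 1 phi))).
Proof.
move=> tphi; have t0 := tD 0 tphi; have t1 := tD 1 tphi.
set A := (fun x => _ + _ : 'M[R]_2).
have AE i j f g (k : R) chi : (forall z, A z i j = 1 * f z + k * g z) -> sqi (ext f) -> sqi (ext g) ->
    tst chi -> pair2 (fun z => A z i j) chi = pair2 f chi + k * pair2 g chi.
  move=> H sf sg tchi; have := pair2_lin 1 1 k sf sg tchi; rewrite !mul1r => <-.
  by apply: eq_pair2 => z _; rewrite H !mul1r.
have cf z := cof22 (minor22 (sym (kappa_g z))).
have AijE z i j : A z i j = kk i j z + 2^-1 * cof (minor22 (sym (kappa_g z))) i j.
  by rewrite /A /sym22; move: (minor22 _) => K; rewrite mxE [X in _ + X]mxE.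
have A00 z : A z 0 0 = 1 * kk 0 0 z + 2^-1 * kk 1 1 z.
  by rewrite AijE mul1r; have [-> _ _ _] := cf z.
have A01 z : A z 0 1 = 1 * kk 0 1 z + - 2^-1 * kk 1 0 z.
  by rewrite AijE mul1r; have [_ -> _ _] := cf z; rewrite mulrN mulNr.
have A10 z : A z 1 0 = 1 * kk 1 0 z + - 2^-1 * kk 0 1 z.
  by rewrite AijE mul1r; have [_ _ -> _] := cf z; rewrite mulrN mulNr.
have A11 z : A z 1 1 = 1 * kk 1 1 z + 2^-1 * kk 0 0 z.
  by rewrite AijE mul1r; have [_ _ _ ->] := cf z.
have e00 := AE _ _ _ _ _ _ A00 (sqi_kk 0 0) (sqi_kk 1 1) (tD 0 t0).
have e01 := AE _ _ _ _ _ _ A01 (sqi_kk 0 1) (sqi_kk 1 0) (tD 0 t1).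
have e10 := AE _ _ _ _ _ _ A10 (sqi_kk 1 0) (sqi_kk 0 1) (tD 0 t1).
have e11 := AE _ _ _ _ _ _ A11 (sqi_kk 1 1) (sqi_kk 0 0) (tD 1 t1).
have cc := congr1 (pair2 (fun z => A z 0 1)) (derive01 tphi).
apply: (etrans (divTdiv_pair2 _ _)).
exact: (div_lin e00 cc e01 e10 e11).
Qed.

(** The membrane terms of [bending_euler_lagrange] are the stress acting on the gradient of [v],
    paired with the gradient of [phi]. As the stress is the cofactor of the Hessian of [Phi],
    [airy_byparts] turns them into minus the bracket. *)
Lemma airy_equilibrium phi : tst phi ->
  lm / 3 * dlaplacian (dlaplacian (regular Omega v)) phi =
  regular Omega (airy Omega v Phi) phi
  - lm / 3 * divTdiv Omega
      (fun x => minor22 (sym (kappa_g x)) + 2^-1 *: cof (minor22 (sym (kappa_g x)))) phi.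
Proof.
move=> tphi; have t0 := tD 0 tphi; have t1 := tD 1 tphi.
have [sp sq ss] := sqi_stress; have [_ [s00 s01 s11]] := W22_sqi Wv.
have [_ _ sv1] := sobolev1_wpartial oO (sobolevS oO sv).
have e := bilaplacianE Wv tphi; have [c0 c1] := pair2_compat Wv tphi.
have B := bending_euler_lagrange tphi; have dE := divTdivE tphi.
have av := etrans (regular_airy sPhi sv WPhi Wv tphi) (airy_byparts oO M0 OM WPhi Wv tphi).
have x1 := @pair3_ext R Omega p (wp 0 v) (D 0 phi); have x2 := @pair3_ext R Omega s (wp 1 v) (D 1 phi).
have sqe f : sqi (ext f) -> sqi (ext (ext f)) by rewrite (agree_ext (@agree_ext_id _ _ f)).
have x3 := etrans (pair3N (sqe _ sq) (sv1 0) t1) (congr1 -%R (@pair3_ext R Omega q (wp 0 v) (D 1 phi))).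
have x4 := etrans (pair3N (sqe _ sq) (sv1 1) t0) (congr1 -%R (@pair3_ext R Omega q (wp 1 v) (D 0 phi))).
have y1 := pair2D s00 (sqi_kk 0 0) (tD 0 t0); have y2 := pair2D s11 (sqi_kk 1 1) (tD 0 t0).
have y3 := pair2D s00 (sqi_kk 0 0) (tD 1 t1); have y4 := pair2D s11 (sqi_kk 1 1) (tD 1 t1).
have [_ _ v2] := sobolev2_wpartial oO sv; have [_ w1 sw1] := sobolev1_wpartial oO (v2 1).
have s10 := sw1 0.
have y5 := pair2D (sqi_extD s01 s10) (sqi_extD (sqi_kk 0 1) (sqi_kk 1 0)) (tD 0 t1).
have y6 := pair2D s01 s10 (tD 0 t1); have y7 := pair2D (sqi_kk 0 1) (sqi_kk 1 0) (tD 0 t1).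
(* [bend12] contains both mixed representatives while [Wv] keeps one; they agree almost
   everywhere. *)
have y8 : pair2 (wp 0 (wp 1 v)) (D 0 (D 1 phi)) = pair2 (wp 1 (wp 0 v)) (D 0 (D 1 phi)).
  have [_ _ [_ _ /(_ 0) w10]] := Wv; have U := weak_partial_unique oO (w1 0) w10.
  exact: Int_ext_ae (sqi_loc s10) (sqi_loc s01) U (tD 0 t1).
exact: (equil_lin e c0 c1 B av x1 x2 x3 x4
  y1 y2 y3 y4 y5 y6 y7 y8 dE).
Qed.

End potential.

Lemma airy_potential : exists Phi : R * R -> R,
  [/\ sobolev Omega 2 Phi,
      (\forall x \ae mu, Omega x -> cof (whess Omega Phi x) =
        (2 * lm) *: (sym (wjac Omega w x) + 2^-1 *: tensor (wgrad Omega v x) (wgrad Omega v x)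
          - minor22 (sym (eps_g x))
          + (wdiv Omega w x + \tr (2^-1 *: tensor (wgrad Omega v x) (wgrad Omega v x)
              - minor22 (sym (eps_g x))))%:M)),
      (forall phi, tst phi -> dlaplacian (dlaplacian (regular Omega Phi)) phi =
        - (3 * lm / 2) * regular Omega (airy Omega v v) phi
        - 3 * lm * curlTcurl Omega (fun x => minor22 (eps_g x)) phi) &
      (forall phi, tst phi -> lm / 3 * dlaplacian (dlaplacian (regular Omega v)) phi =
        regular Omega (airy Omega v Phi) phi
        - lm / 3 * divTdiv Omega
            (fun x => minor22 (sym (kappa_g x)) + 2^-1 *: cof (minor22 (sym (kappa_g x)))) phi)].
Proof.
have [sp sq ss] := sqi_stress; have [dpq dqs] := divfree_pq.
have [Phi [sPhi [P [Q [W1 W2 W3]]]]] := stress_potential oO M0 OM sp sq ss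
  (boxed_ext OM p) (boxed_ext OM q) (boxed_ext OM s) dpq dqs.
have WPhi : W22 Omega Phi P Q (ext s) (fun z => - ext q z) (ext p) by exact: And3 W1 W2 W3.
by exists Phi; split; [exact: sPhi|exact: stress_cof WPhi|exact: airy_compatibility WPhi|
  exact: airy_equilibrium sPhi WPhi].
Qed.

End airy_potential.

(** * The degenerate case of zero shear modulus *)

Section zero_potential.
Variable R : realType.
Variable Omega : set (R * R).
Hypothesis oO : open Omega.
Variable M : R.
Hypothesis M0 : 0 < M.
Hypothesis OM : Omega `<=` obox (- M) M (- M) M.
Local Opaque wpartial derive.
Local Notation mu := (@leb2 R).
Local Notation ext := (ext Omega).
Local Notation Z := (fun=> 0 : R).

Let ext_zero : ext Z = Z.
Proof. by apply/funext => z; exact: mulr0. Qed.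

Let sqi_zero : sqi mu (ext Z).
Proof. exact: (sqi_ext_smooth oO OM (@smooth_cst R 0)). Qed.

Lemma pair2_zero chi : pair2 Omega Z chi = 0.
Proof. by rewrite -[RHS](Int0 mu); apply: eq_Int => z; rewrite ext_zero mul0r. Qed.

Lemma pair3_zero f chi : pair3 Omega Z f chi = 0.
Proof. by rewrite -[RHS](Int0 mu); apply: eq_Int => z; rewrite ext_zero mul0r. Qed.

Lemma weak_partial_zero i : is_weak_partial Omega i Z Z.
Proof.
apply/is_weak_partialE; split; [exact: sqi_loc sqi_zero|exact: sqi_loc sqi_zero|].
move=> phi _; exact: (etrans (pair2_zero _) (etrans (esym (oppr0 _)) (congr1 -%R (esym (pair2_zero _))))).
Qed.

Lemma W22_zero : W22 Omega Z Z Z Z Z Z.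
Proof.
have H : W12 Omega Z (sel Z Z).
  exact: (W12_sel sqi_zero sqi_zero sqi_zero (weak_partial_zero 0) (weak_partial_zero 1)).
by split; exact: H.
Qed.

Lemma sobolev_zero k : sobolev Omega k Z.
Proof.
elim: k => [|k IH]; first by split=> //; apply/sqi_L2.
by split; [apply/sqi_L2|move=> i; exists Z; [exact: weak_partial_zero|exact: IH]].
Qed.

Lemma bilaplacian_zero phi : test_fun Omega phi ->
  dlaplacian (dlaplacian (regular Omega Z)) phi = 0.
Proof.
move=> tphi; have s0 : 0 + 0 + (0 + 0) = 0 :> R by rewrite !addr0.
have z := pair2_zero; apply: (etrans (bilaplacianE W22_zero tphi)).
exact: (etrans (congr2 +%R (congr2 +%R (z _) (z _)) (congr2 +%R (z _) (z _))) s0).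
Qed.

Lemma cof_whess_zero : \forall x \ae mu, Omega x -> cof (whess Omega Z x) = 0.
Proof.
have H := W22_whess oO W22_zero; apply: filterS H => z H zO; have [h00 h01 h10 h11] := H zO.
have [c00 c01 c10 c11] := cof22 (whess Omega Z z).
apply/matrixP; apply: forall_ord2; apply: forall_ord2; rewrite [RHS]mxE.
- exact: etrans c00 h11.
- exact: etrans c01 (etrans (congr1 -%R h10) (oppr0 _)).
- exact: etrans c10 (etrans (congr1 -%R h01) (oppr0 _)).
- exact: etrans c11 h00.
Qed.

Lemma regular_airy_zero v phi : sobolev Omega 2 v -> test_fun Omega phi ->
  regular Omega (airy Omega v Z) phi = 0.
Proof.
move=> sv tphi; have H := regular_airy oO (sobolev_zero 2) sv W22_zero (sobolev2_W22 oO sv) tphi.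
have s0 : 0 + 0 - 2 * 0 = 0 :> R by rewrite mulr0 addr0 subr0.
have z := pair3_zero; apply: (etrans H).
exact: (etrans (congr2 (fun x y => x - 2 * y) (congr2 +%R (z _ _) (z _ _)) (z _ _)) s0).
Qed.

End zero_potential.

(** * The Euler-Lagrange equations on a bounded domain *)

Lemma bounded_set_obox (R : realType) (Omega : set (R * R)) : bounded_set Omega ->
  exists2 M : R, 0 < M & Omega `<=` obox (- M) M (- M) M.
Proof.
(* One unit makes the bound admissible in [bounded_set], the second makes the inequalities of the
   open box strict. *)
move=> [B [_ BP]]; pose M := Num.max 0 B + 2; have M0 : 0 < M.
  by rewrite ltr_wpDl// le_max lexx.
exists M => // z zO; have : `|z| <= Num.max 0 B + 1.
  by apply: BP => //; rewrite (@le_lt_trans _ _ (Num.max 0 B)) ?le_max ?lexx ?orbT// ltrDl.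
rewrite /Num.norm/= => zM.
have [z1 z2] : `|z.1| < M /\ `|z.2| < M.
  by split; apply: (@le_lt_trans _ _ (Num.max 0 B + 1)); rewrite ?ltrD2l ?ltr1n//;
    apply: le_trans zM; rewrite le_max lexx ?orbT.
by rewrite oboxE -!ltr_norml.
Qed.

Theorem mainTheorem2 (R : realType) (Omega : set (R * R))
  (Omega_open : open Omega)
  (Omega_bounded : bounded_set Omega)
  (Omega_sc : simply_connected Omega)
  (eps_g kappa_g : R * R -> 'M[R]_3)
  (eps_smooth : forall i j, smooth_closure Omega (fun x => eps_g x i j))
  (kappa_smooth : forall i j, smooth_closure Omega (fun x => kappa_g x i j))
  (W : 'M[R]_3 -> R)
  (W_ge0 : forall F, 0 <= W F)
  (W_frame : forall Q F, SO3 Q -> W (Q *m F) = W F)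
  (W_id : W 1%:M = 0)
  (W_coercive : exists2 c : R, 0 < c & forall F, c * dist_SO3 F ^+ 2 <= W F)
  (W_C2 : exists2 delta : R, 0 < delta &
            Ck_on 2 [set F : 'M[R]_3 | dist_SO3 F < delta] W)
  (W_isotropic : forall F Q, SO3 Q -> W (F *m Q) = W F) :
  exists mu lambda : R,
    (forall F, Q3 W F = 2 * mu * frob (sym F) ^+ 2 + lambda * `|\tr F| ^+ 2) /\
    forall (w : R * R -> 'cV[R]_2) (v : R * R -> R),
      (forall i, sobolev Omega 1 (fun x => w x i 0)) ->
      sobolev Omega 2 v ->
      critical_point Omega W eps_g kappa_g w v ->
      exists Phi : R * R -> R,
        [/\ sobolev Omega 2 Phi,
            (\forall x \ae @leb2 R, Omega x ->
              cof (whess Omega Phi x) =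
                (2 * mu) *:
                (sym (wjac Omega w x)
                 + 2^-1 *: tensor (wgrad Omega v x) (wgrad Omega v x)
                 - minor22 (sym (eps_g x))
                 + (wdiv Omega w x
                    + \tr (2^-1 *: tensor (wgrad Omega v x) (wgrad Omega v x)
                           - minor22 (sym (eps_g x))))%:M)),
            (forall phi, test_fun Omega phi ->
              dlaplacian (dlaplacian (regular Omega Phi)) phi =
                - (3 * mu / 2) * regular Omega (airy Omega v v) phi
                - 3 * mu * curlTcurl Omega (fun x => minor22 (eps_g x)) phi) &
            (forall phi, test_fun Omega phi ->
              mu / 3 * dlaplacian (dlaplacian (regular Omega v)) phi =
                regular Omega (airy Omega v Phi) phi
                - mu / 3 * divTdiv Omega
                    (fun x => minor22 (sym (kappa_g x))
                              + 2^-1 *: cof (minor22 (sym (kappa_g x)))) phi)].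
Proof.
have [mu [lambda [mu_ge0 Q3E]]] := Q3_isotropic W_ge0 W_frame W_id W_C2 W_isotropic.
exists mu, lambda; split=> // w v sw sv crit.
have [M M0 OM] := bounded_set_obox Omega_bounded.
have Q2E F : Q2In W F = 2 * mu * normQ2 F := Q2In_isotropic F mu_ge0 Q3E.
(* The construction of the stress potential divides by [mu]. When [mu = 0] the prescribed stress is
   zero and every term with a factor [mu] vanishes, so the zero potential does. *)
have [mu0|mu_neq0] := eqVneq mu 0; last first.
  have mu_gt0 : 0 < mu by rewrite lt_def mu_neq0.
  exact: (airy_potential Omega_open M0 OM mu_gt0 Q2E eps_smooth kappa_smooth sw sv crit).
exists (fun=> 0); split.
- exact: sobolev_zero OM 2.
- have H := cof_whess_zero Omega_open OM; apply: filterS H => x H xO.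
  by rewrite (H xO) mu0 mulr0 scale0r.
- move=> phi tphi; apply: (etrans (bilaplacian_zero Omega_open OM tphi)).
  have z (x y : R) : 0 = - (3 * mu / 2) * x - 3 * mu * y by rewrite mu0; ring.
  exact: z.
- move=> phi tphi; have E := regular_airy_zero Omega_open OM sv tphi.
  have z (x y u : R) : u = 0 -> mu / 3 * x = u - mu / 3 * y by move=> ->; rewrite mu0; ring.
  exact: z.
Qed.
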